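(* Let $f=f(\mathbf x)\in L^\infty$ be a strictly positive source function, and let $\Sigma_a(m)=\sum_{l=0}^L\Sigma_{a,l}(z,\mathbf x)m^l$ and $\widetilde\Sigma_a(m)=\sum_{l=0}^L\widetilde\Sigma_{a,l}(z,\mathbf x)m^l$ be two absorption coefficients. Let $u$ be the solution of $$\begin{aligned} \partial_zu+\mathbf k\cdot\nabla u+\Sigma_a(\langle u\rangle)u+\Sigma_s(\mathcal I-\mathcal K)u&=0&&\text{in }X,\\ u(z,\mathbf x,\mathbf k)&=0&&\text{on }\Gamma_-,\\ u(0,\mathbf x,\mathbf k)&=f(\mathbf x)&&\text{on }X_0, \end{aligned}$$ and let $\widetilde u$ be the solution of the same problem (same $f$, $\Sigma_s$, $\mathcal K$) with $\Sigma_a$ replaced by $\widetilde\Sigma_a$. Assume that each of these problems has a unique positive solution in $\mathcal W_\infty$. Let $g=\langle u\rangle$ and $\widetilde g=\langle\widetilde u\rangle$ be the corresponding data on $(0,T)\times\Omega$. Then $g=\widetilde g$ implies $\Sigma_a(\langle u\rangle)=\widetilde\Sigma_a(\langle\widetilde u\rangle)$.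
   Context: Let $d\ge1$, $T>0$, and let $\Omega\subset\mathbb R^d$ be a bounded convex domain with smooth boundary $\partial\Omega$. $\mathbb S^{d-1}$ is the unit sphere of $\mathbb R^d$. Put $X=(0,T)\times\Omega\times\mathbb S^{d-1}$, $X_0=\Omega\times\mathbb S^{d-1}$, and $\Gamma_-=\{(z,\mathbf x,\mathbf k)\in(0,T)\times\partial\Omega\times\mathbb S^{d-1}:\ \mathbf n_{\mathbf x}\cdot\mathbf k<0\}$, where $\mathbf n_{\mathbf x}$ is the unit outward normal at $\mathbf x\in\partial\Omega$. For a function $u(z,\mathbf x,\mathbf k)$, $\langle u\rangle(z,\mathbf x)=\int_{\mathbb S^{d-1}}u(z,\mathbf x,\mathbf k)\,d\mathbf k$. Absorption: $L\ge0$ is an integer and each of the functions $\Sigma_{a,l}$, $\widetilde\Sigma_{a,l}$ on $(0,T)\times\Omega$ is bounded above and below by positive finite constants. Scattering: $\Sigma_s>0$ is a constant, $\mathcal I$ is the identity and $\mathcal K u(z,\mathbf x,\mathbf k)=\int_{\mathbb S^{d-1}}p(\mathbf k,\mathbf k')u(z,\mathbf x,\mathbf k')\,d\mathbf k'$, where the phase function $p(\mathbf k,\mathbf k')=p(\mathbf k\cdot\mathbf k')$ depends only on $\mathbf k\cdot\mathbf k'$, satisfies $\int_{\mathbb S^{d-1}}p(\mathbf k,\mathbf k')\,d\mathbf k'=1$, and $\underline\theta\le p(\mathbf k,\mathbf k')\le\overline\theta$ for positive constants $\underline\theta,\overline\theta$. $\mathcal W_\infty$ is the space of $u\in L^\infty((0,T)\times\Omega\times\mathbb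 S^{d-1})$ with $\partial_zu+\mathbf k\cdot\nabla u\in L^\infty((0,T)\times\Omega\times\mathbb S^{d-1})$, $u(0,\cdot,\cdot)\in L^\infty(\Omega\times\mathbb S^{d-1})$ and $u|_{\Gamma_-}\in L^\infty(\Gamma_-,|\mathbf n_{\mathbf x}\cdot\mathbf k|\,dz\,d\mathbf k\,dS(\mathbf x))$, with $dS$ the surface measure on $\partial\Omega$. *)

(* Defs.v *)
From HB Require Import structures.
From mathcomp Require Import all_boot all_order all_algebra.
From mathcomp Require Import all_classical all_reals all_analysis.
From mathcomp Require Import measurable_realfun ring lra.

Set Implicit Arguments.
Unset Strict Implicit.
Unset Printing Implicit Defensive.

Import Order.TTheory GRing.Theory Num.Theory.
Import numFieldNormedType.Exports.

Local Open Scope classical_set_scope.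
Local Open Scope ring_scope.

(* The sigma-finite structure that the library declares on [m1 \x m2] is
   shadowed by the one for probability measures, hence the alias. *)
Section sigma_finite_product.
Context d1 d2 (T1 : measurableType d1) (T2 : measurableType d2) (R : realType).
Variable m1 : {sigma_finite_measure set T1 -> \bar R}.
Variable m2 : {sigma_finite_measure set T2 -> \bar R}.

Definition sigma_finite_product : set (T1 * T2) -> \bar R := (m1 \x m2)%E.

HB.instance Definition _ := Measure.on sigma_finite_product.

Let sigma_finite_productT : sigma_finite setT sigma_finite_product.
Proof.
have /sigma_finiteP[F [TF ndF Foo]] := sigma_finiteT m1.
have /sigma_finiteP[G [TG ndG Goo]] := sigma_finiteT m2.
exists (fun n => F n `*` G n).
  rewrite -setXTT TF TG predeqE => -[x y]; split.
    move=> [/= [n _ Fnx] [k _ Gky]]; exists (maxn n k) => //; split.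
    - by move: x Fnx; exact/subsetPset/ndF/leq_maxl.
    - by move: y Gky; exact/subsetPset/ndG/leq_maxr.
  by move=> [n _ []/= ? ?]; split; exists n.
move=> k; have [? ?] := Foo k; have [? ?] := Goo k.
split; first exact: measurableX.
rewrite /sigma_finite_product product_measure1E//.
by rewrite lte_mul_pinfty// ge0_fin_numE.
Qed.

HB.instance Definition _ := Measure_isSigmaFinite.Build _ _ _
  sigma_finite_product sigma_finite_productT.

End sigma_finite_product.

(* 'rV[R]_n carries the product sigma-algebra, which is the Borel one. *)
Definition rV_display : measure_display. Proof. exact. Qed.

Section rV_measurable.
Context {R : realType} (n : nat).

Definition rV_coord (i : 'I_n) (x : 'rV[R]_n) : R := x ord0 i.

Let rV_set0 : g_sigma_preimage rV_coord set0.
Proof. exact: sigma_algebra0. Qed.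

Let rV_setC A : g_sigma_preimage rV_coord A -> g_sigma_preimage rV_coord (~` A).
Proof. exact: sigma_algebraC. Qed.

Let rV_bigcup (F : _^nat) : (forall i, g_sigma_preimage rV_coord (F i)) ->
  g_sigma_preimage rV_coord (\bigcup_i (F i)).
Proof. exact: sigma_algebra_bigcup. Qed.

HB.instance Definition _ := @isMeasurable.Build rV_display
  'rV[R]_n (g_sigma_preimage rV_coord) rV_set0 rV_setC rV_bigcup.

Lemma measurable_rV_coord (i : 'I_n) : measurable_fun setT (rV_coord i).
Proof.
move=> _ Y mY; rewrite setTI; apply: sub_sigma_algebra.
rewrite -bigcup_seq/=; exists i => /=; first by rewrite mem_index_enum.
by exists Y => //; rewrite setTI.
Qed.

Lemma measurable_fun_rVP d (T : measurableType d) (f : T -> 'rV[R]_n) :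
  (forall i, measurable_fun setT (rV_coord i \o f)) -> measurable_fun setT f.
Proof.
move=> mf; apply: (@measurability _ _ _ _ _ _
  (\big[setU/set0]_(i < n) preimage_set_system setT (rV_coord i) measurable)) => //.
move=> _ [A + <-].
rewrite -bigcup_seq/= => -[i _ /= [B mB <-]].
by rewrite !setTI -[X in measurable X]setTI; exact: mf.
Qed.

End rV_measurable.

Section lebesgue_rV.
Context {R : realType}.

Definition rV_cons n (p : R * 'rV[R]_n) : 'rV[R]_n.+1 :=
  \row_i oapp (p.2 ord0) p.1 (unlift ord0 i).

Lemma measurable_rV_cons n : measurable_fun setT (@rV_cons n).
Proof.
apply: measurable_fun_rVP => i.
case: (unliftP ord0 i) => [j|] ->.
- rewrite (_ : _ \o _ = rV_coord j \o snd).
    by apply: measurableT_comp => //; exact: measurable_rV_coord.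
  by apply/funext => -[a v] /=; rewrite /rV_coord mxE liftK.
- rewrite (_ : _ \o _ = fst); first exact: measurable_fst.
  by apply/funext => -[a v] /=; rewrite /rV_coord mxE unlift_none.
Qed.

Fixpoint lebesgue_rV (n : nat) : set 'rV[R]_n -> \bar R :=
  if n is m.+1 then
    pushforward (lebesgue_measure \x @lebesgue_rV m)%E (@rV_cons m)
  else \d_(0 : 'rV[R]_0).

Section pushforward_rV_cons.
Context n
  (m : {sigma_finite_measure set (measurableTypeR R * 'rV[R]_n)%type -> \bar R}).

Let P := pushforward m (@rV_cons n).

Let mcons A : measurable A -> measurable (@rV_cons n @^-1` A).
Proof.
by move=> mA; rewrite -[X in measurable X]setTI; exact: measurable_rV_cons.
Qed.

Let P0 : P set0 = 0%E. Proof. by rewrite /P /pushforward preimage_set0. Qed.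

Let P_ge0 A : (0 <= P A)%E.
Proof. by rewrite /P /pushforward measure_ge0. Qed.

Let P_sigma_additive : semi_sigma_additive P.
Proof.
move=> F mF tF mUF; rewrite /P /pushforward preimage_bigcup.
apply: measure_semi_sigma_additive.
- by move=> k; exact: mcons.
- apply/trivIsetP => /= i j _ _ ij; rewrite -preimage_setI.
  by move/trivIsetP : tF => /(_ _ _ _ _ ij) ->//; rewrite preimage_set0.
- by rewrite -preimage_bigcup; exact: mcons.
Qed.

HB.instance Definition _ := isMeasure.Build _ _ _ P P0 P_ge0 P_sigma_additive.

Let P_sigma_finite : sigma_finite setT P.
Proof.
have /sigma_finiteP[F [TF _ Foo]] := sigma_finiteT m.
pose unc (x : 'rV[R]_n.+1) :=
  (x ord0 ord0, \row_(j < n) x ord0 (lift ord0 j)).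
have consK : cancel (@rV_cons n) unc.
  move=> [a v]; congr pair; first by rewrite mxE unlift_none.
  by apply/rowP => j; rewrite !mxE liftK.
have munc : measurable_fun setT unc.
  apply/measurable_fun_pairP; split; first exact: (measurable_rV_coord ord0).
  apply: measurable_fun_rVP => j.
  rewrite (_ : _ \o _ = rV_coord (lift ord0 j)).
    exact: measurable_rV_coord.
  by apply/funext => x; rewrite /rV_coord /= mxE.
exists (fun k => unc @^-1` F k).
  by rewrite -preimage_bigcup -TF preimage_setT.
move=> k; have [mF Fk] := Foo k; split.
  by rewrite -[X in measurable X]setTI; exact: munc.
rewrite /P /pushforward -comp_preimage (_ : unc \o _ = id) //.
by apply/funext => p /=; rewrite consK.
Qed.

HB.instance Definition _ := Measure_isSigmaFinite.Build _ _ _ P P_sigma_finite.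

Definition rV_cons_measure : {sigma_finite_measure set 'rV[R]_n.+1 -> \bar R} :=
  P.

End pushforward_rV_cons.

Lemma lebesgue_rV_measure n :
  {m : {sigma_finite_measure set 'rV[R]_n -> \bar R} |
    @lebesgue_rV n = m :> (set _ -> _)}.
Proof.
elim: n => [|n [m mE]] /=; first by exists \d_(0 : 'rV[R]_0).
rewrite mE.
by exists (rV_cons_measure (sigma_finite_product lebesgue_measure m)).
Qed.

Section lebesgue_rV_instance.
Variable n : nat.
Let L := @lebesgue_rV n.

Let L0 : L set0 = 0%E.
Proof. by rewrite /L; have [m ->] := lebesgue_rV_measure n. Qed.

Let L_ge0 A : (0 <= L A)%E.
Proof. by rewrite /L; have [m ->] := lebesgue_rV_measure n. Qed.

Let L_sigma_additive : semi_sigma_additive L.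
Proof.
rewrite /L; have [m ->] := lebesgue_rV_measure n.
exact: measure_semi_sigma_additive.
Qed.

HB.instance Definition _ := isMeasure.Build _ _ _ (@lebesgue_rV n)
  L0 L_ge0 L_sigma_additive.

Let L_sigma_finite : sigma_finite setT L.
Proof.
rewrite /L; have [m ->] := lebesgue_rV_measure n; exact: sigma_finiteT.
Qed.

HB.instance Definition _ := Measure_isSigmaFinite.Build _ _ _ (@lebesgue_rV n)
  L_sigma_finite.

End lebesgue_rV_instance.

End lebesgue_rV.
Arguments lebesgue_rV {R} n _.

Section euclidean.
Context {R : realType} {d : nat}.
Implicit Types x y : 'rV[R]_d.

Definition dot x y : R := \sum_(i < d) x ord0 i * y ord0 i.

Definition enorm x : R := Num.sqrt (dot x x).

Definition sphere : set 'rV[R]_d := [set k | enorm k = 1].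

Lemma coord_le_enorm x i : `|x ord0 i| <= enorm x.
Proof.
rewrite -sqrtr_sqr; apply: ler_wsqrtr.
rewrite /dot (bigD1 i) //= -expr2 lerDl; apply: sumr_ge0 => j _.
by rewrite -expr2 sqr_ge0.
Qed.

Lemma measurable_enorm : measurable_fun setT enorm.
Proof.
apply: measurableT_comp.
  by apply: continuous_measurable_fun; exact: sqrt_continuous.
apply: measurable_sum => i.
by apply: measurable_funM; exact: measurable_rV_coord.
Qed.

Lemma measurable_sphere : measurable sphere.
Proof.
rewrite (_ : sphere = enorm @^-1` [set 1]) // -[X in measurable X]setTI.
exact: measurable_enorm.
Qed.

End euclidean.

Section hausdorff.
Local Open Scope ereal_scope.
Context {R : realType} {d : nat}.
Implicit Types (A B F : set 'rV[R]_d) (delta : R).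

Definition ediam F : \bar R :=
  ereal_sup [set (enorm (p.1 - p.2)%R)%:E | p in F `*` F].

(* The normalizing constant is the volume of the unit ball of R^s, divided by
   2 ^ s: the s-dimensional measure is then the surface measure of
   s-dimensional hypersurfaces, and the counting measure when s = 0. *)
Definition ball_volume (s : nat) : R :=
  fine (lebesgue_rV s [set x | (enorm x <= 1)%R]).

(* Sets of diameter greater than [delta] get weight [+oo], so that they do not
   take part in a covering of finite weight. *)
Definition hausdorff_weight (s : nat) delta F : \bar R :=
  if F == set0 then 0
  else if ediam F <= delta%:E
       then (ball_volume s * (fine (ediam F) / 2) ^+ s)%R%:E
       else +oo.

(* [mu_ext] takes the infimum over the countable Borel coverings; this is the
   same as over all coverings, a set having the same diameter as its closure. *)
Definition hausdorff (s : nat) A : \bar R :=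
  ereal_sup [set mu_ext (hausdorff_weight s delta) A
            | delta in [set delta | (0 < delta)%R]].

Lemma ball_volume_ge0 s : (0 <= ball_volume s)%R.
Proof. by rewrite /ball_volume fine_ge0. Qed.

Lemma ediam_ge0 F : F !=set0 -> 0 <= ediam F.
Proof.
move=> [x Fx]; apply: ereal_sup_ubound; exists (x, x) => //=.
by rewrite subrr /enorm /dot big1 ?sqrtr0// => i _; rewrite mxE mul0r.
Qed.

Lemma weight0 s delta : hausdorff_weight s delta set0 = 0.
Proof. by rewrite /hausdorff_weight eqxx. Qed.

Lemma weight_ge0 s delta F : 0 <= hausdorff_weight s delta F.
Proof.
rewrite /hausdorff_weight; case: ifPn => // /set0P F0.
case: ifPn => // _; rewrite lee_fin mulr_ge0 ?ball_volume_ge0// exprn_ge0// divr_ge0//.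
by rewrite fine_ge0 ?ediam_ge0.
Qed.
Hint Resolve weight0 weight_ge0 : core.

Lemma hausdorff0 s : hausdorff s set0 = 0.
Proof.
apply/eqP; rewrite eq_le; apply/andP; split.
  by apply: ge_ereal_sup => _ [delta _ <-]; rewrite mu_ext0.
by apply: ereal_sup_ubound; exists 1%R => //=; rewrite mu_ext0.
Qed.

Lemma le_mu_ext_hausdorff s delta A : (0 < delta)%R ->
  mu_ext (hausdorff_weight s delta) A <= hausdorff s A.
Proof. by move=> delta0; apply: ereal_sup_ubound; exists delta. Qed.

Lemma hausdorff_ge0 s A : 0 <= hausdorff s A.
Proof.
by apply: le_trans (le_mu_ext_hausdorff s A ltr01); exact: mu_ext_ge0.
Qed.

Lemma le_hausdorff s : {homo hausdorff s : A B / A `<=` B >-> A <= B}.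
Proof.
move=> A B AB; apply: ge_ereal_sup => _ [delta delta0 <-].
by apply: le_trans (le_mu_ext_hausdorff s B delta0); exact: le_mu_ext.
Qed.

Lemma hausdorff_sigma_subadditive s : sigma_subadditive (hausdorff s).
Proof.
move=> F; apply: ge_ereal_sup => _ [delta delta0 <-].
apply: le_trans (mu_ext_sigma_subadditive _ _) _ => //.
apply: lee_nneseries => [n _ _|n _]; first exact: mu_ext_ge0.
exact: le_mu_ext_hausdorff.
Qed.

HB.instance Definition _ s := isOuterMeasure.Build R _ (hausdorff s)
  (hausdorff0 s) (hausdorff_ge0 s) (@le_hausdorff s)
  (@hausdorff_sigma_subadditive s).

Lemma mu_ext_separated s delta e A B : (delta < e)%R ->
  (forall x y, A x -> B y -> (e <= enorm (x - y))%R) ->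
  mu_ext (hausdorff_weight s delta) A + mu_ext (hausdorff_weight s delta) B
    <= mu_ext (hausdorff_weight s delta) (A `|` B).
Proof.
move=> deltae AB; apply: le_ereal_inf_tmp => _ [F [mF FAB] <-].
pose part C k := if F k `&` C == set0 then set0 else F k.
have part_cover C : C `<=` A `|` B -> measurable_cover C (part C).
  move=> CAB; split=> [k|x Cx].
    by rewrite /part; case: ifPn => // _; exact: measurable0.
  have [k _ Fkx] := FAB _ (CAB _ Cx); exists k => //; rewrite /part ifN//.
  by apply/set0P; exists x.
have le_part C : C `<=` A `|` B -> mu_ext (hausdorff_weight s delta) C <=
    \sum_(k <oo) hausdorff_weight s delta (part C k).
  by move=> CAB; apply: ereal_inf_lbound; exists (part C) => //; exact: part_cover.
apply: (@le_trans _ _ (\sum_(k <oo) (hausdorff_weight s delta (part A k) +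
    hausdorff_weight s delta (part B k)))).
  rewrite nneseriesD//; apply: leeD; apply: le_part; [exact: subsetUl|exact: subsetUr].
apply: lee_nneseries => k _ //; first by move=> _; rewrite adde_ge0.
rewrite /part; case: ifPn => [_|/set0P[x [Fx Ax]]].
  by rewrite weight0 add0e; case: ifPn => // _; rewrite weight0.
case: ifPn => [_|/set0P[y [Fy By]]]; first by rewrite weight0 adde0.
rewrite [leRHS]/hausdorff_weight ifN; last by apply/set0P; exists x.
case: ifPn => [diamF|_]; last by rewrite leey.
have : ((enorm (x - y))%:E <= delta%:E).
  by apply: le_trans diamF; apply: ereal_sup_ubound; exists (x, y).
by rewrite lee_fin => /(le_trans (AB _ _ Ax By)); rewrite leNgt deltae.
Qed.

Lemma le_hausdorff_weight s delta delta' F : (delta <= delta')%R ->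
  hausdorff_weight s delta' F <= hausdorff_weight s delta F.
Proof.
move=> dd; rewrite /hausdorff_weight; case: ifPn => // _.
case: (boolP (ediam F <= delta%:E)) => [h|_]; last by rewrite leey.
by rewrite (le_trans h)// lee_fin.
Qed.

Lemma le_mu_ext_weight s delta delta' A : (delta <= delta')%R ->
  mu_ext (hausdorff_weight s delta') A <= mu_ext (hausdorff_weight s delta) A.
Proof.
move=> dd; apply: le_ereal_inf_tmp => _ [F mF <-].
apply: ge_ereal_inf; exists (\sum_(k <oo) hausdorff_weight s delta' (F k)).
  by exists F.
by apply: lee_nneseries => // k _; exact: le_hausdorff_weight.
Qed.

Lemma hausdorff_separated s (e : R) A B : (0 < e)%R ->
  (forall x y, A x -> B y -> (e <= enorm (x - y))%R) ->
  hausdorff s A + hausdorff s B <= hausdorff s (A `|` B).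
Proof.
move=> e0 AB.
have [->|ABoo] := eqVneq (hausdorff s (A `|` B)) +oo; first exact: leey.
have fin C : C `<=` A `|` B -> hausdorff s C \is a fin_num.
  move=> CAB; rewrite ge0_fin_numE ?hausdorff_ge0//.
  by apply: le_lt_trans (le_hausdorff s CAB) _; rewrite ltey.
have fA := fin _ (@subsetUl _ A B); have fB := fin _ (@subsetUr _ A B).
rewrite -leeBrDr//; apply: ge_ereal_sup => _ [delta1 /= d10 <-].
have fA1 : mu_ext (hausdorff_weight s delta1) A \is a fin_num.
  rewrite ge0_fin_numE ?mu_ext_ge0//.
  apply: le_lt_trans (le_mu_ext_hausdorff s A d10) _.
  by rewrite -ge0_fin_numE ?hausdorff_ge0.
rewrite leeBrDr// addeC -leeBrDr//; apply: ge_ereal_sup => _ [delta2 /= d20 <-].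
rewrite leeBrDr//.
pose delta : R := Num.min (e / 2)%R (Num.min delta1 delta2).
have delta0 : (0 < delta)%R by rewrite !lt_min d10 d20 divr_gt0.
have deltae : (delta < e)%R.
  by rewrite gt_min ltr_pdivrMr// ltr_pMr// ltr1n.
apply: le_trans (le_mu_ext_hausdorff s _ delta0).
apply: le_trans (mu_ext_separated s deltae AB); rewrite addeC; apply: leeD.
  by apply: le_mu_ext_weight; rewrite !ge_min lexx orbT.
by apply: le_mu_ext_weight; rewrite !ge_min lexx !orbT.
Qed.

Lemma caratheodory_half_space s (i : 'I_d) (a : R) :
  (hausdorff s).-caratheodory [set x : 'rV[R]_d | (a < x ord0 i)%R].
Proof.
apply: le_caratheodory_measurable => X /=.
set P := [set x | _].
have [->|Xoo] := eqVneq (hausdorff s X) +oo; first exact: leey.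
have Xlt : hausdorff s X < +oo by rewrite ltey.
have fin C : C `<=` X -> hausdorff s C \is a fin_num.
  move=> CX; rewrite ge0_fin_numE ?hausdorff_ge0//.
  exact: le_lt_trans (le_hausdorff s CX) _.
pose r (k : nat) : R := (a + k.+1%:R^-1)%R.
have r_lt k l : (k < l)%N -> (r l < r k)%R.
  by move=> kl; rewrite ltrD2l ltf_pV2 ?posrE// ltr_nat.
pose A k := X `&` [set x | (r k < x ord0 i)%R].
pose D k := X `&` [set x | (r k.+1 < x ord0 i <= r k)%R].
have sep k l (x y : 'rV[R]_d) : (k < l)%N -> (r k < x ord0 i)%R ->
    (y ord0 i <= r l)%R -> (r k - r l <= enorm (x - y))%R.
  move=> kl rx ry; apply: le_trans (coord_le_enorm _ i); rewrite !mxE.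
  by apply: le_trans (ler_norm _); rewrite lerB// ltW.
have sumD n : \sum_(0 <= k < n) hausdorff s (D k.+1) <=
    hausdorff s (A n) + hausdorff s (A n.+1).
  elim: n => [|n ih]; first by rewrite big_geq// adde_ge0// hausdorff_ge0.
  rewrite big_nat_recr//=; apply: le_trans (leeD ih (lexx _)) _.
  rewrite -addeA [leLHS]addeCA; apply: leeD => //.
  apply: le_trans (@hausdorff_separated s (r n - r n.+1) _ _ _ _) _.
  - by rewrite subr_gt0 r_lt.
  - by move=> x y [_ /= rx] [_ /andP[_ ry]]; exact: sep.
  - apply: le_hausdorff => x [[Xx /= rx]|[Xx /andP[rx _]]]; split => //=.
    by apply: lt_trans rx; exact: r_lt (ltnW _).
have D_summable : \sum_(0 <= k <oo) hausdorff s (D k.+1) < +oo.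
  apply: (@le_lt_trans _ _ (hausdorff s X + hausdorff s X)).
    apply: lime_le; first by apply: is_cvg_nneseries => k _ _; exact: hausdorff_ge0.
    apply: nearW => n; apply: le_trans (sumD n) _.
    by apply: leeD; apply: le_hausdorff => x [].
  by rewrite -ge0_fin_numE ?adde_ge0 ?hausdorff_ge0// fin_numD !fin.
apply/lee_addgt0Pr => e e0.
have [N _ tailN] : exists2 N, True &
    \sum_(N <= k <oo) hausdorff s (D k.+1) <= e%:E.
  have := nneseries_tail_cvg D_summable (fun k _ => hausdorff_ge0 s (D k.+1)).
  move=> /fine_cvgP[fin_tail] /cvgrPdist_le /(_ e e0) tail.
  near \oo => N; exists N => //.
  have fN : \sum_(N <= k <oo) hausdorff s (D k.+1) \is a fin_num by near: N.
  rewrite -(fineK fN) lee_fin.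
  have : (`|0 - fine (\sum_(N <= k <oo) hausdorff s (D k.+1))| <= e)%R.
    by near: N.
  by rewrite sub0r normrN; apply: le_trans; exact: ler_norm.
have XP : X `&` P `<=` A N.+1 `|` \bigcup_k D (k + N).+1.
  move=> x [Xx /= ax]; have [rx|xr] := ltP (r N.+1) (x ord0 i); first by left.
  right; have rx : exists k, (r k < x ord0 i)%R.
    by have [k kx] := ltr_add_invr ax; exists k.
  case: (ex_minnP rx) => -[|m] rm min_m.
    by have := lt_le_trans rm xr; rewrite ltNge ltW// r_lt.
  have mN : (N < m)%N.
    rewrite ltnNge; apply/negP; rewrite -ltnS leq_eqVlt => /orP[/eqP[mN]|mN].
      by have := lt_le_trans rm xr; rewrite mN ltxx.
    have := lt_le_trans rm xr.
    by rewrite ltNge ltW// r_lt.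
  exists (m - N.+1)%N => //; rewrite -addnS subnK//; split => //=.
  rewrite rm /= leNgt; apply/negP => /min_m; by rewrite ltnn.
have sepN : hausdorff s (A N.+1) + hausdorff s (X `&` ~` P) <= hausdorff s X.
  apply: le_trans (@hausdorff_separated s (r N.+1 - a) _ _ _ _) _.
  - by rewrite /r addrAC subrr add0r invr_gt0.
  - move=> x y [_ /= rx] [_ /negP]; rewrite -leNgt => ya.
    apply: le_trans (coord_le_enorm _ i); rewrite !mxE.
    by apply: le_trans (ler_norm _); rewrite lerB// ltW.
  - by apply: le_hausdorff => x [[]|[]].
apply: le_trans (leeD sepN tailN).
rewrite addeAC; apply: leeD => //.
apply: le_trans (le_hausdorff s XP) _.
apply: le_trans (outer_measureU2 (hausdorff s) _ _) _; apply: leeD => //=.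
apply: le_trans (hausdorff_sigma_subadditive s (fun k => D (k + N).+1)) _.
rewrite (@nneseries_addn _ (fun k => hausdorff s (D k.+1)) N)// => k.
exact: hausdorff_ge0.
Unshelve. all: by end_near. Qed.

Lemma caratheodory_measurable_rV s A : measurable A ->
  (hausdorff s).-caratheodory A.
Proof.
pose T := caratheodory_type (hausdorff s : {outer_measure set 'rV[R]_d -> \bar R}).
suff : measurable_fun setT (id : T -> 'rV[R]_d).
  by move=> /(_ measurableT A) + mA => /(_ mA); rewrite setTI.
apply: measurable_fun_rVP => i.
apply: (measurability _ (RGenOInfty.measurableE R)) => _ [_ [a ->] <-].
rewrite setTI (_ : _ @^-1` _ = [set x : 'rV[R]_d | (a < x ord0 i)%R]).
  exact: caratheodory_half_space.
by apply/seteqP; split => x /=; rewrite in_itv/= andbT.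
Qed.

Lemma hausdorff_semi_sigma_additive s :
  semi_sigma_additive (hausdorff s : set 'rV[R]_d -> \bar R).
Proof.
move=> F mF tF mUF.
by apply: (@caratheodory_measure_sigma_additive R _ (hausdorff s)) => // [k|];
  exact: caratheodory_measurable_rV.
Qed.

HB.instance Definition _ s := isMeasure.Build _ _ _ (hausdorff s)
  (hausdorff0 s) (hausdorff_ge0 s) (@hausdorff_semi_sigma_additive s).

End hausdorff.

Section hausdorff_sphere.
Context {R : realType} {d : nat}.
Implicit Types x y : 'rV[R]_d.

Variable N : nat.

Definition sphere_cell (c : 'I_d * bool * {ffun 'I_d.-1 -> 'I_N}) :
    set 'rV[R]_d :=
  sphere `&` [set x | 1 <= d%:R * x ord0 c.1.1 ^+ 2
                   /\ 0 <= (-1) ^+ c.1.2 * x ord0 c.1.1] `&`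
  \bigcap_(j in [set: 'I_d.-1])
    [set x | 2 * (c.2 j)%:R <= N%:R * (x ord0 (lift c.1.1 j) + 1)
                            <= 2 * (c.2 j).+1%:R].

Lemma measurable_sphere_cell c : measurable (sphere_cell c).
Proof.
pose f1 x := d%:R * x ord0 c.1.1 ^+ 2.
pose f2 x := (-1) ^+ c.1.2 * x ord0 c.1.1.
pose f3 j x := N%:R * (x ord0 (lift c.1.1 j) + 1).
have mc i : measurable_fun setT (fun x : 'rV[R]_d => x ord0 i).
  exact: measurable_rV_coord.
have m1 : measurable_fun setT f1.
  by apply: measurable_funM => //; exact: measurable_funX.
have m2 : measurable_fun setT f2 by apply: measurable_funM.
have m3 j : measurable_fun setT (f3 j).
  by apply: measurable_funM => //; exact: measurable_funD.
apply: measurableI; [apply: measurableI|].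
- exact: measurable_sphere.
- rewrite [X in measurable X](_ : _ = f1 @^-1` `[1, +oo[ `&` f2 @^-1` `[0, +oo[).
    by apply: measurableI; rewrite -[X in measurable X]setTI; [exact: m1|exact: m2].
  by apply/seteqP; split => x /=; rewrite !in_itv/= !andbT.
- apply: fin_bigcap_measurable => // j _.
  rewrite [X in measurable X](_ : _ = f3 j @^-1` `[2 * (c.2 j)%:R, 2 * (c.2 j).+1%:R]).
    by rewrite -[X in measurable X]setTI; exact: m3.
  by apply/seteqP; split => x /=; rewrite in_itv.
Qed.

Lemma sphere_sum x : sphere x -> \sum_i x ord0 i ^+ 2 = 1.
Proof.
rewrite /sphere /= /enorm => /(congr1 (fun t => t ^+ 2)).
rewrite sqr_sqrtr ?expr1n; last first.
  by apply: sumr_ge0 => i _; rewrite -expr2 sqr_ge0.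
by move=> <-; apply: eq_bigr => i _; rewrite expr2.
Qed.

Lemma sphere_coord x i : sphere x -> `|x ord0 i| <= 1.
Proof. by move=> <-; exact: coord_le_enorm. Qed.

Hypothesis N0 : (0 < N)%N.

Lemma sphere_cell_cover : sphere `<=` \bigcup_c (@sphere_cell c).
Proof.
move=> x sx.
have [i xi] : exists i, 1 <= d%:R * x ord0 i ^+ 2.
  apply/not_existsP => h.
  have lt1 i : d%:R * x ord0 i ^+ 2 < 1.
    by rewrite ltNge; apply/negP; exact: h.
  have d0 : (0 < d)%N.
    case: (posnP d) => // d0; have := sphere_sum sx.
    rewrite big1; first by move=> /eqP; rewrite eq_sym oner_eq0.
    by move=> j; have := ltn_ord j; rewrite {2}d0.
  have : \sum_i d%:R * x ord0 i ^+ 2 < \sum_(i < d) (1 : R).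
    apply: ltr_sum => //; apply/hasP.
    by exists (Ordinal d0) => //; rewrite mem_index_enum.
  rewrite -mulr_sumr (sphere_sum sx) mulr1 sumr_const card_ord.
  by rewrite ltxx.
have grid j : exists m : 'I_N,
    2 * m%:R <= N%:R * (x ord0 (lift i j) + 1) <= 2 * m.+1%:R.
  set y := x ord0 _.
  have /andP[y1 y2] : -1 <= y <= 1 by rewrite -ler_norml; exact: sphere_coord.
  have NR : (0 : R) < N%:R by rewrite ltr0n.
  pose t := N%:R * (y + 1) / 2.
  have t0 : 0 <= t by rewrite /t divr_ge0// mulr_ge0// -lerBlDr sub0r.
  have tN : t <= N%:R.
    by rewrite /t ler_pdivrMr// ler_pM2l//; lra.
  have /andP[mt tm] := truncn_itv t0.
  have te : N%:R * (y + 1) = 2 * t by rewrite /t; field.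
  rewrite te.
  have [mN|Nm] := ltnP (Num.truncn t) N.
    exists (Ordinal mN) => /=; rewrite !ler_pM2l// mt /=; exact: ltW.
  have mN : (N.-1 < N)%N by rewrite prednK.
  exists (Ordinal mN) => /=; rewrite !ler_pM2l// prednK// tN andbT.
  by apply: le_trans mt; rewrite ler_nat (leq_trans (leq_pred N)).
have [g gP] := choice grid.
exists (i, (x ord0 i < 0), [ffun j => g j]) => //.
split; [split => //|].
  split => //=; case: ltP => xi0; rewrite ?expr1 ?mulN1r ?oppr_ge0 ?mul1r//.
  exact: ltW.
by move=> j _ /=; rewrite ffunE; exact: gP.
Qed.

Lemma sphere_cell_dist c x y : sphere_cell c x -> sphere_cell c y ->
  enorm (x - y) <= (2 * d%:R ^+ 3) / N%:R.
Proof.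
case: c => [[i b] g] [[sx [/= x1 x2]] xg] [[sy [/= y1 y2]] yg].
have NR : (0 : R) < N%:R by rewrite ltr0n.
have d1 : (1 : R) <= d%:R.
  by rewrite ler1n (leq_ltn_trans _ (ltn_ord i)).
have d_gt0 : (0 : R) < d%:R by exact: lt_le_trans d1.
have oth l : l != i -> `|x ord0 l - y ord0 l| <= 2 / N%:R.
  move=> li; case: (unliftP i l) li => [j ->|->]; last by rewrite eqxx.
  move=> _; have /andP[a1 a2] := xg j I; have /andP[b1 b2] := yg j I.
  rewrite ler_pdivlMr// -[X in _ * X](gtr0_norm NR) -normrM ler_norml.
  move: a1 a2 b1 b2 => /=; rewrite -!natr1; move: (x _ _) (y _ _) (N%:R) => u v w.
  by move: ((g j)%:R : R) => m *; apply/andP; split; lra.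
have {x2 y2} sumxy : 2 / d%:R <= `|x ord0 i + y ord0 i|.
  have lb (z : R) : 1 <= d%:R * z ^+ 2 -> d%:R^-1 <= `|z|.
    move=> z1; rewrite -(ler_pM2r d_gt0) mulVf ?gt_eqF//.
    have : 1 <= (`|z| * d%:R) ^+ 2.
      rewrite exprMn real_normK ?num_real//.
      apply: le_trans z1 _; rewrite mulrC [d%:R ^+ 2]expr2 mulrA ler_peMr//.
      by rewrite mulr_ge0// ?sqr_ge0// (le_trans _ d1).
    by rewrite expr_ge1// mulr_ge0// (le_trans _ d1).
  have := lb _ x1; have := lb _ y1.
  have -> : `|x ord0 i + y ord0 i| = `|x ord0 i| + `|y ord0 i|.
    case: b x2 y2 => /=; rewrite ?expr1 ?expr0 ?mulN1r ?mul1r ?oppr_ge0 => x2 y2.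
      by rewrite !ler0_norm ?opprD//; lra.
    by rewrite !ger0_norm//; lra.
  by move=> ??; rewrite mulrDl mul1r lerD.
have same : `|x ord0 i - y ord0 i| <= 2 * d%:R ^+ 2 / N%:R.
  have eqp : (x ord0 i - y ord0 i) * (x ord0 i + y ord0 i) =
      \sum_(l | l != i) (y ord0 l ^+ 2 - x ord0 l ^+ 2).
    have := sphere_sum sx; have := sphere_sum sy.
    rewrite (bigD1 i)//= => ey; rewrite (bigD1 i)//= => ex.
    rewrite sumrB -subr_sqr; lra.
  have : `|x ord0 i - y ord0 i| * (2 / d%:R) <= d%:R * (4 / N%:R).
    apply: (@le_trans _ _ (`|x ord0 i - y ord0 i| * `|x ord0 i + y ord0 i|)).
      by rewrite ler_wpM2l.
    rewrite -normrM eqp; apply: le_trans (ler_norm_sum _ _ _) _.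
    apply: (@le_trans _ _ (\sum_(l < d | l != i) (4 / N%:R))).
      apply: ler_sum => l li; rewrite subr_sqr normrM distrC.
      rewrite (_ : 4 / N%:R = (2 / N%:R) * 2); last by field; rewrite gt_eqF.
      apply: ler_pM => //; first exact: oth.
      apply: le_trans (ler_normD _ _) _.
      by have := sphere_coord l sx; have := sphere_coord l sy; lra.
    rewrite sumr_const -[leLHS]mulr_natl ler_wpM2r ?divr_ge0//.
    by rewrite ler_nat -[leqRHS]card_ord max_card.
  have d20 : (0 : R) <= d%:R / 2 by rewrite divr_ge0.
  move=> /(ler_wpM2r d20).
  rewrite (_ : _ * (2 / d%:R) * _ = `|x ord0 i - y ord0 i|); last first.
    by field; rewrite gt_eqF.
  rewrite (_ : d%:R * (4 / N%:R) * _ = 2 * d%:R ^+ 2 / N%:R)//.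
  by field; rewrite gt_eqF.
pose M : R := 2 * d%:R ^+ 2 / N%:R.
have M0 : 0 <= M by rewrite /M divr_ge0 ?mulr_ge0 ?exprn_ge0.
have allM l : `|(x - y) ord0 l| <= M.
  rewrite !mxE; have [->//|li] := eqVneq l i.
  apply: le_trans (oth l li) _; rewrite /M ler_pM2r ?invr_gt0//.
  by rewrite ler_peMr// expr_ge1// ltW// (lt_le_trans _ d1).
rewrite (_ : 2 * _ / _ = d%:R * M); last by rewrite /M; field; rewrite gt_eqF.
have dM : 0 <= d%:R * M by rewrite mulr_ge0// (le_trans _ d1).
rewrite -(ger0_norm dM) -sqrtr_sqr; apply: ler_wsqrtr.
apply: (@le_trans _ _ (\sum_(l < d) M ^+ 2)).
  apply: ler_sum => l _; rewrite -expr2 -[leLHS]real_normK ?num_real//.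
  by rewrite lerXn2r ?nnegrE.
rewrite sumr_const card_ord -[leLHS]mulr_natl.
rewrite [leRHS]exprMn ler_wpM2r ?sqr_ge0//.
by rewrite expr2 ler_peMr// (le_trans _ d1).
Qed.

End hausdorff_sphere.

Lemma hausdorff_sphere_lty {R : realType} {d : nat} :
  (hausdorff d.-1 (@sphere R d) < +oo)%E.
Proof.
pose C : R := 2 * d%:R ^+ 3; have C0 : 0 <= C by rewrite mulr_ge0// exprn_ge0.
pose b : R := ball_volume d.-1.
have b0 : 0 <= b by exact: ball_volume_ge0.
pose I N : finType := ('I_d * bool * {ffun 'I_d.-1 -> 'I_N})%type.
apply: (@le_lt_trans _ _ ((d * 2)%:R * (b * (C / 2) ^+ d.-1))%:E); last first.
  exact: ltry.
apply: ge_ereal_sup => _ [delta /= delta0 <-].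
have [N N0 NC] : exists2 N, (0 < N)%N & C / N%:R <= delta.
  exists (Num.truncn (C / delta)).+1 => //.
  rewrite ler_pdivrMr// mulrC -ler_pdivrMr//.
  by have /andP[_ /ltW] := truncn_itv (divr_ge0 C0 (ltW delta0)).
have NR : (0 : R) < N%:R by rewrite ltr0n.
pose F k : set 'rV[R]_d :=
  oapp (@sphere_cell R d N) set0 (nth None (map some (enum (I N))) k).
have sizeE : size (map some (enum (I N))) = #|I N|.
  by rewrite size_map -cardE.
apply: ge_ereal_inf; exists (\sum_(k <oo) hausdorff_weight d.-1 delta (F k))%E.
  exists F => //; split=> [k|x sx].
    rewrite /F; case: nth => [c|]/=; last exact: measurable0.
    exact: measurable_sphere_cell.
  have [c _ cx] := sphere_cell_cover N0 sx.
  have cI : (index c (enum (I N)) < size (enum (I N)))%N.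
    by rewrite index_mem mem_enum.
  exists (index c (enum (I N))) => //.
  by rewrite /F (nth_map c)//= nth_index ?mem_enum.
have wF c : (hausdorff_weight d.-1 delta (@sphere_cell R d N c) <=
    (b * (C / 2 / N%:R) ^+ d.-1)%:E)%E.
  rewrite /hausdorff_weight; case: ifPn => [_|/set0P c0].
    by rewrite lee_fin mulr_ge0// exprn_ge0// !divr_ge0.
  have diamC : (ediam (@sphere_cell R d N c) <= (C / N%:R)%:E)%E.
    apply: ge_ereal_sup => _ [[x y] [/= cx cy] <-].
    by rewrite lee_fin; exact: (sphere_cell_dist N0 cx cy).
  rewrite ifT; last by rewrite (le_trans diamC)// lee_fin.
  have diam0 := ediam_ge0 c0.
  have fdiam : ediam (@sphere_cell R d N c) \is a fin_num.
    by rewrite ge0_fin_numE// (le_lt_trans diamC)// ltry.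
  rewrite lee_fin ler_wpM2l// lerXn2r ?nnegrE ?divr_ge0 ?fine_ge0//.
  rewrite mulrAC ler_pM2r ?invr_gt0//.
  by rewrite -lee_fin fineK.
rewrite (nneseries_split 0 #|I N|); last by move=> k _; exact: weight_ge0.
rewrite [X in (_ + X)%E]eseries0 ?adde0; last first.
  by move=> k /= Ik _; rewrite /F nth_default ?sizeE//= weight0.
apply: (@le_trans _ _ (\sum_(0 <= k < 0 + #|I N|)
    (b * (C / 2 / N%:R) ^+ d.-1)%:E)%E).
  rewrite !big_nat; apply: lee_sum => k /andP[_ kI].
  rewrite /F; case: nth => [c|] /=; first exact: wF.
  by rewrite weight0 lee_fin mulr_ge0// exprn_ge0// !divr_ge0.
rewrite add0n sumEFin big_const_nat subn0 iter_addr_0 lee_fin.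
rewrite !card_prod card_bool card_ffun !card_ord.
rewrite -[leLHS]mulr_natl natrM natrX expr_div_n.
rewrite le_eqVlt; apply/orP; left; apply/eqP.
by field; rewrite expf_neq0// gt_eqF.
Qed.

Section phase_space.
Context (R : realType) (d : nat).

(* surface measure of the unit sphere *)
Definition sphere_measure : set 'rV[R]_d -> \bar R :=
  mrestr (hausdorff d.-1) measurable_sphere.

HB.instance Definition _ := Measure.on sphere_measure.

Let sphere_measure_fin : fin_num_fun sphere_measure.
Proof.
move=> A mA; rewrite ge0_fin_numE//.
apply: le_lt_trans hausdorff_sphere_lty.
by rewrite /sphere_measure /mrestr; apply: le_hausdorff => x [].
Qed.

HB.instance Definition _ := Measure_isFinite.Build _ _ _
  sphere_measure sphere_measure_fin.

Definition spacetime_measure : set (measurableTypeR R * 'rV[R]_d)%type -> \bar R :=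
  sigma_finite_product lebesgue_measure (lebesgue_rV d).

HB.instance Definition _ := SigmaFiniteMeasure.on spacetime_measure.

Definition initial_measure : set ('rV[R]_d * 'rV[R]_d)%type -> \bar R :=
  sigma_finite_product (lebesgue_rV d) sphere_measure.

HB.instance Definition _ := SigmaFiniteMeasure.on initial_measure.

Definition phase_measure : set (measurableTypeR R * 'rV[R]_d * 'rV[R]_d)%type -> \bar R :=
  sigma_finite_product spacetime_measure sphere_measure.

HB.instance Definition _ := SigmaFiniteMeasure.on phase_measure.

End phase_space.
Arguments sphere_measure {R d} _.
Arguments spacetime_measure {R d} _.
Arguments initial_measure {R d} _.
Arguments phase_measure {R d} _.

Section domain.
Context {R : realType} {d : nat}.
Implicit Types (Omega : set 'rV[R]_d) (x n : 'rV[R]_d).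

(* All iterated directional derivatives exist and are continuous. *)
Definition smooth (V : normedModType R) (f : V -> R) : Prop :=
  forall vs : seq V, let g := foldr (fun v h => 'D_v h) f vs in
    continuous g /\ forall y v : V, derivable g y v.

Definition gradient (f : 'rV[R]_d -> R) x : 'rV[R]_d :=
  \row_i 'D_(delta_mx ord0 i) f x.

Definition boundary Omega : set 'rV[R]_d := closure Omega `\` Omega°.

Definition local_defining_function Omega x (rho : 'rV[R]_d -> R) : Prop :=
  smooth rho /\
  exists U : set 'rV[R]_d, [/\ open U, U x &
    forall y, U y -> (Omega y <-> rho y < 0) /\ gradient rho y != 0].

Definition smooth_boundary Omega : Prop :=
  forall x, boundary Omega x -> exists rho, local_defining_function Omega x rho.

Definition bounded_convex_smooth_domain Omega : Prop :=
  [/\ open Omega, Omega !=set0, bounded_set Omega,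
      convex_set (Omega : set (convex_lmodType 'rV[R]_d))
    & smooth_boundary Omega].

Definition outward_normal Omega x n : Prop :=
  exists2 rho, local_defining_function Omega x rho
    & n = (enorm (gradient rho x))^-1 *: gradient rho x.

Definition normal Omega x : 'rV[R]_d :=
  xget 0 [set n | outward_normal Omega x n].

End domain.

Definition Linfty d (X : measurableType d) (R : realType)
    (mu : set X -> \bar R) (D : set X) (f : X -> R) : Prop :=
  measurable_fun D f /\ exists M : R, {ae mu, forall x, D x -> `|f x| <= M}.

Section transport.
Context {R : realType} {d : nat}.
Variables (T : R) (Omega : set 'rV[R]_d).
Local Notation space := 'rV[R]_d.
Implicit Types (u w : R * space * space -> R) (phi : R * space * space -> R).

Definition spacetime : set (R * space) := `]0, T[ `*` Omega.

Definition phase_space : set (R * space * space) := spacetime `*` sphere.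

Definition initial_space : set (space * space) := Omega `*` sphere.

Definition inflow : set (R * space * space) :=
  [set p | [/\ `]0, T[%classic p.1.1, boundary Omega p.1.2, sphere p.2
             & dot (normal Omega p.1.2) p.2 < 0]].

(* |n_x . k| dz dk dS(x) on the inflow boundary, dS being the
   (d-1)-dimensional Hausdorff measure *)
Definition inflow_measure (A : set (R * space * space)) : \bar R :=
  (\int[lebesgue_measure]_(z in `]0%R, T[) \int[sphere_measure]_(k in sphere)
   \int[hausdorff d.-1]_(x in boundary Omega)
     (`|dot (normal Omega x) k| * \1_(A `&` inflow) (z, x, k))%:E)%E.

(* The restrictions to [phase_space] of these functions are the smooth
   functions with compact support in (0,T) x Omega x S^(d-1). *)
Definition test_function phi : Prop :=
  smooth phi /\ exists K : set (R * space * space),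
    [/\ compact K, K `<=` spacetime `*` setT & forall p, ~ K p -> phi p = 0].

(* [w] is d_z u + k . grad u in the sense of distributions; the directional
   derivative of [phi] along (1, k, 0) is d_z phi + k . grad phi. *)
Definition transport_derivative u w : Prop :=
  forall phi, test_function phi ->
    (\int[phase_measure]_(p in phase_space) (u p * 'D_(1, p.2, 0) phi p))%R =
    - (\int[phase_measure]_(p in phase_space) (w p * phi p))%R.

Definition ess_cvg_right0 (g : R -> R) (l : R) : Prop :=
  forall e, 0 < e -> exists2 delta, 0 < delta &
    {ae lebesgue_measure, forall s, 0 < s < delta -> `|g s - l| < e}.

(* Traces are essential limits along the characteristics; they depend only on
   the class of [u] modulo null sets of [phase_space]. *)
Definition initial_trace u (h : space * space -> R) : Prop :=
  {ae initial_measure, forall q, initial_space q ->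
    ess_cvg_right0 (fun s => u (s, q.1 + s *: q.2, q.2)) (h q)}.

Definition inflow_trace u (h : R * space * space -> R) : Prop :=
  {ae inflow_measure, forall p, inflow p ->
    ess_cvg_right0 (fun s => u (p.1.1 + s, p.1.2 + s *: p.2, p.2)) (h p)}.

Definition W_infty u : Prop :=
  [/\ Linfty phase_measure phase_space u,
      exists2 w, transport_derivative u w & Linfty phase_measure phase_space w,
      exists2 h, initial_trace u h & Linfty initial_measure initial_space h
    & exists2 h, inflow_trace u h & Linfty inflow_measure inflow h].

Definition average u (q : R * space) : R :=
  (\int[sphere_measure]_(k in sphere) u (q, k))%R.

Definition scattering (p : R -> R) u (q : R * space * space) : R :=
  (\int[sphere_measure]_(k in sphere) (p (dot q.2 k) * u (q.1, k)))%R.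

Definition absorption L (Sigma : 'I_L.+1 -> R * space -> R)
    (m : R * space -> R) (q : R * space) : R :=
  \sum_(l < L.+1) Sigma l q * m q ^+ l.

Definition absorption_coefficient (S : R * space -> R) : Prop :=
  measurable_fun spacetime S /\ exists c C : R, 0 < c /\
    {ae spacetime_measure, forall q, spacetime q -> c <= S q <= C}.

Definition phase_function (p : R -> R) : Prop :=
  [/\ measurable_fun (`[-1, 1]%classic : set R) p,
      exists theta0 theta1 : R, 0 < theta0 /\
        forall k k' : space, sphere k -> sphere k' ->
          theta0 <= p (dot k k') <= theta1
    & forall k : space, sphere k ->
        (\int[sphere_measure]_(k' in sphere) p (dot k k'))%R = 1].

Section problem.
Variables (L : nat) (Sigma : 'I_L.+1 -> R * space -> R).
Variables (Sigma_s : R) (p : R -> R) (f : space -> R).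

Definition solution u : Prop :=
  [/\ W_infty u,
      exists w, [/\ transport_derivative u w, Linfty phase_measure phase_space w
        & {ae phase_measure, forall q, phase_space q ->
            w q + absorption Sigma (average u) q.1 * u q
              + Sigma_s * (u q - scattering p u q) = 0}],
      inflow_trace u (fun=> 0)
    & initial_trace u (fun q => f q.1)].

Definition positive_solution u : Prop :=
  solution u /\ {ae phase_measure, forall q, phase_space q -> 0 < u q}.

Definition unique_positive_solution u : Prop :=
  positive_solution u /\ forall v, positive_solution v ->
    {ae phase_measure, forall q, phase_space q -> v q = u q}.

End problem.

End transport.

(* Main.v *)
Require Import Defs.
From HB Require Import structures.
From mathcomp Require Import all_boot all_order all_algebra.
From mathcomp Require Import all_classical all_reals all_analysis.
From mathcomp Require Import measurable_realfun ring lra.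

Set Implicit Arguments.
Unset Strict Implicit.
Unset Printing Implicit Defensive.

Import Order.TTheory GRing.Theory Num.Theory.
Import numFieldNormedType.Exports.

Local Open Scope classical_set_scope.
Local Open Scope ring_scope.

(** Let u and v be the solutions for the two absorption coefficients A and tA,
    with derivatives w and z along the characteristics. They are compared by
    the relative entropy F = u - v + v ln (v / u), which is nonnegative and
    vanishes only where u = v. Along a characteristic its derivative is
    DF = (1 - v / u) w + ln (v / u) z, and the integral of DF over the phase
    space is estimated twice.

    At a fixed time and position, insert the two equations into DF and
    integrate over the sphere of directions. As the averages of u and v agree,
    the absorption terms give - tA times the integral of F and the terms with
    u - v cancel. The scattering terms give at most zero: F is the supremum
    over q > 0 of the functions (1 - q) u + (ln q) v, which are linear in
    (u, v), and scattering averages them with a symmetric probability kernel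
    ([fiber_dissipation]). So the integral of DF is at most - al times that of
    F, where al > 0 is a lower bound of tA.

    On a characteristic, u and v have the same initial or inflow trace, so F
    starts from 0, and the integral of DF is its nonnegative terminal value
    ([line_entropy_production]). Both estimates force F = 0, that is u = v
    ([solutions_equal]). Then the derivatives w and z agree as well
    ([transport_derivative_unique]), and the difference of the equations is
    (A - tA) u = 0 with u > 0 ([absorptions_equal]).

    Three points need care. The derivative is a distribution, and it has to be
    turned into increments along almost every characteristic
    ([characteristic_representation]). The quotient u / v must be bounded away
    from 0 and infinity for F and DF to be bounded; as the solutions have the
    same average and the phase function lies between positive constants, the
    scattering terms dominate each other, and an exponential weight propagates
    the comparison from the start of each line ([line_ratio]). Finally, the
    inflow trace is known up to sets that are null for |n . k| dS, and almost
    every line has to enter the domain outside of such a set ([inflow_lines]).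
    For a fixed direction, the starting points of the lines that enter through
    a bad subset of the boundary form a slab over it, whose volume is at most a
    constant times the surface area of the subset ([lebesgue_slab_le]), while
    convexity bounds |n . k| from below for lines that get well inside
    ([deep_inflow]). *)

(** * Integrals over intervals *)

Section interval_integral.
Context {R : realType}.
Notation mu := (@lebesgue_measure R).
Implicit Types (f g : R -> R) (a b c s t : R) (G : set R).

(** The solutions are bounded and live on a set of finite measure. This class of
    functions is closed under the operations that occur, so that integrability
    hardly needs a separate argument. *)
Definition bounded_measurable d (X : measurableType d) (f : X -> R) : Prop :=
  measurable_fun setT f /\ exists M : R, forall x, `|f x| <= M.

Lemma bounded_measurable_integrable d (X : measurableType d)
    (m : {measure set X -> \bar R}) (D : set X) (f : X -> R) :
  measurable D -> (m D < +oo)%E -> bounded_measurable f ->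
  m.-integrable D (EFin \o f).
Proof.
move=> mD mDoo [mf [M fM]]; apply: measurable_bounded_integrable => //.
  exact: measurable_funTS.
exists M; split; first exact: num_real.
by move=> N MN x Dx /=; apply: le_trans (fM x) (ltW MN).
Qed.

Definition itv_int f s t : R := (\int[mu]_(r in `[s, t]) f r)%R.

Lemma itv_integrable f s t : bounded_measurable f ->
  mu.-integrable `[s, t] (EFin \o f).
Proof.
move=> bf; apply: bounded_measurable_integrable => //.
by rewrite /= lebesgue_measure_itv/=; case: ifPn => // _; rewrite -EFinB ltry.
Qed.

Lemma itv_intD f s m t : bounded_measurable f -> s <= m -> m <= t ->
  itv_int f s t = itv_int f s m + itv_int f m t.
Proof.
move=> bf sm mt; have := @Rintegral_itvB R f (BLeft s) (BRight t) m.
rewrite !bnd_simp => /(_ (itv_integrable s t bf) sm mt) /eqP.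
rewrite subr_eq => /eqP; rewrite /itv_int => ->.
by rewrite addrC Rintegral_itv_obnd_cbnd//;
  apply: integrableS (itv_integrable m t bf) => //; exact: subset_itv_oc_cc.
Qed.

(** The solutions are controlled at almost every point of a line only, whence
    the set G of full measure. *)
Lemma itv_int_ge f c s t G : bounded_measurable f -> s <= t ->
  mu.-negligible (`]s, t[ `\` G) ->
  (forall r, G r -> s < r < t -> c <= f r) -> c * (t - s) <= itv_int f s t.
Proof.
move=> bf st negG fc.
have bg : bounded_measurable (fun r => Num.max (f r) c).
  have [mf [M fM]] := bf; split; first exact: measurable_maxr.
  exists (Num.max M `|c|) => x; rewrite /Num.max; case: ifP => // _.
    by rewrite le_max lexx orbT.
  by rewrite le_max fM.
have -> : itv_int f s t = itv_int (fun r => Num.max (f r) c) s t.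
  rewrite /itv_int /Rintegral; congr fine; apply: ae_eq_integral => //.
  - by case/integrableP : (itv_integrable s t bf).
  - by case/integrableP : (itv_integrable s t bg).
  apply: (@negligibleS _ _ _ mu ((`]s, t[ `\` G) `|` ([set s] `|` [set t]))).
    move=> r /= /not_implyP[]; rewrite in_itv /= => /andP[sr rt] fr.
    have [rs|rs] := eqVneq r s; first by right; left.
    have [rt'|rt'] := eqVneq r t; first by right; right.
    left; have srt : s < r < t by rewrite !lt_neqAle sr rt rt' eq_sym rs.
    split; first by rewrite in_itv.
    by move=> Gr; apply: fr; congr EFin; apply/esym/max_idPl; exact: fc.
  have n1 x : mu.-negligible [set x].
    apply/negligibleP; first exact: measurable_set1.
    by rewrite /= lebesgue_measure_set1.
  by apply: negligibleU => //; exact: negligibleU.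
have : \int[mu]_(r in `[s, t]) c <= itv_int (fun r => Num.max (f r) c) s t.
  apply: le_Rintegral => //; last by move=> r _; rewrite le_max lexx orbT.
  - apply: (itv_integrable s t (f := fun=> c)); split => //; by exists `|c|.
  - exact: (itv_integrable s t bg).
rewrite Rintegral_cst//= lebesgue_measure_itv/= lte_fin.
by move: st; rewrite le_eqVlt => /predU1P[->|st]; rewrite ?ltxx ?subrr ?mulr0 ?st.
Qed.

Lemma itv_intZ f c s t : bounded_measurable f ->
  itv_int (fun r => c * f r) s t = c * itv_int f s t.
Proof. by move=> bf; rewrite /itv_int RintegralZl//; exact: itv_integrable. Qed.

Lemma bounded_measurableZ d (X : measurableType d) c (f : X -> R) :
  bounded_measurable f -> bounded_measurable (fun r => c * f r).
Proof.
move=> [mf [M fM]]; split; first exact: measurable_funM.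
by exists (`|c| * M) => x; rewrite normrM ler_wpM2l.
Qed.

Lemma bounded_measurableD d (X : measurableType d) (f g : X -> R) :
  bounded_measurable f ->
  bounded_measurable g -> bounded_measurable (fun r => f r + g r).
Proof.
move=> [mf [M fM]] [mg [N gN]]; split; first exact: measurable_funD.
by exists (M + N) => x; apply: le_trans (ler_normD _ _) _; exact: lerD.
Qed.

Lemma bounded_measurableB d (X : measurableType d) (f g : X -> R) :
  bounded_measurable f ->
  bounded_measurable g -> bounded_measurable (fun r => f r - g r).
Proof.
move=> [mf [M fM]] [mg [N gN]]; split; first exact: measurable_funB.
by exists (M + N) => x; apply: le_trans (ler_normB _ _) _; exact: lerD.
Qed.

Lemma bounded_measurableM d (X : measurableType d) (f g : X -> R) :
  bounded_measurable f ->
  bounded_measurable g -> bounded_measurable (fun r => f r * g r).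
Proof.
move=> [mf [M fM]] [mg [N gN]]; split; first exact: measurable_funM.
by exists (M * N) => x; rewrite normrM ler_pM.
Qed.

Lemma bounded_measurable_cst d (X : measurableType d) c :
  bounded_measurable (fun _ : X => c).
Proof. by split => //; exists `|c|. Qed.

Lemma itv_int_add f g s t : bounded_measurable f -> bounded_measurable g ->
  itv_int (fun r => f r + g r) s t = itv_int f s t + itv_int g s t.
Proof. by move=> bf bg; rewrite /itv_int RintegralD//; exact: itv_integrable. Qed.

Lemma itv_intB f g s t : bounded_measurable f -> bounded_measurable g ->
  itv_int (fun r => f r - g r) s t = itv_int f s t - itv_int g s t.
Proof. by move=> bf bg; rewrite /itv_int RintegralB//; exact: itv_integrable. Qed.

Lemma itv_int_cst c s t : s <= t -> itv_int (fun=> c) s t = c * (t - s).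
Proof.
move=> st; rewrite /itv_int Rintegral_cst//= lebesgue_measure_itv/= lte_fin.
by move: st; rewrite le_eqVlt => /predU1P[->|st]; rewrite ?ltxx ?subrr ?mulr0 ?st.
Qed.

Lemma itv_int_le f c s t : bounded_measurable f -> s <= t ->
  (forall r, `|f r| <= c) -> `|itv_int f s t| <= c * (t - s).
Proof.
move=> bf st fc; rewrite ler_norml; apply/andP; split.
  rewrite -mulNr; apply: (@itv_int_ge f (- c) s t setT) => //.
    by rewrite setDT; exact: negligible_set0.
  by move=> r _ _; have := fc r; rewrite ler_norml => /andP[].
have bNf := bounded_measurableZ (-1) bf.
have : - c * (t - s) <= itv_int (fun r => -1 * f r) s t.
  apply: (@itv_int_ge _ (- c) s t setT) => //.
    by rewrite setDT; exact: negligible_set0.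
  by move=> r _ _; have := fc r; rewrite ler_norml => /andP[_]; lra.
by rewrite itv_intZ//; lra.
Qed.

(** An interval function that is superadditive and bounded below by a
    quadratic error is nonnegative. Cutting an interval in its middle third
    replaces (y - x) ^ 2 by at most 5 / 9 of it, so the error vanishes in the
    limit. Only points of a dense set G are used as end points, which makes
    this the substitute for differentiating functions that are defined off a
    null set. *)
Lemma quadratic_superadditive_ge0 (G : set R) (D : R -> R -> R) (C : R) s t :
  G s -> G t -> s < t ->
  (forall x y, G x -> G y -> s <= x -> x < y -> y <= t ->
    exists2 m, G m & x + (y - x) / 3 < m < x + 2 * (y - x) / 3) ->
  (forall x m y, G x -> G m -> G y -> s <= x -> x < m -> m < y -> y <= t ->
     D x m + D m y <= D x y) ->
  (forall x y, G x -> G y -> s <= x -> x < y -> y <= t ->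
     - C * (y - x) ^+ 2 <= D x y) ->
  0 <= D s t.
Proof.
move=> Gs Gt st dense superD quadD.
have C0 : 0 <= Num.max C 0 by rewrite le_max lexx orbT.
suff H n : forall x y, G x -> G y -> s <= x -> x < y -> y <= t ->
    - Num.max C 0 * (5 / 9) ^+ n * (y - x) ^+ 2 <= D x y.
  have cvg0 : (fun n => - Num.max C 0 * (5 / 9) ^+ n * (t - s) ^+ 2) @ \oo --> (0 : R).
    have h : (fun n => (5 / 9 : R) ^+ n) @ \oo --> (0 : R).
      by apply: cvg_expr; rewrite ger0_norm; lra.
    have := cvgM (cvgM (@cvg_cst _ (- Num.max C 0) _ \oo _) h)
      (@cvg_cst _ ((t - s) ^+ 2) _ \oo _).
    by rewrite mulr0 mul0r; apply.
  move/cvg_lim : (cvg0) => <- //; apply: limr_le; first by apply/cvg_ex; exists 0.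
  by near=> n; apply: H.
elim: n => [|n ih] x y Gx Gy sx xy yt.
  rewrite expr0 mulr1; apply: le_trans (quadD _ _ Gx Gy sx xy yt).
  by rewrite ler_wpM2r ?sqr_ge0// lerN2 le_max lexx.
have [m Gm /andP[xm my]] := dense _ _ Gx Gy sx xy yt.
have xm' : x < m by lra.
have my' : m < y by lra.
apply: le_trans (superD _ _ _ Gx Gm Gy sx xm' my' yt).
have h1 := ih x m Gx Gm sx xm' (le_trans (ltW my') yt).
have h2 := ih m y Gm Gy (le_trans sx (ltW xm')) my' yt.
apply: le_trans (lerD h1 h2).
have -> : - Num.max C 0 * (5 / 9) ^+ n.+1 * (y - x) ^+ 2 =
    - (Num.max C 0 * (5 / 9) ^+ n * (5 / 9 * (y - x) ^+ 2)).
  by rewrite exprSr; ring.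
rewrite -mulrDr !mulNr lerN2.
apply: ler_wpM2l; first by rewrite mulr_ge0// exprn_ge0//; lra.
rewrite -subr_le0.
(* for l in [1/3, 2/3], the sum l ^ 2 + (1 - l) ^ 2 is at most 5 / 9 *)
have -> : m = x + (y - x) * ((m - x) / (y - x)) by field; rewrite gt_eqF// subr_gt0.
set l := (m - x) / (y - x).
have yx0 : 0 < y - x by rewrite subr_gt0.
have l1 : 1/3 < l by rewrite /l ltr_pdivlMr//; lra.
have l2 : l < 2/3 by rewrite /l ltr_pdivrMr//; lra.
have -> : (x + (y - x) * l - x) ^+ 2 + (y - (x + (y - x) * l)) ^+ 2 -
   5 / 9 * (y - x) ^+ 2 = 2 * (y - x) ^+ 2 * ((l - 1/3) * (l - 2/3)) by field.
by apply: mulr_ge0_le0; [rewrite mulr_ge0 ?sqr_ge0|apply: mulr_ge0_le0; lra].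
Unshelve. all: by end_near. Qed.

End interval_integral.

(** * Relative entropy on one characteristic *)

Section entropy_inequalities.
Context {R : realType}.
Implicit Types x y u v q r : R.

Lemma ln_le_sub1 x : 0 < x -> ln x <= x - 1.
Proof.
move=> x0; have := @expR_ge1Dx R (ln x); rewrite lnK// => h; lra.
Qed.

Lemma lnB_le x y c : 0 < c -> c <= x -> c <= y -> `|ln x - ln y| <= `|x - y| / c.
Proof.
have half z w : 0 < c -> c <= z -> c <= w -> ln z - ln w <= `|z - w| / c.
  move=> c0 cz cw; have z0 := lt_le_trans c0 cz; have w0 := lt_le_trans c0 cw.
  rewrite -ln_div//; apply: le_trans (ln_le_sub1 _) _; first by rewrite divr_gt0.
  have -> : z / w - 1 = (z - w) / w by field; rewrite gt_eqF.
  apply: le_trans (ler_norm _) _; rewrite normrM ler_wpM2l//.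
  by rewrite normfV lef_pV2 ?posrE ?normr_gt0 ?gt_eqF// (le_trans cw)// ler_norm.
move=> c0 cx cy; rewrite ler_norml; apply/andP; split; last exact: half.
by have := half y x c0 cy cx; rewrite distrC; lra.
Qed.

(** The integrand of the Kullback-Leibler divergence of v from u, without
    normalization of the total masses. *)
Definition entropy u v : R := u - v + v * ln (v / u).

(** The function ln lies below its tangents; equality holds at q = v / u, so
    the entropy is the supremum of these linear functions of (u, v). *)
Lemma entropy_tangent u v q : 0 < u -> 0 < v -> 0 < q ->
  (1 - q) * u + ln q * v <= entropy u v.
Proof.
move=> u0 v0 q0; rewrite /entropy.
have h : ln (q * u / v) <= q * u / v - 1 by apply: ln_le_sub1; rewrite divr_gt0// mulr_gt0.
have e : ln (q * u / v) = ln q - ln (v / u).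
  rewrite -ln_div ?posrE ?divr_gt0//; congr ln.
  by field; rewrite !gt_eqF.
have : v * (ln q - ln (v / u)) <= v * (q * u / v - 1) by rewrite ler_pM2l// -e.
have -> : v * (q * u / v - 1) = q * u - v by field; rewrite gt_eqF.
lra.
Qed.

Lemma entropy_ge0 u v : 0 < u -> 0 < v -> 0 <= entropy u v.
Proof.
move=> u0 v0; have := entropy_tangent u0 v0 (@ltr01 R).
by rewrite ln1 mul0r subrr mul0r addr0.
Qed.

Lemma entropyE u v : 0 < u -> 0 < v ->
  entropy u v = (1 - v / u) * u + ln (v / u) * v.
Proof. by move=> u0 v0; rewrite /entropy; field; rewrite gt_eqF. Qed.

(** This makes the entropy small where u and v are close and their quotient
    is bounded, as at the start of a line. *)
Lemma entropy_le u v c : 0 < u -> 0 < v -> v <= c * u ->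
  entropy u v <= `|u - v| * (1 + c).
Proof.
move=> u0 v0 vcu; have vu0 : 0 < v / u by rewrite divr_gt0.
have h := ln_le_sub1 vu0.
have c0 : v / u <= c by rewrite ler_pdivrMr.
apply: (@le_trans _ _ ((u - v) * (1 - v / u))).
  have : v * ln (v / u) <= v * (v / u - 1) by rewrite ler_pM2l.
  have : u * (v / u) = v by field; rewrite gt_eqF.
  by rewrite /entropy; lra.
apply: le_trans (ler_norm _) _; rewrite normrM ler_wpM2l//.
rewrite ler_norml; apply/andP; split; lra.
Qed.

(** If u and v differ, the linear function of [entropy_tangent] for the mean q
    of 1 and v / u is positive. *)
Lemma entropy_eq0 u v : 0 < u -> 0 < v -> entropy u v <= 0 -> u = v.
Proof.
move=> u0 v0 e0; apply/eqP/negPn/negP => uv.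
have s0 : 0 < v / u by rewrite divr_gt0.
have [q qE] : exists q, q = (1 + v / u) / 2 by eexists.
have q0 : 0 < q by rewrite qE divr_gt0// addr_gt0.
have : (1 - q) * u + ln q * v <= 0.
  by apply: le_trans e0; exact: entropy_tangent.
have h : - ln q <= q^-1 - 1.
  by rewrite -lnV ?posrE//; apply: ln_le_sub1; rewrite invr_gt0.
have : v * - ln q <= v * (q^-1 - 1) by rewrite ler_pM2l.
have ve : v = (2 * q - 1) * u by rewrite qE; field; rewrite gt_eqF.
have q1 : q != 1.
  apply: contra uv => /eqP q1; rewrite ve q1; apply/eqP; ring.
have -> : v * (q^-1 - 1) = u * (1 - q) * ((2 * q - 1) / q).
  by rewrite ve; field; rewrite gt_eqF.
have -> : (2 * q - 1) / q = 1 - (1 - q) / q by field; rewrite gt_eqF.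
have : 0 < u * ((1 - q) ^+ 2 / q).
  by rewrite mulr_gt0// divr_gt0// exprn_even_gt0//= subr_eq0 eq_sym.
rewrite expr2; lra.
Qed.

End entropy_inequalities.

Section characteristic_line.
Context {R : realType}.
Notation mu := (@lebesgue_measure R).
Variables (a b M : R) (G : set R).
Hypotheses (ab : a < b) (a0 : 0 <= a).
Hypothesis Gab : G `<=` `]a, b[.
Hypothesis Gnull : mu.-negligible (`]a, b[ `\` G).
Variables U V W Z : R -> R.
Hypotheses (bW : bounded_measurable W) (bZ : bounded_measurable Z).
Hypotheses (WM : forall r, `|W r| <= M) (ZM : forall r, `|Z r| <= M).
Hypothesis U0 : forall r, G r -> 0 < U r <= M.
Hypothesis V0 : forall r, G r -> 0 < V r <= M.
Hypothesis UW : forall s t, G s -> G t -> s < t -> U t - U s = itv_int W s t.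
Hypothesis VZ : forall s t, G s -> G t -> s < t -> V t - V s = itv_int Z s t.

Lemma line_dense s t : a <= s -> s < t -> t <= b -> exists2 m, G m & s < m < t.
Proof.
move=> as_ st tb; apply: contrapT => nG.
have : mu.-negligible `]s, t[%classic.
  apply: negligibleS Gnull => r; rewrite /= in_itv/= => /andP[sr rt]; split.
    by rewrite in_itv/=; apply/andP; split; [exact: le_lt_trans sr|exact: lt_le_trans tb].
  by move=> Gr; apply: nG; exists r => //; rewrite sr.
move/negligibleP => /(_ (measurable_itv _)).
rewrite /= lebesgue_measure_itv/= lte_fin st => /eqP.
by rewrite -EFinB eqe subr_eq0 gt_eqF.
Qed.

Lemma line_null s t : a <= s -> t <= b -> mu.-negligible (`]s, t[ `\` G).
Proof.
move=> as_ tb; apply: negligibleS Gnull => r []; rewrite /= in_itv/= => /andP[sr rt] nGr; split => //.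
by rewrite in_itv/=; apply/andP; split; [exact: le_lt_trans sr|exact: lt_le_trans tb].
Qed.

Lemma line_in s : G s -> a < s < b.
Proof. by move/Gab; rewrite /= in_itv. Qed.

(** The functions of a line are only controlled on G, and G is dense enough
    for the middle third argument. *)
Lemma line_quadratic (D : R -> R -> R) (C : R) s t :
  G s -> G t -> s < t ->
  (forall x m y, G x -> G m -> G y -> s <= x -> x < m -> m < y -> y <= t ->
     D x m + D m y <= D x y) ->
  (forall x y, G x -> G y -> s <= x -> x < y -> y <= t ->
     - C * (y - x) ^+ 2 <= D x y) ->
  0 <= D s t.
Proof.
move=> Gs Gt st sD qD; apply: (@quadratic_superadditive_ge0 _ G D C) => //.
move=> x y Gx Gy sx xy yt.
have /andP[ax _] := line_in Gx; have /andP[_ yb] := line_in Gy.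
by apply: line_dense; lra.
Qed.

Lemma line_lipschitz (X Y : R -> R) :
  bounded_measurable Y -> (forall r, `|Y r| <= M) ->
  (forall s t, G s -> G t -> s < t -> X t - X s = itv_int Y s t) ->
  forall s t, G s -> G t -> `|X t - X s| <= M * `|t - s|.
Proof.
move=> bY YM XY s t Gs Gt.
case: (ltgtP s t) => [st|ts|->]; last by rewrite !subrr !normr0 mulr0.
  by rewrite XY// (@gtr0_norm _ (t - s)) ?subr_gt0//; apply: itv_int_le => //; exact: ltW.
by rewrite distrC (distrC t) XY// (@gtr0_norm _ (s - t)) ?subr_gt0//;
  apply: itv_int_le => //; exact: ltW.
Qed.

Section growth.
Variable k : R.
Hypothesis WU : forall r, G r -> 0 <= W r + M * U r.
Hypothesis WZ : forall r, G r -> k * Z r <= W r + M * U r.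

(** Formally the derivative of e^(M t) U - k V is e^(M t) (W + M U) - k Z,
    which is nonnegative as e^(M t) >= 1. The increments satisfy this up to a
    quadratic error. *)
Lemma line_growth s t : G s -> G t -> s < t ->
  expR (M * s) * U s - k * V s <= expR (M * t) * U t - k * V t.
Proof.
move=> Gs Gt st; rewrite -subr_ge0.
pose D x y := expR (M * y) * U y - k * V y - (expR (M * x) * U x - k * V x).
have M0 : 0 <= M by have /andP[u0 u1] := U0 Gs; lra.
(* the constant collects the errors M ^ 2 d ^ 2 in X and M ^ 3 d ^ 2 in h2 *)
apply: (@line_quadratic D (expR (M * t) * (M ^+ 2 + M ^+ 3)) s t) => //.
  by move=> x m y *; rewrite /D; lra.
move=> x y Gx Gy sx xy yt.
have /andP[ax xb] := line_in Gx; have /andP[ay yb] := line_in Gy.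
have [d dE] : exists d, d = y - x by eexists.
have d0 : 0 <= d by lra.
set j := itv_int W x y.
have Uy : U y = U x + j by rewrite /j -UW//; ring.
have Vy : V y = V x + itv_int Z x y by rewrite -VZ//; ring.
pose X := j + M * d * U x + M ^+ 2 * d ^+ 2.
have XE : X = itv_int (fun r => W r + (M * U x + M ^+ 2 * d)) x y.
  rewrite itv_int_add//; last exact: bounded_measurable_cst.
  by rewrite itv_int_cst ?ltW// /X -/j dE; ring.
have Ux r : G r -> x < r < y -> M * U r <= M * U x + M ^+ 2 * d.
  move=> Gr /andP[xr ry].
  have := line_lipschitz bW WM UW Gx Gr; rewrite (@gtr0_norm _ (r - x)) ?subr_gt0//.
  move=> /(le_trans (ler_norm _)) h.
  have : M * (U r - U x) <= M * (M * (y - x)).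
    apply: ler_wpM2l => //; apply: le_trans h _; apply: ler_wpM2l => //; lra.
  by rewrite dE; lra.
have X0 : 0 <= X.
  rewrite XE -[leLHS](mul0r (y - x)); apply: (@itv_int_ge _ _ _ _ _ G).
  - by apply: bounded_measurableD => //; exact: bounded_measurable_cst.
  - exact: ltW.
  - by apply: line_null; exact: ltW.
  - by move=> r Gr xry; have := Ux r Gr xry; have := WU Gr; lra.
have kX : k * itv_int Z x y <= X.
  rewrite -subr_ge0 XE -itv_intZ//.
  have bkZ := bounded_measurableZ k bZ.
  have bWc : bounded_measurable (fun r => W r + (M * U x + M ^+ 2 * d)).
    by apply: bounded_measurableD => //; exact: bounded_measurable_cst.
  rewrite -itv_intB//.
  rewrite -[leLHS](mul0r (y - x)); apply: (@itv_int_ge _ _ _ _ _ G).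
  - exact: bounded_measurableB.
  - exact: ltW.
  - by apply: line_null; exact: ltW.
  - by move=> r Gr xry; have := Ux r Gr xry; have := WZ Gr; lra.
set ex := expR (M * x); set ey := expR (M * y).
have ey1 : 1 <= ey.
  by rewrite -expR0 ler_expR mulr_ge0// (le_trans a0)// ltW.
have exy : ey * (1 - M * d) <= ex.
  have -> : ex = ey * expR (- (M * d)) by rewrite /ex /ey -expRD; congr expR; rewrite dE; ring.
  by rewrite ler_wpM2l ?expR_ge0//; have := expR_ge1Dx (- (M * d)); lra.
have eyx : ex * (1 + M * d) <= ey.
  have -> : ey = ex * expR (M * d) by rewrite /ex /ey -expRD; congr expR; rewrite dE; ring.
  by rewrite ler_wpM2l ?expR_ge0//; exact: expR_ge1Dx.
have eyt : ey <= expR (M * t) by rewrite ler_expR ler_wpM2l.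
have eXk : k * itv_int Z x y <= ey * X.
  by apply: le_trans kX _; rewrite ler_peMl.
have /andP[Ux0 UxM] := U0 Gx.
rewrite /D -/ex -/ey Uy Vy -dE.
(* (ey - ex) U x >= ex M d U x >= ey M d U x - (ey - ex) M d U x *)
have h1 : ex * (M * d) * U x <= (ey - ex) * U x.
  by rewrite ler_wpM2r ?(ltW Ux0)//; lra.
have Md0 : 0 <= M * d by rewrite mulr_ge0.
have h2 : (ey - ex) * (M * d * U x) <= ey * (M * d) * (M * d * M).
  apply: ler_pM => //.
  - by rewrite subr_ge0; apply: le_trans eyx; rewrite ler_peMr ?expR_ge0//; lra.
  - by rewrite mulr_ge0// ltW.
  - lra.
  - by rewrite ler_wpM2l.
have h3 : ey * (M ^+ 2 * d ^+ 2 + M ^+ 3 * d ^+ 2) <=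
    expR (M * t) * (M ^+ 2 * d ^+ 2 + M ^+ 3 * d ^+ 2).
  by rewrite ler_wpM2r// addr_ge0// mulr_ge0// exprn_ge0.
move: eXk; rewrite /X.
rewrite !exprS !expr0 in h3 *; lra.
Qed.

End growth.

Section ratio.
Hypothesis start : forall e t : R, 0 < e -> a < t ->
  exists s, [/\ G s, s < t & `|U s - V s| < e].
Variable T : R.
Hypothesis bT : b <= T.
Variable k : R.
Hypothesis k01 : 0 <= k <= 1.
Hypothesis WU : forall r, G r -> 0 <= W r + M * U r.
Hypothesis WZ : forall r, G r -> k * Z r <= W r + M * U r.

(** The monotone function of [line_growth] is nonnegative in the limit at the
    start of the line, because there U and V have the same limit and k <= 1. *)
Lemma line_ratio t : G t -> k * V t <= expR (M * T) * U t.
Proof.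
move=> Gt; apply/ler_addgt0Pr => e e0.
have /andP[at_ tb] := line_in Gt.
have [s [Gs st sUV]] := start e0 at_.
have /andP[as_ sb] := line_in Gs.
have /andP[k0 k1] := k01.
have := line_growth WU WZ Gs Gt st.
have /andP[Us0 UsM] := U0 Gs; have /andP[Vs0 VsM] := V0 Gs.
have M0 : 0 <= M by lra.
have e1 : U s <= expR (M * s) * U s.
  by rewrite ler_peMl ?(ltW Us0)// -expR0 ler_expR mulr_ge0// (le_trans a0)// ltW.
have kV : k * V s <= V s by rewrite ler_piMl// ltW.
have /andP[Ut0 UtM] := U0 Gt.
have e2 : expR (M * t) * U t <= expR (M * T) * U t.
  by rewrite ler_wpM2r ?(ltW Ut0)// ler_expR ler_wpM2l// (le_trans (ltW tb)).
move: sUV; rewrite ltr_norml => /andP[]; lra.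
Qed.

End ratio.

Section entropy_production.
Hypothesis start : forall e t : R, 0 < e -> a < t ->
  exists s, [/\ G s, s < t & `|U s - V s| < e].
Variable c : R.
Hypothesis c0 : 0 < c.
Hypothesis UV : forall r, G r -> U r <= c * V r.
Hypothesis VU : forall r, G r -> V r <= c * U r.
Hypothesis WU : forall r, G r -> 0 <= W r + M * U r.
Variable E : R -> R.
Hypothesis bE : bounded_measurable E.
Hypothesis EE : forall r, G r ->
  E r = (1 - V r / U r) * W r + ln (V r / U r) * Z r.

(** By [entropy_tangent] with q = V y / U y, the increment of the entropy over
    [x, y] is at most (1 - q) times that of U plus ln q times that of V, and
    replacing q by V r / U r under the integral costs a quadratic error since
    the quotient is Lipschitz on compact parts of the line. *)
Lemma line_entropy_increment s t : G s -> G t -> s < t ->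
  entropy (U t) (V t) - entropy (U s) (V s) <= itv_int E s t.
Proof.
move=> Gs Gt st; rewrite -subr_ge0.
pose D x y := itv_int E x y - (entropy (U y) (V y) - entropy (U x) (V x)).
have /andP[Us0 UsM] := U0 Gs; have M0 : 0 <= M by lra.
have /andP[as_ sb] := line_in Gs; have /andP[at_ tb] := line_in Gt.
(* a positive lower bound of U on [s, t], from the growth of e^(M t) U *)
pose m := expR (- (M * t)) * U s.
have m0 : 0 < m by rewrite mulr_gt0// expR_gt0.
have Um r : G r -> s <= r -> r <= t -> m <= U r.
  move=> Gr sr rt.
  have /andP[Ur0 _] := U0 Gr.
  suff h : U s <= expR (M * t) * U r.
    by rewrite /m expRN mulrC ler_pdivrMr ?expR_gt0// mulrC.
  move: sr; rewrite le_eqVlt => /predU1P[->|sr].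
    by rewrite ler_peMl ?(ltW Ur0)// -expR0 ler_expR mulr_ge0// (le_trans a0)// ltW.
  have WZ r' : G r' -> 0 * Z r' <= W r' + M * U r'.
    by move=> Gr'; rewrite mul0r; exact: WU.
  have := line_growth WU WZ Gs Gr sr; rewrite !mul0r !subr0.
  have e1 : U s <= expR (M * s) * U s.
    by rewrite ler_peMl ?(ltW Us0)// -expR0 ler_expR mulr_ge0// (le_trans a0)// ltW.
  have e2 : expR (M * r) * U r <= expR (M * t) * U r.
    by rewrite ler_wpM2r ?(ltW Ur0)// ler_expR ler_wpM2l.
  lra.
have cV r : G r -> c^-1 <= V r / U r.
  move=> Gr; have /andP[Ur0 _] := U0 Gr.
  by rewrite ler_pdivlMr// mulrC ler_pdivrMr// mulrC; exact: UV.
have Vc r : G r -> V r / U r <= c.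
  by move=> Gr; have /andP[Ur0 _] := U0 Gr; rewrite ler_pdivrMr//; exact: VU.
pose K := M * (1 + c) / m.
have K0 : 0 <= K by rewrite /K divr_ge0 ?(ltW m0)// mulr_ge0// addr_ge0// ltW.
have qK x y : G x -> G y -> s <= x -> x <= t -> s <= y -> y <= t ->
    `|V x / U x - V y / U y| <= K * `|x - y|.
  move=> Gx Gy sx xt sy yt.
  have /andP[Ux0 UxM] := U0 Gx; have /andP[Uy0 UyM] := U0 Gy.
  have Uxm := Um x Gx sx xt.
  have -> : V x / U x - V y / U y =
      ((V x - V y) - V y / U y * (U x - U y)) / U x.
    by field; rewrite !gt_eqF.
  have Vy0 : 0 <= V y / U y by rewrite (le_trans _ (cV _ Gy))// invr_ge0 ltW.
  rewrite normrM normfV (gtr0_norm Ux0) ler_pdivrMr//.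
  apply: le_trans (ler_normB _ _) _; rewrite normrM (ger0_norm Vy0).
  have h1 := line_lipschitz bW WM UW Gy Gx.
  have h2 := line_lipschitz bZ ZM VZ Gy Gx.
  have h3 : V y / U y * `|U x - U y| <= c * (M * `|x - y|).
    by apply: ler_pM => //; exact: Vc.
  apply: (@le_trans _ _ (M * (1 + c) * `|x - y|)); first lra.
  have -> : K * `|x - y| * U x = M * (1 + c) * `|x - y| * (U x / m).
    by rewrite /K; field; rewrite gt_eqF.
  by rewrite ler_peMr ?ler_pdivlMr ?mul1r// mulr_ge0// mulr_ge0// addr_ge0// ltW.
pose C := M * (K + K * c).
apply: (@line_quadratic D C s t) => //.
  move=> x y z _ _ _ _ xy yz _; rewrite /D (itv_intD bE (ltW xy) (ltW yz)); lra.
move=> x y Gx Gy sx xy yt; rewrite /D.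
have /andP[ax xb] := line_in Gx; have /andP[ay yb] := line_in Gy.
set q := V y / U y.
have /andP[Ux0 UxM] := U0 Gx; have /andP[Uy0 UyM] := U0 Gy.
have /andP[Vx0 VxM] := V0 Gx; have /andP[Vy0 VyM] := V0 Gy.
have q0 : 0 < q by rewrite divr_gt0.
have := entropy_tangent Ux0 Vx0 q0; rewrite (entropyE Uy0 Vy0) -/q.
have Uy : U y = U x + itv_int W x y by rewrite -UW//; ring.
have Vy : V y = V x + itv_int Z x y by rewrite -VZ//; ring.
have -> : (1 - q) * U y + ln q * V y = (1 - q) * U x + ln q * V x +
    ((1 - q) * itv_int W x y + ln q * itv_int Z x y).
  by rewrite Uy Vy; ring.
suff : - C * (y - x) ^+ 2 <= itv_int E x y -
   ((1 - q) * itv_int W x y + ln q * itv_int Z x y) by lra.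
have bqW := bounded_measurableZ (1 - q) bW.
have bqZ := bounded_measurableZ (ln q) bZ.
have bqWZ := bounded_measurableD bqW bqZ.
rewrite -!itv_intZ// -itv_int_add//.
rewrite -itv_intB//.
rewrite expr2 mulrA; apply: (@itv_int_ge _ _ _ _ _ G).
- exact: bounded_measurableB.
- exact: ltW.
- by apply: line_null; exact: ltW.
move=> r Gr /andP[xr ry]; rewrite EE//.
set p := V r / U r.
have -> : (1 - p) * W r + ln p * Z r - ((1 - q) * W r + ln q * Z r) =
  (q - p) * W r + (ln p - ln q) * Z r by ring.
have pq : `|p - q| <= K * (y - x).
  have h := qK r y Gr Gy; rewrite (le_trans (h _ _ _ _))//; try lra.
  by rewrite distrC gtr0_norm ?subr_gt0// ler_wpM2l//; lra.
have lpq : `|ln p - ln q| <= K * c * (y - x).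
  have ci0 : 0 < c^-1 by rewrite invr_gt0.
  apply: le_trans (lnB_le ci0 (cV _ Gr) (cV _ Gy)) _.
  by rewrite invrK -mulrA [c * _]mulrC mulrA ler_wpM2r// ltW.
rewrite -[leLHS]opprK lerNl.
rewrite mulNr opprK.
apply: le_trans (ler_norm _) _; rewrite normrN.
apply: le_trans (ler_normD _ _) _; rewrite !normrM (distrC q).
have h1 : `|p - q| * `|W r| <= K * (y - x) * M by apply: ler_pM.
have h2 : `|ln p - ln q| * `|Z r| <= K * c * (y - x) * M by apply: ler_pM.
by rewrite /C; lra.
Qed.

(** The entropy is nonnegative near the end of the line and arbitrarily small
    at points close to its start. *)
Lemma line_entropy_production : 0 <= itv_int E a b.
Proof.
have [_ [B EB]] := bE.
have B0 : 0 <= B by apply: le_trans (EB 0).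
have ab' := ab; have c0' := c0.
apply/ler_addgt0Pr => e e0; have {}e0 : (0 : R) < e by [].
(* B e1 for each of the two end pieces, (1 + c) e1 for the entropy at s *)
pose e1 := e / (B + B + 2 + c).
have e10 : 0 < e1 by rewrite divr_gt0//; lra.
have [t Gt /andP[t1 tb]] : exists2 t, G t & Num.max (b - e1) ((a + b) / 2) < t < b.
  apply: line_dense => //; first by rewrite le_max; apply/orP; right; lra.
  by rewrite gt_max; apply/andP; split; lra.
move: t1; rewrite gt_max => /andP[t1 t2].
have at_ : a < Num.min t (a + e1) by rewrite lt_min; apply/andP; split; lra.
have [s [Gs]] := start e10 at_.
rewrite lt_min => /andP[st sa] sUV.
have /andP[as_ sb] := line_in Gs.
have /andP[Us0 UsM] := U0 Gs; have /andP[Vs0 VsM] := V0 Gs.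
have /andP[Ut0 UtM] := U0 Gt; have /andP[Vt0 VtM] := V0 Gt.
rewrite (@itv_intD _ E a s b) ?ltW// (@itv_intD _ E s t b) ?ltW//.
have h1 := @itv_int_le _ E B a s bE (ltW as_) EB.
have h2 := @itv_int_le _ E B t b bE (ltW tb) EB.
have h3 := line_entropy_increment Gs Gt st.
have h4 := entropy_ge0 Ut0 Vt0.
have h5 := entropy_le Us0 Vs0 (VU Gs).
have h6 : `|U s - V s| * (1 + c) <= e1 * (1 + c) by rewrite ler_wpM2r ?ltW//; lra.
have h7 : B * (s - a) <= B * e1 by rewrite ler_wpM2l//; lra.
have h8 : B * (b - t) <= B * e1 by rewrite ler_wpM2l//; lra.
move: h1 h2; rewrite !ler_norml => /andP[h1 _] /andP[h2 _].
have : e = e1 * (B + B + 2 + c) by rewrite /e1; field; rewrite gt_eqF//; lra.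
lra.
Qed.

End entropy_production.

End characteristic_line.

(** * Smooth functions and bumps *)

Section smooth_functions.
Context {R : realType}.

(** Smoothness quantifies over all iterated derivatives; it follows from any
    class of differentiable functions that is closed under derivatives. *)
Lemma smooth_coind (V : normedModType R) (P : set (V -> R)) :
  (forall f, P f -> [/\ continuous f, forall x v, derivable f x v
    & forall v, P ('D_v f)]) ->
  forall f, P f -> smooth f.
Proof.
move=> H f Pf vs; have : P (foldr (fun v h => 'D_v h) f vs).
  by elim: vs => //= v vs ih; have [_ _] := H _ ih; exact.
by move=> /H[].
Qed.

Lemma smooth_continuous (V : normedModType R) (f : V -> R) :
  smooth f -> continuous f.
Proof. by move=> /(_ [::])[]. Qed.

Lemma smooth_derivable (V : normedModType R) (f : V -> R) x v :
  smooth f -> derivable f x v.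
Proof. by move=> /(_ [::])[_]; exact. Qed.

Lemma smooth_derive (V : normedModType R) (f : V -> R) v :
  smooth f -> smooth ('D_v f).
Proof. by move=> sf vs; have := sf (rcons vs v); rewrite foldr_rcons. Qed.

Lemma is_derive_comp_real (V : normedModType R) (b : R -> R) (q : V -> R) x v :
  derivable q x v -> derivable b (q x) 1 ->
  is_derive x v (b \o q) ('D_1 b (q x) * 'D_v q x).
Proof.
move=> dq db; pose g (h : R) := q (h *: v + x).
have e0 : g 0 = q x by rewrite /g scale0r add0r.
have gE : (fun h : R => h^-1 *: ((g \o shift 0) (h *: 1) - g 0)) =
    (fun h : R => h^-1 *: ((q \o shift x) (h *: v) - q x)).
  by apply/funext => h /=; rewrite e0 /g addr0 [h *: 1]mulr1.
have bgE : (fun h : R => h^-1 *: (((b \o g) \o shift 0) (h *: 1) - (b \o g) 0)) =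
    (fun h : R => h^-1 *: (((b \o q) \o shift x) (h *: v) - (b \o q) x)).
  by apply/funext => h /=; rewrite e0 /g addr0 [h *: 1]mulr1.
have dg : is_derive (0 : R) (1 : R) g ('D_v q x).
  apply: DeriveDef; first by rewrite /derivable gE.
  by rewrite /derive gE.
have dbg : is_derive (g 0) (1 : R) b ('D_1 b (q x)) by rewrite e0; exact/derivableP.
have [h1 h2] := is_derive1_comp dbg dg.
apply: DeriveDef; first by move: h1; rewrite /derivable bgE.
by move: h2; rewrite /derive bgE.
Qed.

(** The base case contains all smooth functions, so that this is only a device
    to close them under the operations. *)
Inductive smooth_expr (V : normedModType R) : (V -> R) -> Prop :=
| SmoothExprBase f : smooth f -> smooth_expr f
| SmoothExprD f g : smooth_expr f -> smooth_expr g -> smooth_expr (f + g)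
| SmoothExprM f g : smooth_expr f -> smooth_expr g -> smooth_expr (f * g)
| SmoothExprComp (b : R -> R) f : smooth b -> smooth_expr f -> smooth_expr (b \o f).

Lemma smooth_expr_derive (V : normedModType R) (f : V -> R) : smooth_expr f ->
  [/\ continuous f, forall x v, derivable f x v & forall v, smooth_expr ('D_v f)].
Proof.
elim=> {f} [f sf|f g sf [cf df Df] sg [cg dg Dg]|f g sf [cf df Df] sg [cg dg Dg]|
  b f sb sf [cf df Df]]; split.
- exact: smooth_continuous.
- by move=> x v; exact: smooth_derivable.
- by move=> v; apply: SmoothExprBase; exact: smooth_derive.
- by move=> x; apply: cvgD; [exact: cf|exact: cg].
- by move=> x v; apply: derivableD.
- move=> v; rewrite (_ : 'D_v _ = 'D_v f + 'D_v g); first exact: SmoothExprD.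
  by apply/funext => x; rewrite deriveD.
- by move=> x; apply: cvgM; [exact: cf|exact: cg].
- by move=> x v; apply: derivableM.
- move=> v; rewrite (_ : 'D_v _ = f * 'D_v g + g * 'D_v f).
    by apply: SmoothExprD; apply: SmoothExprM.
  by apply/funext => x; rewrite deriveM.
- by move=> x; apply: continuous_comp; [exact: cf|exact: smooth_continuous].
- by move=> x v; have [] := is_derive_comp_real (df x v) (smooth_derivable sb).
- move=> v; rewrite (_ : 'D_v _ = ('D_1 b \o f) * 'D_v f).
    by apply: SmoothExprM => //; apply: SmoothExprComp => //; exact: smooth_derive.
  apply/funext => x.
  by have [_ ->] := is_derive_comp_real (df x v) (smooth_derivable sb).
Qed.

(** The product and chain rules express derivatives of such expressions by
    expressions of the same kind, so that [smooth_coind] applies. *)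
Lemma smooth_exprW (V : normedModType R) (f : V -> R) : smooth_expr f -> smooth f.
Proof. by apply: smooth_coind => {}f; exact: smooth_expr_derive. Qed.

Lemma smoothD (V : normedModType R) (f g : V -> R) :
  smooth f -> smooth g -> smooth (fun x => f x + g x).
Proof.
by move=> sf sg; apply: smooth_exprW; apply: (@SmoothExprD _ f g); exact: SmoothExprBase.
Qed.

Lemma smoothM (V : normedModType R) (f g : V -> R) :
  smooth f -> smooth g -> smooth (fun x => f x * g x).
Proof.
by move=> sf sg; apply: smooth_exprW; apply: (@SmoothExprM _ f g); exact: SmoothExprBase.
Qed.

Lemma smooth_comp (V : normedModType R) (b : R -> R) (f : V -> R) :
  smooth b -> smooth f -> smooth (fun x => b (f x)).
Proof.
move=> sb sf; apply: smooth_exprW; apply: (@SmoothExprComp _ b f) => //.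
exact: SmoothExprBase.
Qed.

Lemma is_derive_linear (V : normedModType R) (f : V -> R) (x v : V) :
  (forall h u w, f (h *: u + w) = h * f u + f w) -> is_derive x v f (f v).
Proof.
move=> fl.
have cv : (fun h : R => h^-1 *: ((f \o shift x) (h *: v) - f x)) @ 0^' --> f v.
  apply: cvg_near_cst; near=> h.
  have h0 : h != 0 by near: h; exact: nbhs_dnbhs_neq.
  by rewrite /= fl addrK [_ *: _]mulrA mulVf// mul1r.
by apply: DeriveDef; [apply/cvg_ex; exists (f v)|exact/cvg_lim].
Unshelve. all: by end_near. Qed.

Lemma smooth_linear (V : normedModType R) (f : V -> R) :
  (forall h u w, f (h *: u + w) = h * f u + f w) -> continuous f -> smooth f.
Proof.
move=> fl cf.
apply: (@smooth_coind V [set g | g = f \/ exists c, g = cst c]); last by left.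
move=> g [->|[c ->]]; split => //.
- by move=> x v; have [] := is_derive_linear x v fl.
- move=> v; right; exists (f v); apply/funext => x.
  by have [_ ->] := is_derive_linear x v fl.
- by move=> x; exact: cvg_cst.
- by move=> v; right; exists 0; apply/funext => x; rewrite derive_cst.
Qed.

Lemma smooth_cst (V : normedModType R) (c : R) : smooth (fun _ : V => c).
Proof.
apply: (@smooth_coind V [set g | exists c, g = cst c]); last by exists c.
move=> _ [{}c ->]; split.
- by move=> x; exact: cvg_cst.
- by move=> x v; exact: derivable_cst.
- by move=> v; exists 0; apply/funext => x; rewrite derive_cst.
Qed.

Lemma smooth_prod (V : normedModType R) (I : Type) (r : seq I) (F : I -> V -> R) :
  (forall i, smooth (F i)) -> smooth (fun x => \prod_(i <- r) F i x).
Proof.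
move=> sF; elim: r => [|i r ih].
  rewrite (_ : (fun x => _) = fun=> 1); first exact: smooth_cst.
  by apply/funext => x; rewrite big_nil.
rewrite (_ : (fun x => _) = fun x => F i x * \prod_(i <- r) F i x).
  exact: smoothM.
by apply/funext => x; rewrite big_cons.
Qed.

(** On the line a single derivative suffices, since the derivative in
    direction v is v times the one in direction 1. *)
Lemma smooth_real (f : R -> R) : (forall x, derivable f x 1) -> smooth ('D_1 f) ->
  smooth f.
Proof.
move=> df sDf.
apply: (@smooth_coind R [set g | smooth g \/ g = f]); last by right.
have dv x v : is_derive x v f (v * 'D_1 f x).
  have h := @is_derive_comp_real R f id x v (@derivable_id _ _ x v) (df x).
  by move: h; rewrite derive_id mulrC.
move=> g [sg|->]; split.
- exact: smooth_continuous.
- by move=> x v; exact: smooth_derivable.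
- by move=> v; left; exact: smooth_derive.
- by move=> x; apply/differentiable_continuous/derivable1_diffP.
- by move=> x v; have [] := dv x v.
- move=> v; left; rewrite (_ : 'D_v f = fun x => v * 'D_1 f x).
    by apply: smoothM => //; exact: smooth_cst.
  by apply/funext => x; have [_ ->] := dv x v.
Qed.

End smooth_functions.

Section bump.
Context {R : realType}.
Implicit Types (P : {poly R}) (x : R).

(** The family P(1 / x) e^(-1/x), extended by 0, contains the standard flat
    function and is closed under derivatives. *)
Definition flat_exp P x : R :=
  if 0 < x then P.[x^-1] * expR (- x^-1) else 0.

Lemma pow_le_expR n (y : R) : 0 <= y -> y ^+ n <= n%:R ^+ n * expR y.
Proof.
move=> y0; case: n => [|n]; first by rewrite !expr0 mul1r -expR0 ler_expR.
have -> : y = n.+1%:R * (y / n.+1%:R) by rewrite mulrC divfK// pnatr_eq0.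
rewrite expRM_natl -exprMn; apply: lerXn2r; rewrite ?nnegrE.
- by rewrite mulr_ge0// divr_ge0.
- by rewrite mulr_ge0// expR_ge0.
- by rewrite ler_wpM2l// (le_trans _ (expR_ge1Dx _))// lerDr.
Qed.

(** Quadratic decay at 0 gives both continuity and a vanishing derivative. *)
Lemma flat_exp_le P : exists C, forall x, `|flat_exp P x| <= C * x ^+ 2.
Proof.
exists (\sum_(i < size P) `|P`_i| * (i.+2)%:R ^+ i.+2) => x.
rewrite /flat_exp; case: ltP => x0; last first.
  by rewrite normr0 mulr_ge0 ?sqr_ge0// sumr_ge0// => i _; rewrite mulr_ge0// exprn_ge0.
rewrite horner_coef mulr_suml mulr_suml; apply: le_trans (ler_norm_sum _ _ _) _.
apply: ler_sum => i _; rewrite !normrM (ger0_norm (expR_ge0 _)) -mulrA -[leRHS]mulrA ler_wpM2l//.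
have y0 : 0 <= x^-1 by rewrite invr_ge0 ltW.
rewrite ger0_norm ?exprn_ge0// expRN ler_pdivrMr ?expR_gt0//.
have := @pow_le_expR i.+2 _ y0.
have -> : x^-1 ^+ i.+2 = x^-1 ^+ i / x ^+ 2 by rewrite -addn2 exprD !exprVn.
rewrite ler_pdivrMr ?exprn_gt0//; move: (i.+2%:R ^+ i.+2 : R) => c; lra.
Qed.

Lemma is_derive_flat_exp P x :
  is_derive x 1 (flat_exp P) (flat_exp ('X^2 * (P - P^`())) x).
Proof.
case: (ltgtP x 0) => [x0|x0|->].
- rewrite [X in is_derive _ _ _ X](_ : _ = 0); last by rewrite /flat_exp ltNge (ltW x0).
  apply: (@near_eq_is_derive _ _ _ (cst 0)).
  near=> z; rewrite /flat_exp ltNge.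
  suff -> : z <= 0 by [].
  by apply: ltW; near: z; exact: lt_nbhsl.
- have xn0 : x != 0 by rewrite gt_eqF.
  pose f (z : R) := P.[z^-1] * expR (- z^-1).
  apply: (@near_eq_is_derive _ _ _ f).
    near=> z; rewrite /flat_exp /f; suff -> : 0 < z by [].
    by near: z; exact: lt_nbhsr.
  have dV : is_derive x 1 (fun z : R => z^-1) (- x ^- 2).
    have := @is_deriveV R id x 1 1 xn0 (is_derive_id _ _).
    by rewrite [_ *: 1]mulr1.
  have d1 : is_derive x 1 (fun z : R => P.[z^-1]) (P^`().[x^-1] * - x ^- 2).
    exact: (@is_derive1_comp _ (horner P) (fun z => z^-1)).
  have d2 : is_derive x 1 (fun z : R => expR (- z^-1)) (expR (- x^-1) * x ^- 2).
    have -> : x ^- 2 = - - x ^- 2 by rewrite opprK.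
    apply: (@is_derive1_comp _ expR (fun z => - z^-1)).
  have dM := @is_deriveM _ _ _ _ x 1 _ _ d1 d2.
  apply: (@is_derive_eq _ _ _ f x 1 _ _ dM).
  rewrite /flat_exp x0 !hornerE /GRing.scale/=.
  by rewrite -exprVn; ring.
- have [C fC] := flat_exp_le P.
  have f0 Q : flat_exp Q 0 = 0 by rewrite /flat_exp ltxx.
  have cv : (fun h : R => h^-1 *: ((flat_exp P \o shift 0) (h *: 1) - flat_exp P 0)) @ 0^' --> (0 : R).
    apply/cvgrPdist_le => e e0; near=> h.
    rewrite /= addr0 [h *: 1]mulr1 f0 subr0 sub0r normrN [_ *: _]/(_ * _) normrM.
    have h0 : h != 0 by near: h; exact: nbhs_dnbhs_neq.
    rewrite normfV mulrC ler_pdivrMr ?normr_gt0//.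
    apply: le_trans (fC h) _.
    rewrite -[h ^+ 2]real_normK ?num_real// expr2 mulrA ler_wpM2r//.
    apply: (@le_trans _ _ ((`|C| + 1) * `|h|)).
      by rewrite ler_wpM2r//; have := ler_norm C; lra.
    rewrite mulrC -ler_pdivlMr; last by rewrite ltr_wpDl.
    near: h; apply: dnbhs0_le; by rewrite divr_gt0// ltr_wpDl.
  rewrite f0; apply: DeriveDef; first by apply/cvg_ex; exists 0.
  exact/cvg_lim.
Unshelve. all: by end_near. Qed.

Lemma smooth_flat_exp P : smooth (flat_exp P).
Proof.
pose S : set (R -> R) := [set f | exists P, f = flat_exp P].
have dv Q (x v : R) : is_derive x v (flat_exp Q) (flat_exp (v *: ('X^2 * (Q - Q^`()))) x).
  have [d1 d2] := is_derive_flat_exp Q x.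
  have := @is_derive_comp_real R R (flat_exp Q) id x v (@derivable_id _ _ x v) d1.
  rewrite d2 derive_id mulrC.
  rewrite (_ : v * _ = flat_exp (v *: ('X^2 * (Q - Q^`()))) x)//.
  by rewrite /flat_exp; case: ifP => _; rewrite ?mulr0// hornerZ mulrA.
apply: (@smooth_coind _ _ S); last by exists P.
move=> _ [Q ->]; split.
- move=> x; apply/differentiable_continuous/derivable1_diffP.
  by have [] := dv Q x 1.
- by move=> x v; have [] := dv Q x v.
- move=> v; exists (v *: ('X^2 * (Q - Q^`()))); apply/funext => x.
  by have [_ ->] := dv Q x v.
Qed.

Definition ramp x : R := flat_exp 1 x.

Lemma rampE x : ramp x = if 0 < x then expR (- x^-1) else 0.
Proof. by rewrite /ramp /flat_exp hornerC mul1r. Qed.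

Lemma smooth_ramp : smooth ramp. Proof. exact: smooth_flat_exp. Qed.

Lemma ramp_ge0 x : 0 <= ramp x.
Proof. by rewrite rampE; case: ifP => // _; exact: expR_ge0. Qed.

Lemma ramp_le1 x : ramp x <= 1.
Proof.
rewrite rampE; case: ifP => // x0.
by rewrite -expR0 ler_expR oppr_le0 invr_ge0 ltW.
Qed.

Lemma ramp_gt0 x : (0 < ramp x) = (0 < x).
Proof. by rewrite rampE; case: ifP; rewrite ?ltxx ?expR_gt0. Qed.

(** Smooth functions that vanish off ]a, b[ and tend to the indicator function
    of this interval as n grows, see [bump_cvg]. *)
Definition bump n (a b x : R) : R := ramp (n%:R * (x - a)) * ramp (n%:R * (b - x)).

Lemma smooth_bump n a b : smooth (bump n a b).
Proof.
have lin : smooth (fun x : R => x).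
  by apply: smooth_linear => //; move=> x; exact: cvg_id.
apply: smoothM; apply: smooth_comp; try exact: smooth_ramp.
  apply: smoothM; first exact: smooth_cst.
  by apply: smoothD => //; exact: smooth_cst.
apply: smoothM; first exact: smooth_cst.
apply: smoothD; first exact: smooth_cst.
apply: smooth_linear => [h u w|x]; first by rewrite opprD mulrN.
by apply: cvgN; exact: cvg_id.
Qed.

Lemma bump_ge0 n a b x : 0 <= bump n a b x.
Proof. by rewrite mulr_ge0// ramp_ge0. Qed.

Lemma bump_le1 n a b x : bump n a b x <= 1.
Proof. by rewrite mulr_ile1// ?ramp_ge0// ramp_le1. Qed.

Lemma bump_neq0 n a b x : bump n a b x != 0 -> a < x < b.
Proof.
move=> h; have : 0 < bump n a b x by rewrite lt_def h bump_ge0.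
rewrite /bump => h2.
have : 0 < ramp (n%:R * (x - a)).
  rewrite lt_def ramp_ge0 andbT; apply: contraTneq h2 => ->.
  by rewrite mul0r ltxx.
have : 0 < ramp (n%:R * (b - x)).
  rewrite lt_def ramp_ge0 andbT; apply: contraTneq h2 => ->.
  by rewrite mulr0 ltxx.
rewrite !ramp_gt0; case: n {h h2} => [|n]; first by rewrite mul0r ltxx.
by rewrite !pmulr_rgt0// !subr_gt0 => -> ->.
Qed.

Lemma ramp_cvg (y : R) : (fun n : nat => ramp (n%:R * y)) @ \oo --> ((0 < y)%R%:R : R).
Proof.
case: (ltP 0 y) => y0; last first.
  rewrite (_ : (fun n => _) = fun=> 0); first exact: cvg_cst.
  by apply/funext => n; rewrite rampE ifF// ltNge mulr_ge0_le0.
have : (fun n : nat => expR (- (n%:R * y)^-1)) @ \oo --> expR (- 0).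
  apply: continuous_cvg; first exact: continuous_expR.
  apply: cvgN; apply/gtr0_cvgV0.
    by near=> n; rewrite mulr_gt0// ltr0n; near: n; exact: nbhs_infty_gt.
  apply/cvgryPge => A; near=> n.
  rewrite -ler_pdivrMr//.
  by near: n; exact: nbhs_infty_ger.
rewrite oppr0 expR0; apply: cvg_trans; apply: near_eq_cvg.
near=> n; rewrite rampE ifT// mulr_gt0// ltr0n.
by near: n; exact: nbhs_infty_gt.
Unshelve. all: by end_near. Qed.

Lemma bump_cvg a b x : (fun n => bump n a b x) @ \oo --> ((a < x < b)%R%:R : R).
Proof.
have := cvgM (@ramp_cvg (x - a)) (@ramp_cvg (b - x)).
by rewrite !subr_gt0 -natrM mulnb; apply.
Qed.

Lemma measurable_bump n a b : measurable_fun setT (bump n a b).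
Proof. by apply: continuous_measurable_fun; apply: smooth_continuous; exact: smooth_bump. Qed.

End bump.

(** * Product measures and uniqueness on boxes *)

Section product_tools.
Local Open Scope ereal_scope.
Context d1 d2 (T1 : measurableType d1) (T2 : measurableType d2) (R : realType).
Variables (m1 : {sigma_finite_measure set T1 -> \bar R})
          (m2 : {sigma_finite_measure set T2 -> \bar R}).
Notation m12 := (sigma_finite_product m1 m2).

Lemma tonelli1 (f : T1 * T2 -> \bar R) : measurable_fun setT f ->
  (forall z, 0 <= f z) -> \int[m12]_z f z = \int[m1]_x \int[m2]_y f (x, y).
Proof. move=> mf f0; exact: (@fubini_tonelli1 _ _ _ _ _ m1 m2 f mf f0). Qed.

Lemma tonelli2 (f : T1 * T2 -> \bar R) : measurable_fun setT f ->
  (forall z, 0 <= f z) -> \int[m12]_z f z = \int[m2]_y \int[m1]_x f (x, y).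
Proof. move=> mf f0; exact: (@fubini_tonelli2 _ _ _ _ _ m1 m2 f mf f0). Qed.

Lemma measure_tonelli1 (A : set (T1 * T2)) : measurable A ->
  m12 A = \int[m1]_x m2 [set y | A (x, y)].
Proof.
move=> mA; have := @tonelli1 (EFin \o \1_A).
rewrite integral_indic// setIT => ->; last 2 first.
- exact/measurable_EFinP.
- by move=> z; rewrite lee_fin.
apply: eq_integral => x _.
have mAx : measurable [set y | A (x, y)].
  by have := measurable_xsection x mA; rewrite xsectionE.
by rewrite -[[set y | A (x, y)]]setIT -integral_indic.
Qed.

Lemma measure_tonelli2 (A : set (T1 * T2)) : measurable A ->
  m12 A = \int[m2]_y m1 [set x | A (x, y)].
Proof.
move=> mA; have := @tonelli2 (EFin \o \1_A).
rewrite integral_indic// setIT => ->; last 2 first.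
- exact/measurable_EFinP.
- by move=> z; rewrite lee_fin.
apply: eq_integral => y _.
have mAy : measurable [set x | A (x, y)].
  by have := measurable_ysection y mA; rewrite ysectionE.
by rewrite -[[set x | A (x, y)]]setIT -integral_indic.
Qed.

Lemma measurable_section1 (A : set (T1 * T2)) x : measurable A ->
  measurable [set y | A (x, y)].
Proof. by move=> mA; have := measurable_xsection x mA; rewrite xsectionE. Qed.

Lemma measurable_section2 (A : set (T1 * T2)) y : measurable A ->
  measurable [set x | A (x, y)].
Proof. by move=> mA; have := measurable_ysection y mA; rewrite ysectionE. Qed.

Lemma measurable_measure_section1 (A : set (T1 * T2)) : measurable A ->
  measurable_fun setT (fun x => m2 [set y | A (x, y)]).
Proof.
move=> mA; have := measurable_fun_xsection m2 mA.
by apply: eq_measurable_fun => x _ /=; rewrite xsectionE.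
Qed.

Lemma measurable_measure_section2 (A : set (T1 * T2)) : measurable A ->
  measurable_fun setT (fun y => m1 [set x | A (x, y)]).
Proof.
move=> mA; have := measurable_fun_ysection m1 mA.
by apply: eq_measurable_fun => x _ /=; rewrite ysectionE.
Qed.

Lemma null_sections1 (A : set (T1 * T2)) : measurable A ->
  m12 A = 0 <-> {ae m1, forall x, m2 [set y | A (x, y)] = 0}.
Proof.
move=> mA; rewrite measure_tonelli1//.
have := ae_eq_integral_abs m1 measurableT (measurable_measure_section1 mA).
under eq_integral do rewrite gee0_abs//.
move=> ->; split; apply: filterS => x /=; last by move=> ->.
by apply.
Qed.

Lemma null_sections2 (A : set (T1 * T2)) : measurable A ->
  m12 A = 0 <-> {ae m2, forall y, m1 [set x | A (x, y)] = 0}.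
Proof.
move=> mA; rewrite measure_tonelli2//.
have := ae_eq_integral_abs m2 measurableT (measurable_measure_section2 mA).
under eq_integral do rewrite gee0_abs//.
move=> ->; split; apply: filterS => x /=; last by move=> ->.
by apply.
Qed.

Lemma ae_sections1 (P : T1 * T2 -> Prop) : {ae m12, forall z, P z} ->
  {ae m1, forall x, {ae m2, forall y, P (x, y)}}.
Proof.
move=> [A [mA A0 PA]]; have /(null_sections1 mA) := A0.
apply: filterS => x Ax0; exists [set y | A (x, y)]; split => //.
  exact: measurable_section1.
by move=> y /= nP; apply: PA.
Qed.

Lemma ae_of_sections1 (P : T1 * T2 -> Prop) : measurable [set z | ~ P z] ->
  {ae m1, forall x, {ae m2, forall y, P (x, y)}} -> {ae m12, forall z, P z}.
Proof.
move=> mP aeP; exists [set z | ~ P z]; split => //.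
apply/(null_sections1 mP); move: aeP; apply: filterS => x [A [mA A0 PA]].
apply/eqP; rewrite -measure_le0 -A0 le_measure ?inE//.
exact: (measurable_section1 x mP).
Qed.

End product_tools.

Lemma cvg_finite_prod {R : realType} (I : Type) (r : seq I) (u : I -> R^nat)
    (l : I -> R) : (forall i, u i n @[n --> \oo] --> l i) ->
  \prod_(i <- r) u i n @[n --> \oo] --> \prod_(i <- r) l i.
Proof.
move=> ul; elim: r => [|i r ih].
  rewrite big_nil (_ : (fun n => _) = fun=> 1); first exact: cvg_cst.
  by apply/funext => n; rewrite big_nil.
rewrite big_cons (_ : (fun n => _) = fun n => u i n * \prod_(i <- r) u i n).
  exact: cvgM.
by apply/funext => n; rewrite big_cons.
Qed.

Section box_uniqueness.
Context d (X : measurableType d) {R : realType} (I : finType) (c : I -> X -> R).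
Variable mu : {measure set X -> \bar R}.

Definition box (a b : I -> R) : set X := [set x | forall i, a i < c i x < b i].

Hypothesis mc : forall i, measurable_fun setT (c i).
Hypothesis gen : (@measurable _ X) `<=`
  <<s [set A | exists i (B : set R), measurable B /\ A = c i @^-1` B] >>.

Lemma measurable_box a b : measurable (box a b).
Proof.
have -> : box a b = \bigcap_(i in [set: I]) c i @^-1` `]a i, b i[.
  apply/seteqP; split => x h i; first by move=> _ /=; rewrite in_itv/=; exact: h.
  by have := h i Logic.I; rewrite /= in_itv.
apply: fin_bigcap_measurable => // i _.
by rewrite -[X in measurable X]setTI; exact: mc.
Qed.

Let boxes : set (set X) := [set A | exists a b, A = box a b].

Let setI_boxes : setI_closed boxes.
Proof.
move=> _ _ [a [b ->]] [a' [b' ->]].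
exists (fun i => Num.max (a i) (a' i)), (fun i => Num.min (b i) (b' i)).
apply/seteqP; split => x.
  move=> [h1 h2] i; rewrite gt_max lt_min.
  by have /andP[-> ->] := h1 i; have /andP[-> ->] := h2 i.
move=> h; split => i; have := h i; rewrite gt_max lt_min.
  by move=> /andP[/andP[-> _] /andP[-> _]].
by move=> /andP[/andP[_ ->] /andP[_ ->]].
Qed.

Let gen_boxes : @measurable _ X = <<s boxes >>.
Proof.
apply/seteqP; split; last first.
  apply: smallest_sub; first exact: sigma_algebra_measurable.
  by move=> _ [a [b ->]]; exact: measurable_box.
apply: (subset_trans gen); apply: smallest_sub.
  exact: smallest_sigma_algebra.
move=> _ [i [B [mB ->]]].
have : measurable_fun setT (c i : g_sigma_algebraType boxes -> R).
  apply: (measurability _ (RGenOInfty.measurableE R)) => _ [_ [r ->] <-].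
  rewrite setTI.
  rewrite (_ : _ @^-1` _ = \bigcup_(n : nat)
      box (fun j => if j == i then r else - n%:R) (fun j => n%:R)).
    apply: bigcup_measurable => n _; apply: sub_sigma_algebra.
    by eexists; eexists; reflexivity.
  apply/seteqP; split => x /=; last first.
    by move=> [n _ /(_ i)]; rewrite eqxx in_itv/= andbT => /andP[].
  rewrite in_itv/= andbT => rx.
  pose N := (\max_(j : I) Num.truncn `|c j x|).+1.
  exists N => // j.
  have cN : `|c j x| < N%:R.
    have /andP[_ h] := truncn_itv (normr_ge0 (c j x)).
    by apply: lt_le_trans h _; rewrite ler_nat ltnS (@leq_bigmax _ (fun j => Num.truncn `|c j x|)).
  move: cN; rewrite ltr_norml => /andP[h1 h2]; rewrite h2 andbT.
  by case: eqP => [->|].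
by move=> /(_ measurableT _ mB); rewrite setTI.
Qed.

Section boxes_integrals.
Variables (A B : I -> R) (f : X -> R).
Hypothesis mf : measurable_fun setT f.
Hypothesis intf : mu.-integrable (box A B) (EFin \o f).
Hypothesis integrable_box : forall a b, (forall i, A i <= a i) -> (forall i, b i <= B i) ->
  (\int[mu]_(x in box a b) (f x)%:E = 0)%E.

(** Boxes are stable under intersection and generate the sigma-algebra, so
    the Dynkin induction extends the vanishing of the integrals to all
    measurable sets, among them those where f is positive or negative. *)
Lemma box_integrals_ae0 : {ae mu, forall x, box A B x -> f x = 0}.
Proof.
have mbox : measurable (box A B) by exact: measurable_box.
have ind (E : set X) : measurable E -> (\int[mu]_(x in E `&` box A B) (f x)%:E = 0)%E.
  have intE E' : measurable E' -> mu.-integrable (E' `&` box A B) (EFin \o f).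
    move=> mE'; have mI := measurableI _ _ mE' mbox.
    by apply: integrableS intf => //; exact: subIsetr.
  move=> mE; have : <<s boxes >> E by rewrite -gen_boxes.
  apply: (@dynkin_induction _ _ boxes
    (fun E => \int[mu]_(x in E `&` box A B) (f x)%:E = 0)%E gen_boxes setI_boxes).
  - by rewrite /= setTI; exact: integrable_box.
  - move=> _ [a [b ->]].
    have -> : box a b `&` box A B =
        box (fun i => Num.max (A i) (a i)) (fun i => Num.min (B i) (b i)).
      apply/seteqP; split => x.
        move=> [h1 h2] i; rewrite gt_max lt_min.
        by have /andP[-> ->] := h1 i; have /andP[-> ->] := h2 i.
      move=> h; split => i; have := h i; rewrite gt_max lt_min.
        by move=> /andP[/andP[_ ->] /andP[_ ->]].
      by move=> /andP[/andP[-> _] /andP[-> _]].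
    by apply: integrable_box => i; rewrite ?le_max ?ge_min lexx.
  - move=> S mS /= S0.
    have : (\int[mu]_(x in box A B) (f x)%:E = 0)%E by exact: integrable_box.
    rewrite -{1}(setTI (box A B)) -(setUv S) setIUl integral_setU//; last 4 first.
    + exact: measurableI.
    + by apply: measurableI => //; exact: measurableC.
    + exact/measurable_EFinP/measurable_funTS.
    + by apply/disj_setPS => x [[Sx _] [nSx _]].
    by rewrite S0 add0e.
  - move=> F mF tF /= F0.
    rewrite setI_bigcupl integral_bigcup//.
    + by apply: eseries0 => i _ _; rewrite F0.
    + exact: trivIset_setIr.
    + by move=> k; exact: measurableI.
    + by rewrite -setI_bigcupl; apply: intE; exact: bigcup_measurable.
have : ae_eq mu (box A B) (EFin \o f) (cst 0%E).
  apply: integral_ae_eq => // E EB mE.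
  by rewrite integral0 -(setIidl EB); exact: ind.
by apply: filterS => x h /h [].
Qed.

End boxes_integrals.

Variables (A B : I -> R) (f : X -> R).
Hypothesis mf : measurable_fun setT f.
Hypothesis intf : mu.-integrable (box A B) (EFin \o f).
Hypothesis f0 : forall a b n, (forall i, A i <= a i) -> (forall i, b i <= B i) ->
  (\int[mu]_(x in box A B) (f x * \prod_i bump n (a i) (b i) (c i x)) = 0)%R.

Let integrable_box a b : (forall i, A i <= a i) -> (forall i, b i <= B i) ->
  (\int[mu]_(x in box a b) (f x)%:E = 0)%E.
Proof.
move=> Aa bB.
have sub : box a b `<=` box A B.
  move=> x h i; have /andP[h1 h2] := h i.
  by rewrite (le_lt_trans (Aa i) h1) (lt_le_trans h2 (bB i)).
pose g n x := f x * \prod_i bump n (a i) (b i) (c i x).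
have prod01 n x : 0 <= \prod_i bump n (a i) (b i) (c i x) <= 1.
  apply/andP; split; first by apply: prodr_ge0 => i _; exact: bump_ge0.
  by apply: prodr_ile1 => i _; rewrite bump_ge0 bump_le1.
have mg n : measurable_fun (box A B) (EFin \o g n).
  apply/measurable_EFinP; apply: measurable_funTS; apply: measurable_funM => //.
  apply: (@measurable_prod _ _ _ _ _ _ (fun i x => bump n (a i) (b i) (c i x))) => i _.
  by apply: measurableT_comp => //; exact: measurable_bump.
have mbox : measurable (box A B) by exact: measurable_box.
have := @dominated_convergence _ _ _ mu _ mbox (fun n => EFin \o g n)
  (EFin \o (fun x => f x * \1_(box a b) x)) (fun x => `|(f x)%:E|%E) mg.
case.
- apply/measurable_EFinP; apply: measurable_funTS; apply: measurable_funM => //.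
  by apply: measurable_indic; exact: measurable_box.
- apply: aeW => x _; apply: cvg_EFin; first exact: nearW.
  rewrite /comp /g /=; apply: cvgM; first exact: cvg_cst.
  have -> : \1_(box a b) x = \prod_i ((a i < c i x < b i)%R%:R : R).
    rewrite indicE; case: (boolP (x \in _)) => [|xab].
      rewrite inE => h; rewrite big1// => i _; by rewrite h.
    have /existsNP[i hi] : ~ (forall i, a i < c i x < b i).
      by move=> h; move/negP: xab; apply; rewrite inE.
    by rewrite (bigD1 i)//= (negbTE (introN idP hi)) mul0r.
  apply: (@cvg_finite_prod _ _ _ (fun i n => bump n (a i) (b i) (c i x))) => i.
  exact: bump_cvg.
- by have := integrable_abse intf; apply.
- apply: aeW => x n _ /=; rewrite lee_fin normrM ler_piMr//.
  by have /andP[h1 h2] := prod01 n x; rewrite ger0_norm.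
move=> intg _ gcvg.
have : (\int[mu]_(x in box A B) (f x * \1_(box a b) x)%:E = 0)%E.
  apply: (cvg_unique _ gcvg) => //.
  apply: cvg_near_cst; apply: nearW => n /=.
  have := f0 n Aa bB; rewrite /Rintegral => h.
  rewrite -[RHS]/(0%R%:E) -h fineK//.
  apply: integrable_fin_num => //.
  apply: (@le_integrable _ _ _ mu _ mbox _ (fun x => (f x)%:E)) => //.
    exact: mg.
  move=> x _ /=; rewrite lee_fin normrM ler_piMr//.
  by have /andP[h1 h2] := prod01 n x; rewrite ger0_norm.
rewrite -{2}(setIidr sub) integral_mkcondr; congr (_ = _).
apply: eq_integral => x _; rewrite patchE indicE.
by case: ifP => _; rewrite ?mulr1 ?mulr0.
Qed.

(** Weak equations only provide integrals against smooth products; dominated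
    convergence of the bumps to indicator functions reduces them to boxes. *)
Lemma box_ae0 : {ae mu, forall x, box A B x -> f x = 0}.
Proof. exact: (box_integrals_ae0 mf intf integrable_box). Qed.

End box_uniqueness.

(** * Measure-preserving maps *)

Section measure_preserving.
Context d1 d2 (X : measurableType d1) (Y : measurableType d2) (R : realType).
Variables (m1 : {measure set X -> \bar R}) (m2 : {measure set Y -> \bar R}).
Variable phi : X -> Y.
Hypothesis mphi : measurable_fun setT phi.
Hypothesis m12 : forall A, measurable A -> m2 A = m1 (phi @^-1` A).

Lemma ge0_integral_preserving (f : Y -> \bar R) :
  measurable_fun setT f -> (forall y, 0 <= f y)%E ->
  (\int[m2]_y f y = \int[m1]_x f (phi x))%E.
Proof.
move=> mf f0.
have := @ge0_integral_pushforward _ _ X Y R phi mphi m1 setT f measurableT mf.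
rewrite preimage_setT => <-//.
apply: (eq_measure_integral
  (measure_function_pushforward__canonical__measure_function_Measure m1 mphi)) => A mA _.
exact: m12.
Qed.

Lemma integral_preserving (f : Y -> \bar R) : m2.-integrable setT f ->
  (\int[m2]_y f y = \int[m1]_x f (phi x))%E.
Proof.
move=> /integrableP[mf _]; rewrite integralE [RHS]integralE.
have mp := measurable_funepos mf; have mn := measurable_funeneg mf.
rewrite (ge0_integral_preserving mp (funepos_ge0 _)).
rewrite (ge0_integral_preserving mn (funeneg_ge0 _)).
have e1 := funepos_comp f phi; have e2 := funeneg_comp f phi.
by rewrite -[fun x => f (phi x)]/(f \o phi) e1 e2.
Qed.

Lemma ae_preserving (P : Y -> Prop) : {ae m2, forall y, P y} ->
  {ae m1, forall x, P (phi x)}.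
Proof.
move=> [A [mA A0 PA]]; exists (phi @^-1` A); split.
- by rewrite -[X in measurable X]setTI; exact: mphi.
- by rewrite -m12.
- by move=> x /= nP; apply: PA.
Qed.

Lemma ae_of_preserving (P : Y -> Prop) : measurable [set y | ~ P y] ->
  {ae m1, forall x, P (phi x)} -> {ae m2, forall y, P y}.
Proof.
move=> mP [A [mA A0 PA]]; exists [set y | ~ P y]; split => //.
rewrite m12//; apply/eqP; rewrite -measure_le0 -A0 le_measure ?inE//.
by rewrite -[X in measurable X]setTI; exact: mphi.
Qed.

End measure_preserving.

Section translation.
Context {R : realType}.

Lemma lebesgue_measure_shift (v : R) (A : set R) : measurable A ->
  lebesgue_measure A = lebesgue_measure [set x | A (x + v)] :> \bar R.
Proof.
have ms : measurable_fun setT (fun x : measurableTypeR R => (x + v : measurableTypeR R)).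
  by apply: measurable_funD => //; exact: measurable_cst.
move=> mA.
have := @lebesgue_measure_unique R
  (measure_function_pushforward__canonical__measure_function_Measure lebesgue_measure ms).
apply => //.
move=> _ [[a b] _ <-].
have E : (fun x : measurableTypeR R => (x + v : measurableTypeR R)) @^-1`
    `]a, b]%classic = `]a - v, b - v]%classic.
  by apply/seteqP; split => x /=; rewrite !in_itv/= ltrBlDr lerBrDr.
rewrite /= /pushforward E !lebesgue_measure_itv/= !lte_fin.
have -> : (a - v < b - v) = (a < b) by rewrite ltrD2r.
case: ifP => // _; rewrite -!EFinB; congr EFin; ring.
Qed.

Lemma lebesgue_rVS n (A : set 'rV[R]_n.+1) : measurable A ->
  lebesgue_rV n.+1 A = (\int[lebesgue_measure]_a lebesgue_rV n [set w | A (rV_cons (a, w))])%E.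
Proof.
move=> mA; rewrite -(@measure_tonelli1 _ _ _ _ _ lebesgue_measure (lebesgue_rV n)
  (@rV_cons R n @^-1` A))//.
by rewrite -[X in measurable X]setTI; exact: measurable_rV_cons.
Qed.

Lemma measurable_rV_shift n (v : 'rV[R]_n) :
  measurable_fun setT (fun x : 'rV[R]_n => x + v).
Proof.
apply: measurable_fun_rVP => i.
rewrite (_ : _ \o _ = fun x => rV_coord i x + v ord0 i).
  by apply: measurable_funD => //; exact: measurable_rV_coord.
by apply/funext => x; rewrite /rV_coord/= mxE.
Qed.

(** By induction on the dimension, one coordinate at a time. *)
Lemma lebesgue_rV_shift n (v : 'rV[R]_n) (A : set 'rV[R]_n) : measurable A ->
  lebesgue_rV n A = lebesgue_rV n [set x | A (x + v)].
Proof.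
elim: n v A => [|n ih] v A mA.
  by rewrite (_ : [set x | _] = A)//; apply/seteqP; split => x /=; rewrite [v]thinmx0 addr0.
have mAv : measurable [set x | A (x + v)].
  by rewrite -[X in measurable X]setTI; exact: (measurable_rV_shift v).
rewrite !lebesgue_rVS//.
pose w := (\row_i v ord0 (lift ord0 i)) : 'rV[R]_n.
have E a : [set x | A (rV_cons (a, x) + v)] =
    [set x | [set y | A (rV_cons (a + v ord0 ord0, y))] (x + w)].
  apply/seteqP; split => x /=; rewrite (_ : rV_cons (a, x) + v = rV_cons (a + v ord0 ord0, x + w))//;
  apply/rowP => i; rewrite !mxE; case: (unliftP ord0 i) => [j|] ->/=;
    by rewrite ?liftK ?unlift_none/= ?mxE.
have mc : measurable (@rV_cons R n @^-1` A : set (measurableTypeR R * 'rV[R]_n)).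
  by rewrite -[X in measurable X]setTI; exact: measurable_rV_cons.
under [RHS]eq_integral => a _.
  rewrite /= E -ih; last first.
    exact: (measurable_section1 (a + v ord0 ord0) mc).
  over.
pose F (a : measurableTypeR R) := lebesgue_rV n [set y | A (rV_cons (a, y))].
rewrite -[LHS]/(\int[lebesgue_measure]_a F a)%E -[RHS]/(\int[lebesgue_measure]_a F (a + v ord0 ord0)%R)%E.
apply: (@ge0_integral_preserving _ _ (measurableTypeR R) (measurableTypeR R) R lebesgue_measure lebesgue_measure (fun a => a + v ord0 ord0)).
- by apply: measurable_funD => //; exact: measurable_cst.
- by move=> B mB; exact: lebesgue_measure_shift.
- exact: (@measurable_measure_section1 _ _ _ _ _ (lebesgue_rV n) _ mc).
- by move=> a; exact: measure_ge0.
Qed.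

End translation.

(** * Coordinates along the characteristics *)

Section countable_unions.
Lemma countable_union_measurable d (X : measurableType d) (J : countType) (F : J -> set X) :
  (forall j, measurable (F j)) -> measurable (\bigcup_j F j).
Proof.
move=> mF.
have -> : \bigcup_j F j = \bigcup_(n : nat) oapp F set0 (unpickle n).
  apply/seteqP; split => x.
    by move=> [j _ Fx]; exists (pickle j) => //; rewrite pickleK.
  by move=> [n _]; case: unpickle => //= j Fx; exists j.
by apply: bigcup_measurable => n _; case: unpickle => /=.
Qed.

Lemma ae_countable d (X : measurableType d) (R : realType)
    (mu : {measure set X -> \bar R}) (J : countType) (P : J -> X -> Prop) :
  (forall j, {ae mu, forall x, P j x}) -> {ae mu, forall x, forall j, P j x}.
Proof.
move=> aeP.
have : {ae mu, forall x, forall n : nat, oapp (P^~ x) True (unpickle n)}.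
  apply/ae_foralln => n.
  by case: unpickle => [j|]/=; [exact: aeP|exact: aeW].
by apply: filterS => x h j; have := h (pickle j); rewrite pickleK.
Qed.

End countable_unions.

Section rV_sets.
Context {R : realType} (n : nat).

Definition open_box (a b : 'I_n -> R) : set 'rV[R]_n :=
  [set x | forall i, a i < x ord0 i < b i].

Lemma measurable_open_box a b : measurable (open_box a b).
Proof. exact: (measurable_box (@measurable_rV_coord R n)). Qed.

(** Rational boxes form a countable base, so open sets are Borel for the
    product structure. *)
Lemma rational_box (A : set 'rV[R]_n) x : open A -> A x ->
  exists ab : {ffun 'I_n -> rat} * {ffun 'I_n -> rat},
    open_box (fun i => ratr (ab.1 i)) (fun i => ratr (ab.2 i)) x /\
    open_box (fun i => ratr (ab.1 i)) (fun i => ratr (ab.2 i)) `<=` A.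
Proof.
move=> oA Ax.
have /nbhs_ballP[e /= e0 eA] : nbhs x A by exact: open_nbhs_nbhs.
have ex i : exists ab : rat * rat, (x ord0 i - e < ratr ab.1 < x ord0 i) /\
    (x ord0 i < ratr ab.2 < x ord0 i + e).
  have [a] : exists q : rat, ratr q \in `]x ord0 i - e, x ord0 i[.
    by apply: rat_in_itvoo; lra.
  rewrite in_itv/= => ha.
  have [b] : exists q : rat, ratr q \in `]x ord0 i, x ord0 i + e[.
    by apply: rat_in_itvoo; lra.
  by rewrite in_itv/= => hb; exists (a, b).
have [g gP] := choice ex.
exists ([ffun i => (g i).1], [ffun i => (g i).2]); split.
  by move=> i /=; rewrite !ffunE; have [/andP[_ ->] /andP[-> _]] := gP i.
move=> y yb; apply: eA; split => // i j; rewrite (ord1 i).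
have := yb j; rewrite /= !ffunE => /andP[y1 y2].
have [/andP[h1 h2] /andP[h3 h4]] := gP j.
rewrite /ball/= ltr_norml; apply/andP; split; lra.
Qed.

Lemma measurable_open (A : set 'rV[R]_n) : open A -> measurable A.
Proof.
move=> oA.
have -> : A = \bigcup_(ab : {ffun 'I_n -> rat} * {ffun 'I_n -> rat})
   [set x | open_box (fun i => ratr (ab.1 i)) (fun i => ratr (ab.2 i)) x /\
    open_box (fun i => ratr (ab.1 i)) (fun i => ratr (ab.2 i)) `<=` A].
  apply/seteqP; split => x; last by move=> [ab _ [h1 h2]]; exact: h2.
  by move=> Ax; have [ab h] := rational_box oA Ax; exists ab.
apply: countable_union_measurable => ab.
have [sub|nsub] := pselect (open_box (fun i => ratr (ab.1 i)) (fun i => ratr (ab.2 i)) `<=` A).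
  rewrite (_ : [set x | _] = open_box (fun i => ratr (ab.1 i)) (fun i => ratr (ab.2 i))).
    exact: measurable_open_box.
  by apply/seteqP; split => x //= -[].
rewrite (_ : [set x | _] = set0); first exact: measurable0.
by apply/seteqP; split => x //= -[].
Qed.

Lemma measurable_closed (A : set 'rV[R]_n) : closed A -> measurable A.
Proof.
by move=> /closed_openC/measurable_open/measurableC; rewrite setCK.
Qed.

End rV_sets.

Section cube.
Context {R : realType}.

Definition cube n (a : 'rV[R]_n) (r : R) : set 'rV[R]_n :=
  [set x | forall i, a ord0 i <= x ord0 i <= a ord0 i + r].

Lemma measurable_cube n (a : 'rV[R]_n) r : measurable (cube a r).
Proof.
have -> : cube a r = \bigcap_(i in [set: 'I_n]) rV_coord i @^-1` `[a ord0 i, a ord0 i + r].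
  apply/seteqP; split => x h i; first by move=> _ /=; rewrite in_itv/=; exact: h.
  by have := h i Logic.I; rewrite /= in_itv.
apply: fin_bigcap_measurable => // i _.
by rewrite -[X in measurable X]setTI; exact: measurable_rV_coord.
Qed.

Lemma lebesgue_rV_cube n (a : 'rV[R]_n) r : 0 <= r ->
  lebesgue_rV n (cube a r) = (r ^+ n)%:E.
Proof.
move=> r0; elim: n a => [|n ih] a.
  rewrite expr0 (_ : cube a r = setT); first by rewrite /= diracT.
  by apply/seteqP; split => // x _ [].
rewrite lebesgue_rVS; last exact: measurable_cube.
pose a' : 'rV[R]_n := \row_j a ord0 (lift ord0 j).
have E s : [set w | cube a r (rV_cons (s, w))] =
    if (a ord0 ord0 <= s <= a ord0 ord0 + r) then cube a' r else set0.
  case: ifP => h; apply/seteqP; split => w //.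
  - move=> hw j; have := hw (lift ord0 j); rewrite !mxE liftK /=; exact.
  - move=> hw i; rewrite mxE; case: (unliftP ord0 i) => [j|] ->/=.
      by have := hw j; rewrite mxE.
    by [].
  - move=> hw; have := hw ord0; rewrite mxE unlift_none /= => h'.
    by rewrite h' in h.
under eq_integral => s _.
  rewrite E (_ : lebesgue_rV n _ =
    ((r ^+ n) * \1_(`[a ord0 ord0, (a ord0 ord0 + r)%R]%classic : set (measurableTypeR R)) s)%:E); last first.
    rewrite indicE; case: ifPn => h.
      by rewrite ih mem_set ?mulr1//= in_itv.
    by rewrite measure0 memNset ?mulr0//= in_itv/=; exact/negP.
  rewrite EFinM.
  over.
rewrite ge0_integralZl//; last by rewrite lee_fin exprn_ge0.
rewrite integral_indic// setIT/= lebesgue_measure_itv/= lte_fin.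
case: ltP => h.
  by rewrite -EFinB -EFinM exprS; congr EFin; ring.
have -> : r = 0 by apply/eqP; rewrite eq_le r0 andbT; lra.
by rewrite mule0 exprS mul0r.
by apply/measurable_EFinP; apply: measurable_indic.
Qed.

End cube.

Section characteristics.
Context {R : realType} {d : nat}.
Notation RT := (measurableTypeR R).
Notation space := 'rV[R]_d.

Definition char_point (q : space * space) (s : R) : space := q.1 + s *: q.2.

(** A point of the phase space is described by its characteristic, given by
    the position y at time 0 and the direction k, and by the time s. Positions
    y run through the whole space, as the line may enter the domain later. *)
Definition char_map (p : (space * space) * RT) : RT * space * space :=
  (p.2, char_point p.1 p.2, p.1.2).

Lemma measurable_char_point d1 (Y : measurableType d1) (f g : Y -> space) (h : Y -> RT) :
  measurable_fun setT f -> measurable_fun setT g -> measurable_fun setT h ->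
  measurable_fun setT (fun y => f y + h y *: g y).
Proof.
move=> mf mg mh; apply: measurable_fun_rVP => i.
rewrite (_ : _ \o _ = fun y => rV_coord i (f y) + h y * rV_coord i (g y)).
  apply: measurable_funD; first exact: measurableT_comp (measurable_rV_coord i) mf.
  by apply: measurable_funM => //; exact: measurableT_comp (measurable_rV_coord i) mg.
by apply/funext => x; rewrite /rV_coord/= !mxE.
Qed.

Lemma measurable_char_map : measurable_fun setT char_map.
Proof.
apply/measurable_fun_pairP; split; last first.
  exact: measurableT_comp measurable_snd measurable_fst.
apply/measurable_fun_pairP; split; first exact: measurable_snd.
apply: measurable_char_point => //.
- exact: measurableT_comp measurable_fst measurable_fst.
- exact: measurableT_comp measurable_snd measurable_fst.
Qed.

Definition char_measure : set ((space * space) * RT) -> \bar R :=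
  sigma_finite_product initial_measure lebesgue_measure.

HB.instance Definition _ := SigmaFiniteMeasure.on char_measure.

(** For each time and direction the change of coordinates is a translation. *)
Lemma char_map_preserving (A : set (RT * space * space)) : measurable A ->
  phase_measure A = char_measure (char_map @^-1` A).
Proof.
move=> mA.
have mB : measurable (char_map @^-1` A).
  by rewrite -[X in measurable X]setTI; exact: measurable_char_map.
pose C : set ((RT * space) * space) := [set p | A (p.1.1, p.2, p.1.2)].
have mC : measurable C.
  rewrite -[X in measurable X]setTI.
  apply: (_ : measurable_fun setT (fun p : (RT * space) * space => (p.1.1, p.2, p.1.2))) => //.
  apply/measurable_fun_pairP; split; last exact: measurableT_comp measurable_snd measurable_fst.
  apply/measurable_fun_pairP; split; last exact: measurable_snd.
  exact: measurableT_comp measurable_fst measurable_fst.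
pose h (p : RT * space) := lebesgue_rV d [set x | C (p, x)].
have mh : measurable_fun setT h.
  exact: (@measurable_measure_section1 _ _ _ _ _ (lebesgue_rV d) _ mC).
have h0 p : (0 <= h p)%E by exact: measure_ge0.
have -> : phase_measure A = _ := measure_tonelli2 spacetime_measure sphere_measure mA.
have -> : char_measure (char_map @^-1` A) = _ :=
  measure_tonelli2 initial_measure lebesgue_measure mB.
transitivity (\int[sphere_measure]_k \int[lebesgue_measure]_s h (s, k))%E.
  apply: eq_integral => k _.
  transitivity (\int[lebesgue_measure]_s lebesgue_rV d [set x | A (s, x, k)])%E => //.
  exact: (measure_tonelli1 lebesgue_measure (lebesgue_rV d) (measurable_section2 k mA)).
rewrite -(tonelli2 lebesgue_measure sphere_measure mh h0).
rewrite (tonelli1 lebesgue_measure sphere_measure mh h0).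
apply: eq_integral => s _.
transitivity (\int[sphere_measure]_k
    lebesgue_rV d [set y | (char_map @^-1` A) ((y, k), s)])%E; last first.
  apply/esym.
  exact: (measure_tonelli2 (lebesgue_rV d) sphere_measure (measurable_section2 s mB)).
apply: eq_integral => k _.
rewrite /h (lebesgue_rV_shift (s *: k)) //.
exact: (measurable_section1 (s, k) mC).
Qed.

End characteristics.

(** * Primitives of bounded functions *)

Section primitives.
Context {R : realType}.
Notation mu := (@lebesgue_measure R).
Notation RT := (measurableTypeR R).
Implicit Types (f g : R -> R).

Lemma bounded_measurable_comp d d' (X : measurableType d) (Y : measurableType d')
    (f : Y -> R) (h : X -> Y) : measurable_fun setT h ->
  bounded_measurable f -> bounded_measurable (f \o h).
Proof.
move=> mh [mf [M fM]]; split; first exact: measurableT_comp mf mh.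
by exists M => x /=.
Qed.

Lemma restrict_support d (X : measurableType d) (D : set X) (f : X -> R) :
  (forall x, ~ D x -> f x = 0) -> f \_ D = f.
Proof.
move=> fD; apply/funext => x; rewrite patchE; case: ifPn => //.
by rewrite notin_setE => /fD.
Qed.

Lemma integrable_support d (X : measurableType d) (m : {measure set X -> \bar R})
    (D : set X) (f : X -> R) : measurable D -> (m D < +oo)%E ->
  bounded_measurable f -> (forall x, ~ D x -> f x = 0) ->
  m.-integrable setT (EFin \o f).
Proof.
move=> mD Doo bf fD.
have := bounded_measurable_integrable mD Doo bf.
by move/(integrable_mkcond _ mD); rewrite restrict_EFin restrict_support.
Qed.

(** Adding the bound M to g makes the integrand nonnegative, so that Tonelli's
    theorem gives measurability; M times the length is subtracted again. *)
Lemma bounded_measurable_itv_int d (Y : measurableType d) (g : Y * RT -> R)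
    (lo hi : Y -> R) (K : R) : bounded_measurable g ->
  measurable_fun setT lo -> measurable_fun setT hi ->
  (forall y, hi y - lo y <= K) ->
  bounded_measurable (fun y => itv_int (fun r => g (y, r)) (lo y) (hi y)).
Proof.
move=> [mg [M gM]] mlo mhi hK.
have mgy y : measurable_fun setT (fun r : RT => g (y, r)).
  by apply: measurableT_comp mg _; exact: measurable_pair1.
have bgy y : bounded_measurable (fun r : R => g (y, r)).
  by split; [exact: mgy|exists M].
split; last first.
  exists (`|M| * `|K|) => y; have [h|h] := leP (lo y) (hi y).
    apply: le_trans (itv_int_le (bgy y) h (fun r => gM (y, r))) _.
    by apply: ler_pM; rewrite ?ler_norm ?(le_trans _ (gM (y, 0)))// ?subr_ge0//
      (le_trans (hK y)) ?ler_norm.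
  rewrite /itv_int set_itv_ge ?bnd_simp -?ltNge// Rintegral_set0 normr0.
  by rewrite mulr_ge0.
pose D : set (Y * RT) := [set p | lo p.1 <= p.2 <= hi p.1].
have mD : measurable D.
  rewrite (_ : D = [set p | lo p.1 <= p.2] `&` [set p | p.2 <= hi p.1]); last first.
    by apply/seteqP; split => p /=; [move=> /andP[]|move=> [h1 h2]; apply/andP].
  have m1 : measurable_fun setT (lo \o fst : Y * RT -> R) by exact: measurableT_comp.
  have m2 : measurable_fun setT (hi \o fst : Y * RT -> R) by exact: measurableT_comp.
  have m3 : measurable_fun setT (snd : Y * RT -> R) by exact: measurable_snd.
  by apply: measurableI; rewrite -[X in measurable X]setTI; exact: measurable_fun_le.
pose G (p : Y * RT) : R := (g p + M) * \1_D p.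
have mG : measurable_fun setT G.
  by apply: measurable_funM; [exact: measurable_funD|exact: measurable_indic].
have gM0 p : 0 <= g p + M by have := gM p; rewrite ler_norml => /andP[]; lra.
have G0 p : (0 <= (EFin \o G) p)%E by rewrite lee_fin mulr_ge0.
have mEG : measurable_fun setT (EFin \o G) by exact/measurable_EFinP.
have mF := @measurable_fun_fubini_tonelli_F _ _ Y RT R mu (EFin \o G) mEG G0.
rewrite (_ : (fun y => _) = fun y => fine (\int[mu]_r (G (y, r))%:E)%E - M * Num.max (hi y - lo y) 0).
  apply: measurable_funB; first by apply: measurableT_comp mF; exact: fine_measurable.
  by apply: measurable_funM => //; apply: measurable_maxr => //; exact: measurable_funB.
apply/funext => y.
have E : \int[mu]_(r in `[lo y, hi y]) (g (y, r) + M) = fine (\int[mu]_r (G (y, r))%:E)%E.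
  rewrite /Rintegral integral_mkcond; congr fine; apply: eq_integral => r _.
  rewrite patchE /G indicE.
  case: ifPn => h; first by rewrite mem_set ?mulr1//; move: h; rewrite inE/= in_itv.
  rewrite memNset ?mulr0//; apply: contraNnot h => h.
  by rewrite inE/= in_itv.
rewrite -E.
have [h|h] := leP (lo y) (hi y); last first.
  rewrite max_r; last by lra.
  by rewrite /itv_int set_itv_ge ?bnd_simp -?ltNge// !Rintegral_set0 mulr0 subr0.
rewrite max_l ?subr_ge0// -[X in X - _]/(itv_int (fun r => g (y, r) + M) _ _).
rewrite itv_int_add//; last exact: bounded_measurable_cst.
by rewrite itv_int_cst// addrK.
Qed.

Lemma bounded_measurable_section d (Y : measurableType d) (g : Y * RT -> R) y :
  bounded_measurable g -> bounded_measurable (fun r : R => g (y, r)).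
Proof.
move=> [mg [M gM]]; split; last by exists M.
by apply: measurableT_comp mg _; exact: measurable_pair1.
Qed.

(** The value is frozen after b; the primitive of a function with support in
    ]a, b[ and mean zero then has compact support. *)
Definition primitive a b f (t : R) : R := itv_int f a (Num.min t b).

Lemma bounded_measurable_primitive a b f : bounded_measurable f ->
  bounded_measurable (primitive a b f).
Proof.
move=> bf.
have := @bounded_measurable_itv_int _ RT (fun p => f p.2) (fun=> a) (fun t => Num.min t b) (b - a).
apply.
- exact: (@bounded_measurable_comp _ _ _ _ f snd).
- exact: measurable_cst.
- by apply: measurable_minr => //; exact: measurable_id.
- by move=> y; rewrite lerB// ge_min lexx orbT.
Qed.

Lemma primitiveB a b f s t : bounded_measurable f -> a <= s -> s <= t -> t <= b ->
  primitive a b f t - primitive a b f s = itv_int f s t.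
Proof.
move=> bf as_ st tb; rewrite /primitive !min_l//; last exact: le_trans tb.
by rewrite (@itv_intD _ f a s t)// addrAC subrr add0r.
Qed.

Lemma itv_int0 f a : itv_int f a a = 0.
Proof. by rewrite /itv_int set_itv1 Rintegral_set1. Qed.

Lemma primitive_start a b f : a <= b -> primitive a b f a = 0.
Proof. by move=> ab; rewrite /primitive min_l// itv_int0. Qed.

(** For merely bounded functions: the defect of the product rule on an
    interval is additive and quadratically small, hence zero by
    [quadratic_superadditive_ge0] applied to it and to its opposite. *)
Lemma integration_by_parts a b f g : a < b ->
  bounded_measurable f -> bounded_measurable g ->
  itv_int (fun t => f t * primitive a b g t + primitive a b f t * g t) a b =
  primitive a b f b * primitive a b g b.
Proof.
move=> ab bf bg.
have [_ [M fM]] := bf; have [_ [N gN]] := bg.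
have M0 : 0 <= M by apply: le_trans (fM 0).
have N0 : 0 <= N by apply: le_trans (gN 0).
pose F := primitive a b f; pose G := primitive a b g.
have bF : bounded_measurable F by exact: bounded_measurable_primitive.
have bG : bounded_measurable G by exact: bounded_measurable_primitive.
pose h t := f t * G t + F t * g t.
have bh : bounded_measurable h by apply: bounded_measurableD; exact: bounded_measurableM.
pose E s t := itv_int h s t - (F t * G t - F s * G s).
(* the defect E is additive and quadratically small *)
have addE x m y : a <= x -> x < m -> m < y -> E x y = E x m + E m y.
  by move=> ax xm my; rewrite /E (itv_intD bh (ltW xm) (ltW my)); ring.
have quadE x y : a <= x -> x < y -> y <= b ->
    `|E x y| <= (2 * M * N) * (y - x) ^+ 2.
  move=> ax xy yb.
  have -> : E x y = itv_int (fun r => f r * (G r - G x) + (F r - F y) * g r) x y.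
    rewrite /E.
    have -> : F y * G y - F x * G x = G x * (F y - F x) + F y * (G y - G x) by ring.
    rewrite (primitiveB bf ax (ltW xy) yb) (primitiveB bg ax (ltW xy) yb).
    have bcf := bounded_measurableZ (G x) bf; have bcg := bounded_measurableZ (F y) bg.
    have bs := bounded_measurableD bcf bcg.
    rewrite -!itv_intZ// -itv_int_add// -itv_intB//.
    by congr itv_int; apply/funext => r; rewrite /h; ring.
  have bk : bounded_measurable (fun r => f r * (G r - G x) + (F r - F y) * g r).
    apply: bounded_measurableD; apply: bounded_measurableM => //;
      by apply: bounded_measurableB => //; exact: bounded_measurable_cst.
  have est r : x < r < y -> `|f r * (G r - G x) + (F r - F y) * g r| <= 2 * M * N * (y - x).
    move=> /andP[xr ry].
    have h1 : `|G r - G x| <= N * (y - x).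
      rewrite (primitiveB bg ax (ltW xr) (le_trans (ltW ry) yb)).
      apply: le_trans (itv_int_le bg (ltW xr) gN) _.
      by rewrite ler_wpM2l//; lra.
    have h2 : `|F r - F y| <= M * (y - x).
      rewrite distrC (primitiveB bf (le_trans ax (ltW xr)) (ltW ry) yb).
      apply: le_trans (itv_int_le bf (ltW ry) fM) _.
      by rewrite ler_wpM2l//; lra.
    apply: le_trans (ler_normD _ _) _; rewrite !normrM.
    have h3 : `|f r| * `|G r - G x| <= M * (N * (y - x)) by exact: ler_pM.
    have h4 : `|F r - F y| * `|g r| <= M * (y - x) * N by exact: ler_pM.
    lra.
  rewrite ler_norml expr2 mulrA; apply/andP; split.
    rewrite -mulNr; apply: (@itv_int_ge _ _ _ _ _ setT) => //; first exact: ltW.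
      by rewrite setDT; exact: negligible_set0.
    by move=> r _ /est; rewrite ler_norml => /andP[].
  have : - (2 * M * N * (y - x)) * (y - x) <= itv_int (fun r => -1 * (f r * (G r - G x) + (F r - F y) * g r)) x y.
    apply: (@itv_int_ge _ _ _ _ _ setT) => //; first exact: bounded_measurableZ.
    - exact: ltW.
    - by rewrite setDT; exact: negligible_set0.
    by move=> r _ /est; rewrite ler_norml => /andP[_]; lra.
  by rewrite itv_intZ//; lra.
have dense : forall x y : R, setT x -> setT y -> a <= x -> x < y -> y <= b ->
    exists2 m, setT m & x + (y - x) / 3 < m < x + 2 * (y - x) / 3.
  by move=> x y _ _ _ xy _; exists ((x + y) / 2) => //; apply/andP; split; lra.
have h1 : 0 <= E a b.
  apply: (@quadratic_superadditive_ge0 _ setT E (2 * M * N)) => //.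
    by move=> x m y _ _ _ ax xm my _; rewrite -(addE x m y).
  by move=> x y _ _ ax xy yb; have := quadE x y ax xy yb; rewrite ler_norml mulNr => /andP[].
have h2 : 0 <= - E a b.
  apply: (@quadratic_superadditive_ge0 _ setT (fun x y => - E x y) (2 * M * N)) => //.
    by move=> x m y _ _ _ ax xm my _; rewrite -opprD -(addE x m y).
  by move=> x y _ _ ax xy yb; have := quadE x y ax xy yb; rewrite ler_norml mulNr => /andP[_]; rewrite lerN2.
have : E a b = 0 by apply/eqP; rewrite eq_le h1 andbT -oppr_ge0.
rewrite /E {2}/F {2}/G !primitive_start ?ltW// mul0r subr0 => /eqP.
by rewrite subr_eq0 => /eqP.
Qed.

Section smooth_primitive.
Variables (a b : R) (f : R -> R).
Hypothesis ab : a < b.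
Hypothesis sf : smooth f.
Hypothesis f0 : forall t, ~~ (a < t < b) -> f t = 0.
Hypothesis fint : itv_int f a b = 0.
Hypothesis bf : bounded_measurable f.

Lemma primitive_out (t : R) : ~~ (a < t < b) -> primitive a b f t = 0.
Proof.
rewrite /primitive; have [ta _|at_] := leP t a.
  rewrite min_l; last by have ab' := ab; lra.
  move: ta; rewrite le_eqVlt => /predU1P[->|ta]; first exact: itv_int0.
  by rewrite /itv_int set_itv_ge ?bnd_simp -?ltNge// Rintegral_set0.
by rewrite /= -leNgt => bt; rewrite min_r.
Qed.

Lemma primitive_derivative (t : R) : is_derive t (1 : R) (primitive a b f) (f t).
Proof.
have E : primitive a b f = fun x => \int[mu]_(r in `]-oo, x]) f r.
  apply/funext => x; rewrite /primitive /itv_int Rintegral_mkcond [RHS]Rintegral_mkcond.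
  apply: eq_Rintegral => r _; rewrite !patchE.
  case: ifPn; case: ifPn => // h1 h2.
    move: h1 h2; rewrite notin_setE inE /= !in_itv/= le_min => h1 /andP[_ /andP[h2 _]].
    by rewrite h2 in h1.
  move: h1 h2; rewrite notin_setE inE /= !in_itv/= le_min => h1 h2.
  rewrite f0//; apply: contraNN; last first.
    by apply/negP; exact: h2.
  by move=> /andP[h3 h4]; rewrite h1 (ltW h3) (ltW h4).
rewrite E.
have int : mu.-integrable `]-oo, (t + 1)] (EFin \o f).
  have : mu.-integrable setT (EFin \o f).
    apply: (@integrable_support _ _ mu `[a, b]%classic f) => //.
      by rewrite /= lebesgue_measure_itv/=; case: ifPn => // _; rewrite -EFinB ltry.
    move=> r /negP; rewrite /= in_itv/= => nr; apply: f0.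
    by apply: contra nr => /andP[/ltW -> /ltW ->].
  by move=> intT; apply: integrableS intT.
have t1 : t < t + 1 by rewrite ltrDl.
have := @continuous_FTC1 R f -oo%O t (t + 1) t1 int.
rewrite ltNyr => /(_ isT (smooth_continuous sf (x := t)))[d1 d2].
by apply: DeriveDef => //; rewrite -d2 derive1E.
Qed.

Lemma smooth_primitive : smooth (primitive a b f).
Proof.
apply: smooth_real => [x|]; first by have [] := primitive_derivative x.
rewrite (_ : 'D_(1 : R) (primitive a b f) = f)//; apply/funext => x.
by have [_ ->] := primitive_derivative x.
Qed.

End smooth_primitive.

Lemma ramp_mono (x y : R) : 0 < x -> x <= y -> ramp x <= ramp y.
Proof.
move=> x0 xy; have y0 := lt_le_trans x0 xy.
by rewrite !rampE x0 y0 ler_expR lerN2 lef_pV2.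
Qed.

Lemma bounded_measurable_bump n (a b : R) : bounded_measurable (bump n a b).
Proof.
split; first exact: measurable_bump.
by exists 1 => x; rewrite ger0_norm ?bump_ge0// bump_le1.
Qed.

Lemma itv_int_bump_gt0 (a b : R) : a < b -> 0 < itv_int (bump 1 a b) a b.
Proof.
move=> ab; have bb := bounded_measurable_bump 1 a b.
pose c := (2 * a + b) / 3; pose e := (a + 2 * b) / 3.
have ac : a <= c by rewrite /c; lra.
have ce : c <= e by rewrite /c /e; lra.
have eb : e <= b by rewrite /e; lra.
rewrite (itv_intD bb ac (le_trans ce eb)) (itv_intD bb ce eb).
have n0 : mu.-negligible (`]c, e[ `\` setT) by rewrite setDT; exact: negligible_set0.
have pos s t : s <= t -> 0 <= itv_int (bump 1 a b) s t.
  by move=> _; apply: Rintegral_ge0 => r _; exact: bump_ge0.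
have w0 : 0 < (b - a) / 3 by lra.
have : ramp ((b - a) / 3) ^+ 2 * (e - c) <= itv_int (bump 1 a b) c e.
  apply: (@itv_int_ge _ _ _ _ _ setT) => // r _ /andP[cr re].
  rewrite /bump !mul1r expr2; apply: ler_pM; rewrite ?ramp_ge0//.
    by apply: ramp_mono => //; move: cr; rewrite /c; lra.
  by apply: ramp_mono => //; move: re; rewrite /e; lra.
have : 0 < ramp ((b - a) / 3) ^+ 2 * (e - c).
  by rewrite mulr_gt0// ?exprn_gt0 ?ramp_gt0//; rewrite /c /e; lra.
have := pos _ _ ac; have := pos _ _ eb; lra.
Qed.

End primitives.

(** * The transport equation in characteristic coordinates *)

Section characteristic_coordinates.
Context {R : realType} {d : nat}.
Notation RT := (measurableTypeR R).
Notation space := 'rV[R]_d.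
Notation J := ('I_d + 'I_d)%type.

Definition line_coord (j : J) (q : space * space) : R :=
  match j with inl i => q.1 ord0 i | inr i => q.2 ord0 i end.

Definition char_coord (i : J + 'I_1) (x : (space * space) * RT) : R :=
  match i with inl j => line_coord j x.1 | inr _ => x.2 end.

Lemma measurable_line_coord j : measurable_fun setT (line_coord j).
Proof.
case: j => i.
  exact: measurableT_comp (measurable_rV_coord i) measurable_fst.
exact: measurableT_comp (measurable_rV_coord i) measurable_snd.
Qed.

Lemma measurable_char_coord i : measurable_fun setT (char_coord i).
Proof.
case: i => [j|j]; last exact: measurable_snd.
exact: measurableT_comp (measurable_line_coord j) measurable_fst.
Qed.

Lemma char_coord_generate : (@measurable _ ((space * space) * RT)%type) `<=`
  <<s [set A | exists i (B : set R), measurable B /\ A = char_coord i @^-1` B] >>.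
Proof.
set G := [set A | _].
have mc i : measurable_fun setT (char_coord i : g_sigma_algebraType G -> R).
  move=> _ B mB; rewrite setTI; apply: sub_sigma_algebra.
  by exists i, B.
have : measurable_fun setT (id : g_sigma_algebraType G -> (space * space) * RT).
  apply/measurable_fun_pairP; split; last exact: (mc (inr ord0)).
  apply/measurable_fun_pairP; split.
    by apply: measurable_fun_rVP => i; exact: (mc (inl (inl i))).
  by apply: measurable_fun_rVP => i; exact: (mc (inl (inr i))).
by move=> mid A mA; have := mid measurableT _ mA; rewrite setTI.
Qed.

Definition line_box (A B : J -> R) : set (space * space) :=
  [set q | forall j, A j <= line_coord j q <= B j].

Lemma line_boxE A B : line_box A B =
  [set q : space * space | (forall i, A (inl i) <= q.1 ord0 i <= B (inl i)) /\
           (forall i, A (inr i) <= q.2 ord0 i <= B (inr i))].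
Proof.
apply/seteqP; split => q.
  by move=> h; split => i; [exact: (h (inl i))|exact: (h (inr i))].
by move=> [h1 h2] [i|i]; [exact: h1|exact: h2].
Qed.

Lemma compact_line_box A B : compact (line_box A B).
Proof.
have cb (a b : 'I_d -> R) : compact [set x : space | forall i, a i <= x ord0 i <= b i].
  have := @rV_compact R d (fun i => `[a i, b i]%classic) (fun i => @segment_compact R (a i) (b i)).
  congr compact; apply/seteqP; split => x h i; have := h i; rewrite /= in_itv//=.
rewrite line_boxE.
have := compact_setX (cb (A \o inl) (B \o inl)) (cb (A \o inr) (B \o inr)).
congr compact.
Qed.

Lemma measurable_line_box A B : measurable (line_box A B).
Proof.
have -> : line_box A B = \bigcap_(j in [set: J]) line_coord j @^-1` `[A j, B j].
  apply/seteqP; split => q h j; first by move=> _ /=; rewrite in_itv/=; exact: h.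
  by have := h j Logic.I; rewrite /= in_itv.
apply: fin_bigcap_measurable => // j _.
by rewrite -[X in measurable X]setTI; exact: measurable_line_coord.
Qed.

Lemma initial_measure_line_box A B : (initial_measure (line_box A B) < +oo)%E.
Proof.
pose a : space := \row_i A (inl i).
pose r := \sum_(i < d) `|B (inl i) - A (inl i)|.
have r0 : 0 <= r by exact: sumr_ge0.
have mC := measurable_cube a r.
apply: (@le_lt_trans _ _ (initial_measure (cube a r `*` setT))).
  apply: le_measure; rewrite ?inE; [exact: measurable_line_box|exact: measurableX|].
  move=> q h; split => // i; rewrite !mxE.
  have /andP[-> h2] := h (inl i); apply: le_trans h2 _.
  rewrite -lerBlDl; apply: le_trans (ler_norm _) _.
  rewrite /r (bigD1 i)//= lerDl; exact: sumr_ge0.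
have -> : initial_measure (cube a r `*` setT) =
    (lebesgue_rV d (cube a r) * sphere_measure [set: space])%E.
  exact: (@product_measure1E _ _ _ _ _ (lebesgue_rV d) sphere_measure).
rewrite lebesgue_rV_cube// lte_mul_pinfty ?lee_fin ?exprn_ge0//.
by rewrite -ge0_fin_numE ?measure_ge0//; exact: fin_num_measure.
Qed.

Lemma char_measure_box A B (a b : R) :
  (char_measure (line_box A B `*` `[a, b]%classic) < +oo)%E.
Proof.
have -> : char_measure (line_box A B `*` `[a, b]%classic) =
    (initial_measure (line_box A B) * lebesgue_measure `[a, b]%classic)%E.
  apply: (@product_measure1E _ _ _ _ _ initial_measure lebesgue_measure) => //.
  exact: measurable_line_box.
apply: lte_mul_pinfty => //.
  by rewrite ge0_fin_numE//; exact: initial_measure_line_box.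
by rewrite lebesgue_measure_itv/=; case: ifPn => // _; rewrite -EFinB ltry.
Qed.

Section test_functions.
Variables (T : R) (Omega : set space).

Definition line_weight n (a b : J -> R) (q : space * space) : R :=
  \prod_j bump n (a j) (b j) (line_coord j q).

Lemma line_weight_neq0 n a b q : line_weight n a b q != 0 ->
  forall j, a j < line_coord j q < b j.
Proof. by move=> /prodf_neq0 h j; apply: bump_neq0 (h j isT). Qed.

Lemma bounded_measurable_line_weight n a b : bounded_measurable (line_weight n a b).
Proof.
split.
  apply: (@measurable_prod _ _ _ _ _ _ (fun j q => bump n (a j) (b j) (line_coord j q))) => j _.
  exact: measurableT_comp (measurable_bump n _ _) (measurable_line_coord j).
exists 1 => q; rewrite ger0_norm; last by apply: prodr_ge0 => j _; exact: bump_ge0.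
by apply: prodr_ile1 => j _; rewrite bump_ge0 bump_le1.
Qed.

Definition char_inverse (p : R * space * space) : space * space :=
  (p.1.2 - p.1.1 *: p.2, p.2).

(** A test function that localizes the lines by bumps and depends on time by
    eta. It is constant along the characteristics up to eta, so its transport
    derivative only differentiates eta. *)
Definition char_test (eta : R -> R) n a b (p : R * space * space) : R :=
  eta p.1.1 * line_weight n a b (char_inverse p).

Lemma smooth_char_test eta n a b : smooth eta -> smooth (char_test eta n a b).
Proof.
move=> seta.
have sz : smooth (fun p : R * space * space => p.1.1).
  apply: smooth_linear => // p; apply: (@cvg_comp _ _ _ (fst : R * space * space -> _)).
    exact: cvg_fst.
  exact: cvg_fst.
have sx i : smooth (fun p : R * space * space => p.1.2 ord0 i).
  apply: smooth_linear => [h v v'|p]; first by rewrite /= !mxE.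
  apply: (@continuous_comp _ _ _ (fun p : R * space * space => p.1.2)
    (fun x : space => x ord0 i)).
    apply: (@cvg_comp _ _ _ (fst : R * space * space -> _)); [exact: cvg_fst|exact: cvg_snd].
  exact: coord_continuous.
have sk i : smooth (fun p : R * space * space => p.2 ord0 i).
  apply: smooth_linear => [h v v'|p]; first by rewrite /= !mxE.
  apply: (@continuous_comp _ _ _ (fun p : R * space * space => p.2)
    (fun x : space => x ord0 i)); [exact: cvg_snd|exact: coord_continuous].
apply: smoothM; first exact: smooth_comp.
apply: (@smooth_prod R _ J _ (fun j p => bump n (a j) (b j) (line_coord j (char_inverse p)))).
move=> j; apply: smooth_comp; first exact: smooth_bump.
case: j => i //=.
rewrite (_ : (fun p => _) = fun p : R * space * space =>
   p.1.2 ord0 i + (-1) * (p.1.1 * p.2 ord0 i)).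
  by apply: smoothD => //; apply: smoothM; [exact: smooth_cst|exact: smoothM].
by apply/funext => p; rewrite !mxE mulN1r.
Qed.

Lemma char_test_derive eta n a b (p : R * space * space) : smooth eta ->
  'D_(1, p.2, 0) (char_test eta n a b) p =
  'D_1 eta p.1.1 * line_weight n a b (char_inverse p).
Proof.
case: p => [[z x] k] /= seta.
set c := line_weight n a b (char_inverse (z, x, k)).
have E h : char_test eta n a b (h *: ((1 : R), k, (0 : space)) + (z, x, k)) =
    eta (h + z) * c.
  rewrite /char_test /= [h *: 1]mulr1; congr (_ * line_weight _ _ _ _).
  rewrite /char_inverse/= scaler0 add0r scalerDl.
  by rewrite [h%:A]mulr1 opprD addrACA subrr add0r.
have -> : 'D_1 eta z * c = 'D_1 (fun t : R => eta t * c) z.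
  rewrite -[fun t : R => eta t * c]/(c \o* eta) deriveMr; first by rewrite mulrC.
  exact: smooth_derivable.
have FE : (fun h : R => h^-1 *: ((char_test eta n a b \o shift (z, x, k))
      (h *: ((1 : R), k, (0 : space))) - char_test eta n a b (z, x, k))) =
    (fun h => h^-1 *: (((fun t => eta t * c) \o shift z) (h *: 1) - eta z * c)).
  by apply/funext => h; rewrite /= E /char_test/= -/c [h *: 1]mulr1.
by rewrite /derive FE.
Qed.


Lemma char_test_compact_support eta n (A B a b : J -> R) (al be : R) :
  smooth eta -> (forall t, ~~ (al < t < be) -> eta t = 0) ->
  (forall j, A j <= a j) -> (forall j, b j <= B j) ->
  0 < al -> be < T ->
  (forall q s, line_box A B q -> al <= s <= be -> Omega (char_point q s)) ->
  test_function T Omega (char_test eta n a b).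
Proof.
move=> seta eta0 Aa bB al0 beT inO; split; first exact: smooth_char_test.
pose cm (x : (space * space) * R) : R * space * space :=
  (x.2, x.1.1 + x.2 *: x.1.2, x.1.2).
exists (cm @` (line_box A B `*` `[al, be]%classic)); split.
- apply: continuous_compact; last first.
    by apply: compact_setX; [exact: compact_line_box|exact: segment_compact].
  apply: continuous_subspaceT => x.
  have c1 : {for x, continuous (fun x : (space * space) * R => x.1.1)}.
    by apply: (@cvg_comp _ _ _ (fst : (space * space) * R -> _)); [exact: cvg_fst|exact: cvg_fst].
  have c2 : {for x, continuous (fun x : (space * space) * R => x.1.2)}.
    by apply: (@cvg_comp _ _ _ (fst : (space * space) * R -> _)); [exact: cvg_fst|exact: cvg_snd].
  have c3 : {for x, continuous (fun x : (space * space) * R => x.2)} by exact: cvg_snd.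
  have c4 : {for x, continuous (fun x : (space * space) * R => x.1.1 + x.2 *: x.1.2)}.
    exact: (cvgD c1 (cvgZ c3 c2)).
  exact: (cvg_pair (cvg_pair c3 c4) c2).
- move=> _ [[q s] [/= qb hs] <-]; move: hs; rewrite in_itv/= => sab.
  split => //; split => /=.
    by rewrite in_itv/=; case/andP: sab => h1 h2; rewrite (lt_le_trans al0 h1) (le_lt_trans h2 beT).
  exact: inO.
- move=> p np; rewrite /char_test; apply/eqP/negPn/negP; rewrite mulf_eq0 negb_or.
  move=> /andP[h1 h2]; apply: np; exists (char_inverse p, p.1.1).
    split => /=.
      move=> j; have /andP[h3 h4] := line_weight_neq0 h2 j.
      by rewrite (le_trans (Aa j) (ltW h3)) (le_trans (ltW h4) (bB j)).
    rewrite in_itv/=.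
    have : al < p.1.1 < be by apply: contra_neqT h1 => /eta0.
    by move=> /andP[/ltW -> /ltW ->].
  by case: p {h1 h2} => [[z x] k]; rewrite /cm /= subrK.
Qed.

Lemma char_inverseK x : char_inverse (char_map x) = x.1.
Proof. by case: x => [[y k] s]; rewrite /char_inverse /char_map /= addrK. Qed.

Lemma measurable_char_inverse :
  measurable_fun setT (char_inverse : RT * space * space -> space * space).
Proof.
apply/measurable_fun_pairP; split; last exact: measurable_snd.
rewrite (_ : _ \o _ = fun p : RT * space * space => p.1.2 + (- p.1.1) *: p.2).
  apply: measurable_char_point.
  - exact: measurableT_comp measurable_snd measurable_fst.
  - exact: measurable_snd.
  - apply: measurable_funN.
    exact: measurableT_comp measurable_fst measurable_fst.
by apply/funext => p; rewrite /= scaleNr.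
Qed.

Section weak_equation.
Variables (u w : RT * space * space -> R).
Hypotheses (bu : bounded_measurable u) (bw : bounded_measurable w).
Hypothesis mX : measurable (phase_space T Omega : set (RT * space * space)).
Hypothesis Xoo : (phase_measure (phase_space T Omega) < +oo)%E.
Hypothesis u_out : forall p, ~ phase_space T Omega p -> u p = 0.
Hypothesis w_out : forall p, ~ phase_space T Omega p -> w p = 0.
Hypothesis uw : transport_derivative T Omega u w.

Lemma Rintegral_support d1 (X : measurableType d1) (m : {measure set X -> \bar R})
    (D : set X) (f : X -> R) : (forall x, ~ D x -> f x = 0) ->
  \int[m]_(x in D) f x = \int[m]_x f x.
Proof. by move=> fD; rewrite Rintegral_mkcond restrict_support. Qed.

Lemma Rintegral_char_map (f : RT * space * space -> R) :
  phase_measure.-integrable setT (EFin \o f) ->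
  \int[phase_measure]_p f p = \int[char_measure]_x f (char_map x).
Proof.
move=> intf; rewrite /Rintegral.
by rewrite (integral_preserving measurable_char_map char_map_preserving intf).
Qed.

(** The test function needs compact support in the phase space, whence the
    condition that the box of lines stays in the domain during [al, be]. *)
Lemma weak_equation_char eta n (A B a b : J -> R) (al be : R) :
  smooth eta -> (forall t, ~~ (al < t < be) -> eta t = 0) ->
  bounded_measurable (eta : RT -> R) -> bounded_measurable ('D_1 eta : RT -> R) ->
  (forall j, A j <= a j) -> (forall j, b j <= B j) ->
  0 < al -> be < T ->
  (forall q s, line_box A B q -> al <= s <= be -> Omega (char_point q s)) ->
  \int[char_measure]_x (('D_1 eta x.2 * u (char_map x) + eta x.2 * w (char_map x))
    * line_weight n a b x.1) = 0.
Proof.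
move=> seta eta0 beta bDeta Aa bB al0 beT inO.
have tphi := char_test_compact_support n seta eta0 Aa bB al0 beT inO.
have := uw tphi.
pose F p := u p * ('D_1 eta p.1.1 * line_weight n a b (char_inverse p)).
pose G p := w p * char_test eta n a b p.
have mz : measurable_fun setT (fun p : RT * space * space => p.1.1).
  exact: measurableT_comp measurable_fst measurable_fst.
have bpsi := bounded_measurable_comp measurable_char_inverse (bounded_measurable_line_weight n a b).
have bF : bounded_measurable F.
  apply: bounded_measurableM => //; apply: bounded_measurableM => //.
  exact: (bounded_measurable_comp mz bDeta).
have bG : bounded_measurable G.
  apply: bounded_measurableM => //; apply: bounded_measurableM => //.
  exact: (bounded_measurable_comp mz beta).
have Fout p : ~ phase_space T Omega p -> F p = 0 by move=> /u_out h; rewrite /F h mul0r.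
have Gout p : ~ phase_space T Omega p -> G p = 0 by move=> /w_out h; rewrite /G h mul0r.
have iF := integrable_support mX Xoo bF Fout.
have iG := integrable_support mX Xoo bG Gout.
rewrite (_ : (fun p => _) = F); last first.
  by apply/funext => p; rewrite /F char_test_derive.
rewrite -/G (@Rintegral_support _ _ phase_measure _ F)// (@Rintegral_support _ _ phase_measure _ G)//.
move=> /eqP; rewrite -addr_eq0 -RintegralD// => /eqP.
have iFG : phase_measure.-integrable setT (EFin \o (fun p => F p + G p)).
  by have := integrableD measurableT iF iG; apply.
rewrite (Rintegral_char_map iFG) => <-.
apply: eq_Rintegral => x _; rewrite /F /G /char_test char_inverseK /=; ring.
Qed.

Section local_representation.
Variables (A B : J -> R) (al be : R).
Hypotheses (al0 : 0 < al) (albe : al < be) (beT : be < T).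
Hypothesis inO : forall q s, line_box A B q -> al <= s <= be -> Omega (char_point q s).

Let U (x : (space * space) * RT) := u (char_map x).
Let W (x : (space * space) * RT) := w (char_map x).

Let bU : bounded_measurable U.
Proof. exact: (bounded_measurable_comp measurable_char_map bu). Qed.

Let bW : bounded_measurable W.
Proof. exact: (bounded_measurable_comp measurable_char_map bw). Qed.

Let om (s : R) := (itv_int (bump 1 al be) al be)^-1 * bump 1 al be s.

Let bom : bounded_measurable (om : RT -> R).
Proof. by apply: bounded_measurableZ; exact: bounded_measurable_bump. Qed.

Let omint : itv_int om al be = 1.
Proof.
rewrite /om itv_intZ; last exact: bounded_measurable_bump.
by rewrite mulVf// gt_eqF// itv_int_bump_gt0.
Qed.

Let N (x : (space * space) * RT) := primitive al be (fun r => W (x.1, r)) x.2.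

Let bN : bounded_measurable N.
Proof.
have := @bounded_measurable_itv_int R _ ((space * space) * RT)%type
  (fun p => W (p.1.1, p.2)) (fun=> al) (fun x => Num.min x.2 be) (be - al).
apply.
- apply: (@bounded_measurable_comp _ _ _ _ _ W (fun p => (p.1.1, p.2))) => //.
  apply/measurable_fun_pairP; split; last exact: measurable_snd.
  exact: measurableT_comp measurable_fst measurable_fst.
- exact: measurable_cst.
- by apply: measurable_minr; [exact: measurable_snd|exact: measurable_cst].
- by move=> y; rewrite lerB// ge_min lexx orbT.
Qed.

Let c0 (q : space * space) := itv_int (fun r => om r * (U (q, r) - N (q, r))) al be.

Let bc0 : bounded_measurable c0.
Proof.
have := @bounded_measurable_itv_int R _ (space * space)%type
  (fun p => om p.2 * (U p - N p)) (fun=> al) (fun=> be) (be - al).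
apply => //.
apply: bounded_measurableM; last exact: bounded_measurableB.
exact: (bounded_measurable_comp measurable_snd bom).
Qed.

Let f (x : (space * space) * RT) := U x - N x - c0 x.1.

Let bf : bounded_measurable f.
Proof.
apply: bounded_measurableB; first exact: bounded_measurableB.
exact: (bounded_measurable_comp measurable_fst bc0).
Qed.

(** Tested against b on one line, f gives the weak equation for the primitive
    of b - (int b) om. *)
Let line_identity (b : R -> R) q : bounded_measurable (b : RT -> R) ->
  let th s := b s - itv_int b al be * om s in
  itv_int (fun s => b s * f (q, s)) al be =
  itv_int (fun s => th s * U (q, s) + primitive al be th s * W (q, s)) al be.
Proof.
move=> bb th.
have bth : bounded_measurable (th : RT -> R).
  by apply: bounded_measurableB => //; exact: bounded_measurableZ.
have bUq := bounded_measurable_section q bU.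
have bWq := bounded_measurable_section q bW.
have bNq := bounded_measurable_section q bN.
have thint : primitive al be th be = 0.
  rewrite /primitive min_l// /th itv_intB//; last exact: bounded_measurableZ.
  by rewrite itv_intZ// omint mulr1 subrr.
have ibp := integration_by_parts albe bth bWq.
rewrite thint mul0r in ibp.
have bpth : bounded_measurable (primitive al be th : RT -> R).
  exact: bounded_measurable_primitive.
have bthU := bounded_measurableM bth bUq.
have bpW := bounded_measurableM bpth bWq.
have bthN := bounded_measurableM bth bNq.
have bD := bounded_measurableB bUq bNq.
have bthD := bounded_measurableM bth bD.
have e1 : itv_int (fun s => th s * U (q, s) + primitive al be th s * W (q, s)) al be =
   itv_int (fun s => th s * (U (q, s) - N (q, s))) al be.
  have -> : (fun s => th s * (U (q, s) - N (q, s))) =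
      (fun s => (th s * U (q, s) + primitive al be th s * W (q, s)) -
        (th s * N (q, s) + primitive al be th s * W (q, s))).
    by apply/funext => s; ring.
  rewrite itv_intB; [|exact: bounded_measurableD|exact: bounded_measurableD].
  by rewrite [X in _ - X](_ : _ = 0) ?subr0//; exact: ibp.
rewrite e1.
have bbD := bounded_measurableM bb bD.
have bbc := bounded_measurableZ (c0 q) bb.
have bomD := bounded_measurableM bom bD.
have -> : (fun s => b s * f (q, s)) =
    (fun s => b s * (U (q, s) - N (q, s)) - c0 q * b s).
  by apply/funext => s; rewrite /f; ring.
have -> : (fun s => th s * (U (q, s) - N (q, s))) =
    (fun s => b s * (U (q, s) - N (q, s)) -
       itv_int b al be * (om s * (U (q, s) - N (q, s)))).
  by apply/funext => s; rewrite /th; ring.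
rewrite !itv_intB//; last exact: bounded_measurableZ.
by rewrite !itv_intZ// /c0 mulrC.
Qed.

(** Let N be the primitive of W on each line. The weak equation shows that
    U - N is orthogonal to the derivatives of test functions, and any bump b
    minus its integral times om is such a derivative. So U - N equals its mean
    c0 against om. All bumps b are tested together with the box weights by one
    use of [box_ae0], which avoids choosing null sets line by line. *)
Lemma local_representation : {ae char_measure, forall x,
  (forall j, A j < line_coord j x.1 < B j) -> al < x.2 < be ->
  u (char_map x) = itv_int (fun r => w (char_map (x.1, r))) al x.2 + c0 x.1}.
Proof.
pose A' (i : J + 'I_1) := match i with inl j => A j | inr _ => al end.
pose B' (i : J + 'I_1) := match i with inl j => B j | inr _ => be end.
pose S := line_box A B `*` `[al, be]%classic.
have mS : measurable S by apply: measurableX => //; exact: measurable_line_box.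
have Soo : (char_measure S < +oo)%E by exact: char_measure_box.
have boxS : box char_coord A' B' `<=` S.
  move=> x h; split => /=.
    by move=> j; have /andP[h1 h2] := h (inl j); rewrite (ltW h1) (ltW h2).
  by have /andP[h1 h2] := h (inr ord0); rewrite in_itv/= (ltW h1) (ltW h2).
have mbox : measurable (box char_coord A' B').
  exact: (measurable_box measurable_char_coord).
have intf : char_measure.-integrable (box char_coord A' B') (EFin \o f).
  apply: bounded_measurable_integrable => //.
  by apply: le_lt_trans Soo; apply: le_measure; rewrite ?inE.
have := @box_ae0 _ _ R (J + 'I_1)%type char_coord char_measure measurable_char_coord
  char_coord_generate A' B' f bf.1 intf.
have H : forall a' b' n, (forall i, A' i <= a' i) -> (forall i, b' i <= B' i) ->
    \int[char_measure]_(x in box char_coord A' B')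
     (f x * \prod_i bump n (a' i) (b' i) (char_coord i x)) = 0.
  move=> a' b' n Aa bB.
  pose psi := line_weight n (a' \o inl) (b' \o inl).
  pose b := bump n (a' (inr ord0)) (b' (inr ord0)).
  have prodE x : \prod_i bump n (a' i) (b' i) (char_coord i x) = psi x.1 * b x.2.
    by rewrite big_sumType/= big_ord1.
  pose g x := psi x.1 * (b x.2 * f x).
  rewrite (_ : (fun x => _) = g); last by apply/funext => x; rewrite prodE /g; ring.
  have bb : bounded_measurable (b : RT -> R) by exact: bounded_measurable_bump.
  have bpsi : bounded_measurable psi by exact: bounded_measurable_line_weight.
  have bpsi1 := bounded_measurable_comp
    (measurable_fst : measurable_fun setT (fst : (space * space) * RT -> _)) bpsi.
  have b2 h : bounded_measurable (h : RT -> R) ->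
      bounded_measurable (fun x : (space * space) * RT => h x.2).
    by move=> bh; exact: (bounded_measurable_comp measurable_snd bh).
  have bg : bounded_measurable g.
    by apply: bounded_measurableM => //; apply: bounded_measurableM => //; exact: b2.
  have psi_out q : psi q != 0 -> forall j, A j < line_coord j q < B j.
    move=> /line_weight_neq0 h j; have /andP[h1 h2] := h j.
    by rewrite (le_lt_trans (Aa (inl j)) h1) (lt_le_trans h2 (bB (inl j))).
  have b_out s : ~~ (al < s < be) -> b s = 0.
    move=> h; apply: contraNeq h => /bump_neq0/andP[h1 h2].
    by rewrite (le_lt_trans (Aa (inr ord0)) h1) (lt_le_trans h2 (bB (inr ord0))).
  have g_out x : ~ box char_coord A' B' x -> g x = 0.
    move=> nbx; apply/eqP/negPn/negP; rewrite /g mulf_eq0 negb_or => /andP[h1].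
    rewrite mulf_eq0 negb_or => /andP[h2 _].
    apply: nbx => -[j|j] /=; first exact: psi_out.
    by apply: contra_neqT h2 => /b_out.
  rewrite Rintegral_support//.
  pose th s := b s - itv_int b al be * om s.
  have bth : bounded_measurable (th : RT -> R).
    by apply: bounded_measurableB => //; exact: bounded_measurableZ.
  have om_out s : ~~ (al < s < be) -> om s = 0.
    move=> h; rewrite /om (_ : bump _ _ _ _ = 0) ?mulr0//.
    by apply: contraNeq h; exact: bump_neq0.
  have th_out s : ~~ (al < s < be) -> th s = 0.
    by move=> h; rewrite /th b_out// om_out// mulr0 subr0.
  have sth : smooth th.
    have -> : th = fun s => b s + (- itv_int b al be * (itv_int (bump 1 al be) al be)^-1) * bump 1 al be s.
      by apply/funext => s; rewrite /th /om; ring.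
    apply: smoothD; first exact: smooth_bump.
    by apply: smoothM; [exact: smooth_cst|exact: smooth_bump].
  have thint : itv_int th al be = 0.
    rewrite /th itv_intB//; last exact: bounded_measurableZ.
    by rewrite itv_intZ// omint mulr1 subrr.
  pose eta := primitive al be th.
  have seta : smooth eta by exact: smooth_primitive.
  have eta_out s : ~~ (al < s < be) -> eta s = 0 by exact: primitive_out.
  have DetaE s : 'D_1 eta s = th s.
    by have [_ ->] := primitive_derivative sth th_out bth s.
  have Deta : 'D_1 eta = th by apply/funext.
  have beta : bounded_measurable (eta : RT -> R) by exact: bounded_measurable_primitive.
  have bDeta : bounded_measurable ('D_1 eta : RT -> R) by rewrite Deta.
  have weak := @weak_equation_char eta n A B (a' \o inl) (b' \o inl) al be seta eta_out beta bDeta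
    (fun j => Aa (inl j)) (fun j => bB (inl j)) al0 beT inO.
  pose k x := (th x.2 * U x + eta x.2 * W x) * psi x.1.
  have bk : bounded_measurable k.
    apply: bounded_measurableM => //.
    by apply: bounded_measurableD; apply: bounded_measurableM => //; exact: b2.
  have k_out x : ~ S x -> k x = 0.
    move=> nSx; rewrite /k; have [->|h1] := eqVneq (psi x.1) 0; first by rewrite mulr0.
    have h2 : ~~ (al < x.2 < be).
      apply/negP => /andP[h2 h3]; apply: nSx; split => /=.
        by move=> j; have /andP[h4 h5] := psi_out _ h1 j; rewrite (ltW h4) (ltW h5).
      by rewrite in_itv/= (ltW h2) (ltW h3).
    by rewrite th_out// eta_out// !mul0r addr0 mul0r.
  have boxoo : (char_measure (box char_coord A' B') < +oo)%E.
    by apply: le_lt_trans Soo; apply: le_measure; rewrite ?inE.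
  have ig := integrable_support (m := char_measure) mbox boxoo bg g_out.
  have ik := integrable_support (m := char_measure) mS Soo bk k_out.
  have : \int[char_measure]_x (g x - k x) = 0.
    have igk : char_measure.-integrable setT (EFin \o (fun x => g x - k x)).
      by have := integrableB measurableT ig ik; apply.
    rewrite /Rintegral.
    have -> : (\int[char_measure]_x (g x - k x)%:E =
       \int[initial_measure]_q \int[lebesgue_measure]_s (g (q, s) - k (q, s))%:E)%E.
      by apply/esym; exact: (@integral12_prod_meas1 _ _ _ _ _ initial_measure lebesgue_measure _ igk).
    rewrite integral0_eq// => q _.
    have out s : ~ `[al, be]%classic s -> g (q, s) - k (q, s) = 0.
      rewrite /= in_itv/= => /negP h.
      have h' : ~~ (al < s < be) by apply: contra h => /andP[/ltW -> /ltW ->].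
      by rewrite /g /k b_out// th_out// eta_out// !mul0r mulr0 addr0 mul0r subrr.
    have igq : \int[lebesgue_measure]_s (g (q, s) - k (q, s)) = 0.
      rewrite -(@Rintegral_support _ _ lebesgue_measure `[al, be]%classic)//.
      have li := line_identity q bb.
      have bUq := bounded_measurable_section q bU.
      have bWq := bounded_measurable_section q bW.
      have bfq := bounded_measurable_section q bf.
      have -> : (fun s => g (q, s) - k (q, s)) = (fun s => psi q * (b s * f (q, s)) -
          psi q * (th s * U (q, s) + eta s * W (q, s))).
        by apply/funext => s; rewrite /g /k /=; ring.
      have bbf := bounded_measurableM bb bfq.
      have btU := bounded_measurableM bth bUq.
      have beW := bounded_measurableM beta bWq.
      have bs := bounded_measurableD btU beW.
      have := itv_intB al be (bounded_measurableZ (psi q) bbf) (bounded_measurableZ (psi q) bs).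
      by rewrite !itv_intZ// li subrr; apply.
    have bgk := bounded_measurable_section q (bounded_measurableB bg bk).
    have loo : (lebesgue_measure `[al, be]%classic < +oo :> \bar R)%E.
      by rewrite lebesgue_measure_itv/=; case: ifPn => // _; rewrite -EFinB ltry.
    have iq := integrable_support (m := lebesgue_measure) (measurable_itv _) loo bgk out.
    by rewrite -(fineK (integrable_fin_num measurableT iq)); congr EFin.
  rewrite RintegralB// => /eqP; rewrite subr_eq0 => /eqP ->.
  rewrite -[RHS]weak; apply: eq_Rintegral => x _; rewrite /k.
  by rewrite DetaE.
move=> /(_ H); apply: filterS => x h hq hs.
have : f x = 0.
  by apply: h => -[j|j] /=; [exact: hq|].
rewrite /f /N /primitive min_l; last by case/andP: hs => _ /ltW.
by move=> /eqP; rewrite subr_eq0 subr_eq => /eqP; rewrite addrC.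
Qed.

End local_representation.
End weak_equation.
End test_functions.
End characteristic_coordinates.

(** * Increments along almost every characteristic *)

Section convex_lines.
Context {R : realType} {d : nat}.
Notation RT := (measurableTypeR R).
Notation space := 'rV[R]_d.
Notation J := ('I_d + 'I_d)%type.

Lemma convex_setE (Omega : set space) :
  convex_set (Omega : set (convex_lmodType 'rV[R]_d)) ->
  forall x y t, Omega x -> Omega y -> 0 <= t <= 1 -> Omega (t *: x + (1 - t) *: y).
Proof.
move=> cO x y t Ox Oy /andP[t0 t1].
by have := cO x y (Itv01 t0 t1) (mem_set Ox) (mem_set Oy); rewrite inE.
Qed.

Lemma convex_line (Omega : set space) (q : space * space) (a b s : R) :
  convex_set (Omega : set (convex_lmodType 'rV[R]_d)) ->
  Omega (char_point q a) -> Omega (char_point q b) -> a <= s <= b ->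
  Omega (char_point q s).
Proof.
move=> cO Oa Ob /andP[as_ sb].
have [ab|ab] := eqVneq a b.
  by have -> : s = a by apply/eqP; rewrite eq_le as_ andbT ab.
have ab' : 0 < b - a by rewrite subr_gt0 lt_neqAle ab (le_trans as_).
pose t := (b - s) / (b - a).
have t01 : 0 <= t <= 1.
  rewrite /t; apply/andP; split.
    by apply: divr_ge0; [rewrite subr_ge0|exact: ltW].
  by rewrite ler_pdivrMr// mul1r; lra.
have := convex_setE cO Oa Ob t01.
congr Omega; rewrite /char_point !scalerDr addrACA -scalerDl (addrC t) subrK scale1r.
rewrite !scalerA -scalerDl; congr (_ + _ *: _).
by rewrite /t; field; rewrite gt_eqF.
Qed.

Lemma continuous_char_point (q : space * space) : continuous (char_point q).
Proof.
move=> s; apply: cvgD; first exact: cvg_cst.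
by apply: (@cvgZ _ _ _ _ _ id (fun=> q.2) s q.2); [exact: cvg_id|exact: cvg_cst].
Qed.

Lemma continuous_char_point1 (s : R) :
  continuous (fun q : space * space => char_point q s).
Proof.
move=> q; apply: cvgD; first exact: cvg_fst.
by apply: (@cvgZ _ _ _ _ _ (fun=> s) snd s q.2); [exact: cvg_cst|exact: cvg_snd].
Qed.

Lemma open_char_time (Omega : set space) q : open Omega ->
  open [set s : R | Omega (char_point q s)].
Proof. by move=> oO; apply: (open_comp (fun s _ => @continuous_char_point q s) oO). Qed.

(** Countably many boxes of lines suffice, so that the exceptional null sets
    can be united. *)
Lemma rational_line_box (A : set (space * space)) q : open A -> A q ->
  exists ab : {ffun J -> rat} * {ffun J -> rat},
    (forall j, ratr (ab.1 j) < line_coord j q < ratr (ab.2 j)) /\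
    line_box (fun j => ratr (ab.1 j)) (fun j => ratr (ab.2 j)) `<=` A.
Proof.
move=> oA Aq.
have /nbhs_ballP[e /= e0 eA] : nbhs q A by exact: open_nbhs_nbhs.
have ex j : exists ab : rat * rat, (line_coord j q - e < ratr ab.1 < line_coord j q) /\
    (line_coord j q < ratr ab.2 < line_coord j q + e).
  have [a] : exists r : rat, ratr r \in `]line_coord j q - e, line_coord j q[.
    by apply: rat_in_itvoo; lra.
  rewrite in_itv/= => ha.
  have [b] : exists r : rat, ratr r \in `]line_coord j q, line_coord j q + e[.
    by apply: rat_in_itvoo; lra.
  by rewrite in_itv/= => hb; exists (a, b).
have [g gP] := choice ex.
exists ([ffun j => (g j).1], [ffun j => (g j).2]); split.
  by move=> j /=; rewrite !ffunE; have [/andP[_ ->] /andP[-> _]] := gP j.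
move=> q' qb; apply: eA.
have close j : `|line_coord j q - line_coord j q'| < e.
  have := qb j; rewrite /= !ffunE => /andP[y1 y2].
  have [/andP[h1 h2] /andP[h3 h4]] := gP j.
  by rewrite ltr_norml; apply/andP; split; lra.
split; split => // i j; rewrite (ord1 i).
  exact: (close (inl j)).
exact: (close (inr j)).
Qed.

Section representation.
Variables (T : R) (Omega : set space).
Hypotheses (oO : open Omega) (cO : convex_set (Omega : set (convex_lmodType 'rV[R]_d))).
Variables (u w : RT * space * space -> R).
Hypotheses (bu : bounded_measurable u) (bw : bounded_measurable w).
Hypothesis mX : measurable (phase_space T Omega : set (RT * space * space)).
Hypothesis Xoo : (phase_measure (phase_space T Omega) < +oo)%E.
Hypothesis u_out : forall p, ~ phase_space T Omega p -> u p = 0.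
Hypothesis w_out : forall p, ~ phase_space T Omega p -> w p = 0.
Hypothesis uw : transport_derivative T Omega u w.

(** An interval by convexity; its start is the initial time or the time of
    entry through the boundary. *)
Definition char_times (q : space * space) : set R :=
  [set s | 0 < s < T /\ Omega (char_point q s)].

Lemma open_char_times q : open (char_times q).
Proof.
rewrite (_ : char_times q = `]0, T[%classic `&` [set s : R | Omega (char_point q s)]).
  by apply: openI; [exact: itv_open|exact: open_char_time].
by apply/seteqP; split => s /=; rewrite in_itv.
Qed.

(** Two times of a line in the domain are joined by a segment inside, and
    nearby lines stay inside between nearby rational times. So every pair of
    times is covered by one of countably many boxes of
    [local_representation]. *)
Lemma characteristic_representation : {ae initial_measure, forall q : space * space,
  exists N : set R, lebesgue_measure.-negligible N /\
  forall s t, char_times q s -> char_times q t -> ~ N s -> ~ N t -> s < t ->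
    u (char_map (q, t)) - u (char_map (q, s)) =
    itv_int (fun r => w (char_map (q, r))) s t}.
Proof.
pose idx := ({ffun J -> rat} * {ffun J -> rat} * (rat * rat))%type.
pose good (i : idx) := [/\ 0 < ratr i.2.1 :> R, ratr i.2.1 < ratr i.2.2 :> R, ratr i.2.2 < T &
  forall q s, line_box (fun j => ratr (i.1.1 j)) (fun j => ratr (i.1.2 j)) q ->
    ratr i.2.1 <= s <= ratr i.2.2 -> Omega (char_point q s)].
pose P (i : idx) (q : space * space) := good i ->
  (forall j, ratr (i.1.1 j) < line_coord j q < ratr (i.1.2 j)) ->
  exists c, {ae (@lebesgue_measure R), forall s, ratr i.2.1 < s < ratr i.2.2 ->
    u (char_map (q, s)) = itv_int (fun r => w (char_map (q, r))) (ratr i.2.1) s + c}.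
have aeP i : {ae initial_measure, forall q, P i q}.
  have [[h1 h2 h3 h4]|ng] := pselect (good i); last by apply: aeW => q /ng.
  have := local_representation bu bw mX Xoo u_out w_out uw h1 h2 h3 h4.
  move=> /(@ae_sections1 _ _ _ _ _ initial_measure lebesgue_measure).
  apply: filterS => q hq _ qb; eexists.
  move: hq; apply: filterS => s /= /(_ qb) hs; exact: hs.
have := ae_countable aeP; apply: filterS => q Pq.
have aeQ (i : idx) : exists c, {ae (@lebesgue_measure R), forall s : R,
   good i -> (forall j, ratr (i.1.1 j) < line_coord j q < ratr (i.1.2 j)) ->
   ratr i.2.1 < s < ratr i.2.2 ->
    u (char_map (q, s)) = itv_int (fun r => w (char_map (q, r))) (ratr i.2.1) s + c}.
  have [g|ng] := pselect (good i); last by exists 0; apply: aeW => s /ng.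
  have [h|nh] := pselect (forall j, ratr (i.1.1 j) < line_coord j q < ratr (i.1.2 j)).
    have [c hc] := Pq i g h; exists c.
    move: hc; apply: filterS; first exact: (ae_filter_ringOfSetsType lebesgue_measure).
    by move=> s hs _ _.
  by exists 0; apply: aeW => s _ /nh.
have [c hc] := choice aeQ.
have [N [mN N0 NP]] := ae_countable hc.
exists N; split; first by exists N; split.
move=> s t [/andP[s0 sT] Os] [/andP[t0 tT] Ot] nNs nNt st.
have [al [al0 als Oal]] : exists al : rat, [/\ 0 < ratr al :> R, ratr al < s & Omega (char_point q (ratr al))].
  have : nbhs s (char_times q).
    by apply: open_nbhs_nbhs; split; [exact: open_char_times|split => //; rewrite s0].
  move=> /nbhs_ballP[e /= e0 es].
  have [al] : exists r : rat, ratr r \in `]s - e, s[ by apply: rat_in_itvoo; lra.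
  rewrite in_itv/= => /andP[h1 h2].
  have [/andP[h3 _] h4] : char_times q (ratr al).
    by apply: es; rewrite /ball/= ltr_norml; apply/andP; split; lra.
  by exists al.
have [be [beT tbe Obe]] : exists be : rat, [/\ ratr be < T, t < ratr be & Omega (char_point q (ratr be))].
  have : nbhs t (char_times q).
    by apply: open_nbhs_nbhs; split; [exact: open_char_times|split => //; rewrite t0].
  move=> /nbhs_ballP[e /= e0 es].
  have [be] : exists r : rat, ratr r \in `]t, t + e[ by apply: rat_in_itvoo; lra.
  rewrite in_itv/= => /andP[h1 h2].
  have [/andP[_ h3] h4] : char_times q (ratr be).
    by apply: es; rewrite /ball/= ltr_norml; apply/andP; split; lra.
  by exists be.
have : open [set q' : space * space | Omega (char_point q' (ratr al)) /\ Omega (char_point q' (ratr be))].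
  apply: openI.
    exact: (open_comp (fun q' _ => @continuous_char_point1 (ratr al) q') oO).
  exact: (open_comp (fun q' _ => @continuous_char_point1 (ratr be) q') oO).
move=> /rational_line_box /(_ (conj Oal Obe))[ab [qab abO]].
pose i : idx := (ab, (al, be)).
have gi : good i.
  split => //; first by apply: lt_trans tbe; exact: lt_trans st.
  by move=> q' r /abO[h1 h2]; exact: convex_line.
have Hs x : ~ N x -> ratr al < x < ratr be ->
    u (char_map (q, x)) = itv_int (fun r => w (char_map (q, r))) (ratr al) x + c i.
  move=> nN hx; apply: contrapT => h; apply: nN; apply: NP => /(_ i gi qab hx).
  exact: h.
have alst : ratr al < s < ratr be by rewrite als (lt_trans st).
have altt : ratr al < t < ratr be by rewrite (lt_trans als).
have bwq : bounded_measurable (fun r : R => w (char_map (q, r))).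
  have := bounded_measurable_section q (bounded_measurable_comp measurable_char_map bw).
  exact.
rewrite (Hs s nNs alst) (Hs t nNt altt) (itv_intD bwq (ltW als) (ltW st)); ring.
Qed.

End representation.

End convex_lines.

(** * Volume of slabs *)

Section slab.
Context {R : realType} {d : nat}.
Notation space := 'rV[R]_d.
Hypothesis d0 : (0 < d)%N.

Lemma ball_volume_gt0 s : 0 < @ball_volume R s.
Proof.
set B := [set x : 'rV[R]_s | enorm x <= 1].
have mB : measurable B.
  rewrite (_ : B = enorm @^-1` `]-oo, 1]).
    by rewrite -[X in measurable X]setTI; exact: measurable_enorm.
  by apply/seteqP; split => x /=; rewrite in_itv.
have Boo : (lebesgue_rV s B < +oo)%E.
  apply: (@le_lt_trans _ _ (lebesgue_rV s (cube (const_mx (-1)) 2))).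
    apply: le_measure; rewrite ?inE; [exact: mB|exact: measurable_cube|].
    move=> x xB i; rewrite mxE; have := le_trans (coord_le_enorm x i) xB.
    by rewrite ler_norml => /andP[]; lra.
  by rewrite lebesgue_rV_cube// ltry.
pose r : R := s.+1%:R^-1.
have r0 : 0 < r by rewrite invr_gt0.
rewrite /ball_volume -/B -lte_fin fineK ?ge0_fin_numE ?measure_ge0//.
apply: (@lt_le_trans _ _ (lebesgue_rV s (cube 0 r))).
  by rewrite lebesgue_rV_cube ?(ltW r0)// lte_fin exprn_gt0.
apply: le_measure; rewrite ?inE; [exact: measurable_cube|exact: mB|].
move=> x xC; rewrite /B /= /enorm -(sqrtr1 R); apply: ler_wsqrtr.
apply: (@le_trans _ _ (\sum_(i < s) r)).
  apply: ler_sum => i _; have := xC i; rewrite mxE add0r => /andP[x0 xr].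
  rewrite -[leRHS]mulr1; apply: ler_pM => //; apply: le_trans xr _.
  by rewrite invf_le1// ler1n.
rewrite sumr_const card_ord -mulr_natl ler_pdivrMr// mul1r ler_nat.
exact: leqnSn.
Qed.

Definition slab (k : space) (A : set space) : set space :=
  [set y | exists x s, [/\ A x, 0 <= s <= 1 & y = x + s *: k]].

(** About 1 / delta cubes of side 4 delta cover the slab over a set of
    diameter delta, which gives the volume delta ^ (d - 1) up to a constant. *)
Lemma slab_cover_delta (k x0 : space) (F : set space) (delta : R) :
  sphere k -> 0 < delta <= 1 -> (forall x, F x -> enorm (x - x0) <= delta) ->
  exists G, [/\ measurable G, slab k F `<=` G &
    (lebesgue_rV d G <= (2 * 4 ^+ d * delta ^+ d.-1)%:E)%E].
Proof.
move=> sk /andP[delta0 delta1] Fd.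
pose n := (Num.truncn delta^-1).+1.
pose C (j : nat) := cube (x0 + (j%:R * delta) *: k - const_mx (2 * delta)) (4 * delta).
exists (\big[setU/set0]_(j < n) C j); split.
- by apply: bigsetU_measurable => j _; exact: measurable_cube.
- move=> _ [x [s [Fx /andP[s0 s1] ->]]].
  have sd0 : 0 <= s / delta by rewrite divr_ge0// ltW.
  have /andP[h1 h2] := truncn_itv sd0.
  have jn : (Num.truncn (s / delta) < n)%N.
    rewrite ltnS; apply: le_truncn; rewrite ler_pdivrMr// mulVf// gt_eqF//.
  rewrite -bigcup_mkord; exists (Num.truncn (s / delta)) => //= i.
  rewrite !mxE; set j := (Num.truncn _)%:R.
  have c1 := le_trans (coord_le_enorm (x - x0) i) (Fd _ Fx).
  have c2 := sphere_coord i sk.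
  have c3 : `|s - j * delta| <= delta.
    rewrite ler_norml; move: h1 h2; rewrite ler_pdivlMr// ltr_pdivrMr// -natr1 -/j.
    by move=> *; apply/andP; split; lra.
  have c4 : `|(s - j * delta) * k ord0 i| <= delta.
    by rewrite normrM -[leRHS]mulr1; apply: ler_pM.
  move: c1 c4; rewrite !mxE !ler_norml => /andP[c1 c1'] /andP[c4 c4'].
  by apply/andP; split; lra.
- apply: (@le_trans _ _ (\sum_(j < n) lebesgue_rV d (C j))%E).
    have mC j : measurable (C j) by exact: measurable_cube.
    apply: (@content_subadditive _ _ _ (lebesgue_rV d)) => //.
    exact: bigsetU_measurable.
  have d40 : 0 <= 4 * delta by rewrite mulr_ge0// ltW.
  under eq_bigr do rewrite lebesgue_rV_cube//.
  rewrite sumEFin lee_fin sumr_const card_ord -[leLHS]mulr_natl.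
  have nd : n%:R * delta <= 2.
    have := truncn_le delta^-1; rewrite invr_ge0 (ltW delta0) => h.
    rewrite /n -natr1 mulrDl mul1r.
    have : (Num.truncn delta^-1)%:R * delta <= 1.
      by rewrite -ler_pdivlMr// mul1r.
    lra.
  have dE : delta ^+ d = delta * delta ^+ d.-1 by rewrite -exprS prednK.
  rewrite exprMn dE.
  have -> : n%:R * (4 ^+ d * (delta * delta ^+ d.-1)) = n%:R * delta * (4 ^+ d * delta ^+ d.-1) by ring.
  by rewrite -[leRHS]mulrA ler_wpM2r// mulr_ge0 ?exprn_ge0// ltW.
Qed.

Definition slab_constant : R := 2 * 4 ^+ d * 2 ^+ d.-1 / ball_volume d.-1.

Lemma slab_constant_gt0 : 0 < slab_constant.
Proof. by rewrite /slab_constant divr_gt0 ?ball_volume_gt0// !mulr_gt0// exprn_gt0. Qed.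

(** The error e is needed when F is a point: its weight vanishes in positive
    dimension, whereas cubes have positive volume. *)
Lemma slab_cover (k : space) (F : set space) (e : R) : sphere k -> 0 < e ->
  exists G, [/\ measurable G, slab k F `<=` G &
    (lebesgue_rV d G <= slab_constant%:E * hausdorff_weight d.-1 1 F + e%:E)%E].
Proof.
move=> sk e0.
have [woo|] := eqVneq (hausdorff_weight d.-1 1 F) +oo%E.
  exists setT; split => //; rewrite woo gt0_muley ?lte_fin ?slab_constant_gt0//.
  by rewrite addye// leey.
rewrite /hausdorff_weight; case: ifPn => [/eqP -> _|].
  exists set0; split => //; first by move=> y [x [s []]].
  by rewrite measure0 mule0 add0e lee_fin ltW.
move=> /set0P[x0 Fx0]; case: ifPn => // Fdiam _.
have diam0 := ediam_ge0 (ex_intro _ x0 Fx0).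
have fin : ediam F \is a fin_num by rewrite ge0_fin_numE// (le_lt_trans Fdiam)// ltry.
set D := fine (ediam F).
have DE : ediam F = D%:E by rewrite fineK.
have D0 : 0 <= D by rewrite -lee_fin -DE.
have D1 : D <= 1 by rewrite -lee_fin -DE.
have FD x : F x -> enorm (x - x0) <= D.
  by move=> Fx; rewrite -lee_fin -DE; apply: ereal_sup_ubound; exists (x, x0).
have weightE : slab_constant * (ball_volume d.-1 * (D / 2) ^+ d.-1) = 2 * 4 ^+ d * D ^+ d.-1.
  rewrite /slab_constant expr_div_n; field.
  by rewrite expf_neq0//= gt_eqF// ball_volume_gt0.
suff [delta [d1 d2 d3]] : exists delta, [/\ 0 < delta <= 1, D <= delta &
    2 * 4 ^+ d * delta ^+ d.-1 <= 2 * 4 ^+ d * D ^+ d.-1 + e].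
  have [G [mG sG LG]] := slab_cover_delta sk d1 (fun x Fx => le_trans (FD x Fx) d2).
  exists G; split => //; apply: le_trans LG _.
  by rewrite -EFinM weightE -EFinD lee_fin.
have [D00|D00] := eqVneq D 0; last first.
  by exists D; split => //; [rewrite lt_def D00 D0|rewrite lerDl ltW].
have [dd|dd] := posnP d.-1.
  by exists 1; split => //; rewrite ?ltr01 ?lexx// dd !expr0 lerDl ltW.
pose delta := Num.min 1 (e / (2 * 4 ^+ d)).
have c0 : 0 < 2 * 4 ^+ d :> R by rewrite mulr_gt0// exprn_gt0.
have delta0 : 0 < delta by rewrite lt_min ltr01 divr_gt0.
have delta1 : delta <= 1 by rewrite ge_min lexx.
exists delta; split; first by rewrite delta0.
- by rewrite D00 ltW.
- rewrite D00 expr0n gtn_eqF//= mulr0 add0r.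
  apply: (@le_trans _ _ (2 * 4 ^+ d * delta)).
    rewrite ler_pM2l// -(prednK dd) exprS ler_piMr ?(ltW delta0)//.
    by rewrite exprn_ile1// ltW.
  by rewrite mulrC -ler_pdivlMr// ge_min lexx orbT.
Qed.

(** Covers of A provide covers of the slab; the bound for the covers by sets
    of diameter at most 1 suffices, as the Hausdorff measure only increases
    when the diameters are restricted further. *)
Lemma lebesgue_slab_le (k : space) (A M : set space) : sphere k ->
  measurable M -> M `<=` slab k A ->
  (lebesgue_rV d M <= slab_constant%:E * hausdorff d.-1 A)%E.
Proof.
move=> sk mM MA.
have C0 := slab_constant_gt0.
suff H : (lebesgue_rV d M * slab_constant^-1%:E <= mu_ext (hausdorff_weight d.-1 1) A)%E.
  have : (lebesgue_rV d M * slab_constant^-1%:E <= hausdorff d.-1 A)%E.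
    apply: le_trans H _; exact: le_mu_ext_hausdorff.
  by rewrite lee_pdivrMr// muleC.
apply: le_ereal_inf_tmp => _ [F [mF FA] <-].
rewrite lee_pdivrMr// muleC.
apply/lee_addgt0Pr => e e0.
have exG n : exists G, [/\ measurable G, slab k (F n) `<=` G &
    (lebesgue_rV d G <= slab_constant%:E * hausdorff_weight d.-1 1 (F n) + (e / (2 ^ n.+1)%:R)%:E)%E].
  by apply: slab_cover => //; rewrite divr_gt0// ltr0n expn_gt0.
have [G GP] := choice exG.
have MG : M `<=` \bigcup_n G n.
  move=> y /MA[x [s [Ax s01 ->]]]; have [n _ Fx] := FA _ Ax.
  by exists n => //; have [_ h _] := GP n; apply: h; exists x, s.
apply: (@le_trans _ _ (\sum_(n <oo) lebesgue_rV d (G n))%E).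
  apply: (@measure_sigma_subadditive _ _ _ (lebesgue_rV d) M G) => //.
  by move=> n; have [] := GP n.
apply: (@le_trans _ _ (\sum_(n <oo) (slab_constant%:E * hausdorff_weight d.-1 1 (F n) + (e / (2 ^ n.+1)%:R)%:E))%E).
  by apply: lee_nneseries => [n _ _|n _]; [exact: measure_ge0|have [] := GP n].
rewrite -nneseriesZl//; last by move=> n _; exact: weight_ge0.
apply: epsilon_trick => [n|]; last exact: ltW.
by rewrite mule_ge0 ?weight_ge0// lee_fin ltW.
Qed.

End slab.

(** * Entry points of lines into the domain *)

Section entry.
Context {R : realType} {d : nat}.
Notation RT := (measurableTypeR R).
Notation space := 'rV[R]_d.
Variable Omega : set space.
Hypotheses (oO : open Omega) (bO : bounded_set Omega).
Hypothesis cO : convex_set (Omega : set (convex_lmodType 'rV[R]_d)).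

Definition chord (q : space * space) : set R := [set s | Omega (char_point q s)].

(** Expressed as an infimum in the extended reals, which makes it measurable
    by rational times alone. *)
Definition entry_time (q : space * space) : R :=
  fine (ereal_inf [set s%:E | s in chord q]).

Definition entry_point (q : space * space) : space := char_point q (entry_time q).

(** The direction is required to be a unit vector so that the chord is bounded
    and has a first point. *)
Definition hits (q : space * space) : Prop := sphere q.2 /\ chord q !=set0.

Lemma chord_bounded q : sphere q.2 -> exists M, forall s, chord q s -> `|s| <= M.
Proof.
move=> sk.
have [i ki] : exists i, q.2 ord0 i != 0.
  apply: contrapT => h; have := sphere_sum sk.
  rewrite big1 => [/eqP|i _]; first by rewrite eq_sym oner_eq0.
  have [->|ki] := eqVneq (q.2 ord0 i) 0; first by rewrite expr0n.
  by case: h; exists i.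
have [M [_ OM]] := bO.
exists ((`|M| + 2 + `|q.1 ord0 i|) / `|q.2 ord0 i|) => s cs.
rewrite ler_pdivlMr ?normr_gt0// -normrM.
have : `|(char_point q s) ord0 i| <= `|M| + 2.
  have h : `|char_point q s| <= `|M| + 1.
    by apply: OM cs; rewrite ltr_pwDr// ler_norm.
  have : ball (0 : space) (`|M| + 2) (char_point q s).
    by rewrite mx_norm_ball /ball_ /= sub0r normrN; apply: le_lt_trans h _; rewrite ltrD2l ltr1n.
  by move=> [_ /(_ ord0 i)]; rewrite mxE /ball/= sub0r normrN => /ltW.
rewrite /char_point !mxE => h.
have -> : s * q.2 ord0 i = (q.1 ord0 i + s * q.2 ord0 i) - q.1 ord0 i by ring.
by apply: le_trans (ler_normB _ _) _; rewrite lerD2r.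
Qed.

Lemma entry_fin q : hits q -> ereal_inf [set s%:E | s in chord q] = (entry_time q)%:E.
Proof.
move=> [sk [s0 cs0]]; rewrite /entry_time fineK//.
have [M chM] := chord_bounded sk.
rewrite fin_real//; apply/andP; split.
  apply: (@lt_le_trans _ _ (- M)%:E); first exact: ltNyr.
  apply: le_ereal_inf_tmp => _ [s cs <-]; rewrite lee_fin.
  by have := chM s cs; rewrite ler_norml => /andP[].
apply: (@le_lt_trans _ _ s0%:E); last exact: ltry.
by apply: ereal_inf_lbound; exists s0.
Qed.

Lemma open_chord q : open (chord q). Proof. exact: open_char_time. Qed.

Lemma entry_time_le q s : hits q -> chord q s -> entry_time q <= s.
Proof.
move=> hq cs; rewrite -lee_fin -(entry_fin hq).
by apply: ereal_inf_lbound; exists s.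
Qed.

Lemma entry_time_lt q s : hits q -> chord q s -> entry_time q < s.
Proof.
move=> hq cs.
have /nbhs_ballP[e /= e0 es] : nbhs s (chord q).
  by apply: open_nbhs_nbhs; split => //; exact: open_chord.
apply: (@le_lt_trans _ _ (s - e / 2)); last by rewrite ltrBlDr ltrDl divr_gt0.
apply: entry_time_le => //; apply: es; rewrite /ball/= opprB addrC subrK.
by rewrite gtr0_norm ?divr_gt0// ltr_pdivrMr// ltr_pMr// ltr1n.
Qed.

Lemma entry_time_dense q c : hits q -> entry_time q < c ->
  exists2 s, chord q s & s < c.
Proof.
move=> hq; rewrite -lte_fin -(entry_fin hq) => /ereal_inf_lt[_ [s cs <-]].
by rewrite lte_fin => sc; exists s.
Qed.

Lemma chord_after_entry q s t : hits q -> chord q t -> entry_time q < s -> s <= t ->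
  chord q s.
Proof.
move=> hq ct es st; have [r cr rs] := entry_time_dense hq es.
by apply: (convex_line cO cr ct); rewrite (ltW rs).
Qed.

Lemma entry_point_boundary q : hits q -> boundary Omega (entry_point q).
Proof.
move=> hq; split; last first.
  move=> /interior_subset cs.
  by have := entry_time_lt hq (cs : chord q _); rewrite ltxx.
move=> B nB.
have : nbhs (entry_time q) (char_point q @^-1` B) by exact: continuous_char_point.
move=> /nbhs_ballP[e /= e0 eB].
have [|s cs se] := @entry_time_dense q (entry_time q + e) hq; first by rewrite ltrDl.
exists (char_point q s); split; first exact: cs.
apply: eB; rewrite /ball/= distrC ger0_norm; first by rewrite ltrBlDl.
by rewrite subr_ge0; exact: entry_time_le.
Qed.

Definition shift_line (r : R) (q : space * space) : space * space := (char_point q r, q.2).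

Lemma char_point_shift r q s : char_point (shift_line r q) s = char_point q (r + s).
Proof. by rewrite /char_point /= -addrA -scalerDl. Qed.

Lemma hits_shift r q : hits (shift_line r q) <-> hits q.
Proof.
split=> -[sk [s cs]]; split => //.
  by exists (r + s); rewrite /chord /= -char_point_shift.
by exists (s - r); rewrite /chord /= char_point_shift addrCA subrr addr0.
Qed.

Lemma entry_time_shift r q : hits q -> entry_time (shift_line r q) = entry_time q - r.
Proof.
move=> hq; have hq' : hits (shift_line r q) by apply/hits_shift.
apply/eqP; rewrite eq_le; apply/andP; split; apply/ler_addgt0Pr => e e0.
  have [|s cs se] := @entry_time_dense q (entry_time q + e) hq; first by rewrite ltrDl.
  have : chord (shift_line r q) (s - r).
    by rewrite /chord /= char_point_shift addrCA subrr addr0.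
  by move=> /(entry_time_le hq'); lra.
have [|s cs se] := @entry_time_dense _ (entry_time (shift_line r q) + e) hq'; first by rewrite ltrDl.
have : chord q (r + s) by rewrite /chord /= -char_point_shift.
by move=> /(entry_time_le hq); lra.
Qed.

Lemma entry_point_shift r q : hits q -> entry_point (shift_line r q) = entry_point q.
Proof.
by move=> hq; rewrite /entry_point char_point_shift entry_time_shift// addrCA subrr addr0.
Qed.

Lemma measurable_chord (s : R) : measurable [set q : space * space | chord q s].
Proof.
rewrite -[X in measurable X]setTI.
apply: (@measurable_char_point R d _ (space * space)%type fst snd (fun=> s)) => //.
exact: measurable_open.
Qed.

Lemma chord_rational q c : (exists2 s, chord q s & s < c) ->
  exists2 r : rat, chord q (ratr r) & ratr r < c.
Proof.
move=> [s cs sc].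
have /nbhs_ballP[e /= e0 es] : nbhs s (chord q).
  by apply: open_nbhs_nbhs; split => //; exact: open_chord.
have [r] : exists r : rat, ratr r \in `]s - e, s[ by apply: rat_in_itvoo; lra.
rewrite in_itv/= => /andP[h1 h2]; exists r; last exact: lt_trans sc.
by apply: es; rewrite /ball/= ltr_norml; apply/andP; split; lra.
Qed.

Lemma measurable_hits : measurable [set q : space * space | hits q].
Proof.
rewrite (_ : [set q | _] = (setT `*` sphere) `&`
    \bigcup_(r : rat) [set q : space * space | chord q (ratr r)]).
  apply: measurableI; first by apply: measurableX => //; exact: measurable_sphere.
  by apply: countable_union_measurable => r; exact: measurable_chord.
apply/seteqP; split => q.
  move=> [sk [s cs]]; split => //.
  have [|r cr _] := @chord_rational q (s + 1); last by exists r.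
  by exists s => //; rewrite ltrDl.
by move=> [[_ sk] [r _ cr]]; split => //; exists (ratr r).
Qed.

Lemma measurable_entry_time : measurable_fun setT entry_time.
Proof.
apply: measurableT_comp; first exact: fine_measurable.
apply: (measurability _ (ErealGenInftyO.measurableE R)) => _ [_ [r ->] <-].
rewrite setTI (_ : _ @^-1` _ =
    \bigcup_(a in [set a : rat | ratr a < r]) [set q : space * space | chord q (ratr a)]).
  rewrite bigcup_mkcond; apply: countable_union_measurable => a.
  by case: ifP => _; [exact: measurable_chord|exact: measurable0].
apply/seteqP; split => q /=.
  rewrite in_itv/= => /ereal_inf_lt[_ [s cs <-]]; rewrite lte_fin => sr.
  have [|a ca ar] := @chord_rational q r; first by exists s.
  by exists a.
move=> [a /= ar ca]; rewrite in_itv/=; apply: (@le_lt_trans _ _ (ratr a)%:E).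
  by apply: ereal_inf_lbound; exists (ratr a).
by rewrite lte_fin.
Qed.

Lemma measurable_entry_point : measurable_fun setT entry_point.
Proof.
apply: (@measurable_char_point R d _ (space * space)%type fst snd entry_time) => //.
exact: measurable_entry_time.
Qed.

Lemma measurable_shift_line r : measurable_fun setT (shift_line r).
Proof.
apply/measurable_fun_pairP; split; last exact: measurable_snd.
exact: (@measurable_char_point R d _ (space * space)%type fst snd (fun=> r)).
Qed.

Lemma initial_measure_shift r (A : set (space * space)) : measurable A ->
  initial_measure A = initial_measure [set q | A (shift_line r q)].
Proof.
move=> mA.
have mA' : measurable [set q | A (shift_line r q)].
  by rewrite -[X in measurable X]setTI; exact: measurable_shift_line.
have -> : initial_measure A = _ := measure_tonelli2 (lebesgue_rV d) sphere_measure mA.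
have -> : initial_measure [set q | A (shift_line r q)] = _ :=
  measure_tonelli2 (lebesgue_rV d) sphere_measure mA'.
apply: eq_integral => k _.
exact: (lebesgue_rV_shift (r *: k) (measurable_section2 k mA)).
Qed.

(** Along each line the entry point is fixed, while the entry time of the
    parameter point runs through all real numbers. Hence the inflow time may
    be shifted against the starting point, and the bad lines with any entry
    time are controlled by those that enter within one unit of time. *)
Lemma entry_null (N : set (RT * (space * space))) : measurable N ->
  sigma_finite_product lebesgue_measure initial_measure
    [set p : RT * (space * space) | [/\ hits p.2, -1 < entry_time p.2 < 0
      & N (p.1, (entry_point p.2, p.2.2))]] = 0%E ->
  initial_measure [set q : space * space | hits q /\ N (entry_time q, (entry_point q, q.2))] = 0%E.
Proof.
move=> mN.
set S1 := [set p | _] => S10.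
pose S2 : set (RT * (space * space)) := [set p | [/\ hits p.2, -1 < entry_time p.2 < 0
  & N (entry_time p.2 + p.1, (entry_point p.2, p.2.2))]].
pose S3 : set (RT * (space * space)) := [set p | [/\ hits p.2, -1 < entry_time p.2 - p.1 < 0
  & N (entry_time p.2, (entry_point p.2, p.2.2))]].
have mE2 : measurable_fun setT (fun p : RT * (space * space) => entry_time p.2).
  exact: measurableT_comp measurable_entry_time measurable_snd.
have mP2 : measurable_fun setT (fun p : RT * (space * space) => (entry_point p.2, p.2.2)).
  apply/measurable_fun_pairP; split.
    exact: measurableT_comp measurable_entry_point measurable_snd.
  exact: measurableT_comp measurable_snd measurable_snd.
have mh2 : measurable [set p : RT * (space * space) | hits p.2].
  rewrite -[X in measurable X]setTI.
  by apply: (measurable_snd measurableT); exact: measurable_hits.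
have mS (f g : RT * (space * space) -> RT) : measurable_fun setT f -> measurable_fun setT g ->
   measurable [set p : RT * (space * space) | [/\ hits p.2, -1 < f p < 0
      & N (g p, (entry_point p.2, p.2.2))]].
  move=> mf mg.
  rewrite (_ : [set p | _] = [set p | hits p.2] `&` (f @^-1` `]-1, 0[%classic `&`
     (fun p : RT * (space * space) => (g p, (entry_point p.2, p.2.2))) @^-1` N)).
    apply: measurableI => //; apply: measurableI; rewrite -[X in measurable X]setTI.
      exact: mf.
    apply: (_ : measurable_fun setT (fun p : RT * (space * space) => (g p, (entry_point p.2, p.2.2)))) => //.
    by apply/measurable_fun_pairP; split.
  apply/seteqP; split => p /=; rewrite in_itv/=.
    by move=> [h1 h2 h3].
  by move=> [h1 [h2 h3]].
have mS1 : measurable S1 by apply: mS.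
have mS2 : measurable S2 by apply: mS => //; exact: measurable_funD.
have mS3 : measurable S3 by apply: mS => //; exact: measurable_funB.
have S20 : sigma_finite_product lebesgue_measure initial_measure S2 = 0%E.
  apply/(null_sections2 _ _ mS2); move/(null_sections2 _ _ mS1) : S10.
  apply: filterS => q /=.
  rewrite (lebesgue_measure_shift (entry_time q)); last exact: (measurable_section2 q mS1).
  move=> <-; congr (lebesgue_measure _); apply/seteqP; split => r [h1 h2 h3]; split => //=.
    by rewrite addrC.
  by rewrite addrC.
have S30 : sigma_finite_product lebesgue_measure initial_measure S3 = 0%E.
  apply/(null_sections1 _ _ mS3); move/(null_sections1 _ _ mS2) : S20.
  apply: filterS => r /=.
  rewrite (initial_measure_shift r); last exact: (measurable_section1 r mS2).
  move=> <-; congr (initial_measure _); apply/seteqP; split => q [/= h1 h2 h3].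
    split => /=; first exact/hits_shift.
      by rewrite entry_time_shift.
    by rewrite entry_time_shift// entry_point_shift// subrK.
  have hq : hits q by apply/(hits_shift r).
  by move: h2 h3; rewrite entry_time_shift// entry_point_shift// subrK.
set E := [set q | _].
have mE : measurable E.
  rewrite (_ : E = [set q | hits q] `&` (fun q => (entry_time q, (entry_point q, q.2))) @^-1` N) //.
  apply: measurableI; first exact: measurable_hits.
  rewrite -[X in measurable X]setTI.
  apply: (_ : measurable_fun setT (fun q : space * space => (entry_time q : RT, (entry_point q, q.2)))) => //.
  apply/measurable_fun_pairP; split; first exact: measurable_entry_time.
  apply/measurable_fun_pairP; split; first exact: measurable_entry_point.
  exact: measurable_snd.
move/(null_sections2 _ _ mS3) : S30 => -[A [mA A0 SA]].
apply/eqP; rewrite -measure_le0 -A0; apply: le_measure; rewrite ?inE//.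
move=> q [hq Nq]; apply: SA => /=.
rewrite (_ : [set x | S3 (x, q)] = `]entry_time q, entry_time q + 1[%classic); last first.
  apply/seteqP; split => r /=; rewrite in_itv/=.
    by move=> [_ /= /andP[h1 h2] _]; apply/andP; split; lra.
  by move=> /andP[h1 h2]; split => //=; apply/andP; split; lra.
rewrite lebesgue_measure_itv/= lte_fin ltrDl ltr01 -EFinB addrAC subrr add0r.
by move=> /eqP; rewrite eqe oner_eq0.
Qed.

End entry.

(** * Normals of a convex domain *)

Section directional_derivatives.
Context {R : realType} {V : normedModType R}.
Implicit Types (f : V -> R) (x v w : V).

(** Directional derivatives are ordinary ones along lines, which makes the
    one-variable mean value theorem available. *)
Lemma is_derive_along_line f x v (t : R) : derivable f (t *: v + x) v ->
  is_derive t (1 : R) (fun s : R => f (s *: v + x)) ('D_v f (t *: v + x)).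
Proof.
move=> df.
have E : (fun h : R => h^-1 *: (((fun s : R => f (s *: v + x)) \o shift t) (h *: 1)
      - f (t *: v + x))) =
    (fun h : R => h^-1 *: ((f \o shift (t *: v + x)) (h *: v) - f (t *: v + x))).
  by apply/funext => h /=; rewrite [h *: 1]mulr1 scalerDl addrA.
by apply: DeriveDef; [rewrite /derivable E|rewrite /derive E].
Qed.

Lemma smooth_deriveZ f x v (c : R) : smooth f -> 'D_(c *: v) f x = c * 'D_v f x.
Proof.
move=> sf.
have h1 := @is_derive_along_line f x (c *: v) 0 (smooth_derivable sf).
have h2 := @is_derive_along_line f x v (c * 0) (smooth_derivable sf).
have hc : is_derive (0 : R) (1 : R) (fun s : R => c * s) c.
  by apply: is_derive_eq; rewrite /GRing.scale/= mulr1.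
have [_ h3] := @is_derive1_comp R (fun s : R => f (s *: v + x)) (fun s => c * s) 0 _ _ h2 hc.
have [_ h4] := h1.
rewrite mulr0 scale0r add0r in h3; rewrite scale0r add0r in h4.
rewrite -h4 mulrC -h3.
have -> // : (fun s : R => f (s *: (c *: v) + x)) =
    (fun s : R => f (s *: v + x)) \o (fun s => c * s).
by apply/funext => s /=; rewrite scalerA mulrC.
Qed.

(** Additivity in the direction is not part of the definition of smoothness;
    it follows from continuity of the derivatives by the mean value theorem.
    One-sided limits suffice, and they keep the intermediate point positive. *)
Lemma smooth_deriveD f x v w : smooth f ->
  'D_(v + w) f x = 'D_v f x + 'D_w f x.
Proof.
move=> sf.
have dvw : derivable f x (v + w) := smooth_derivable sf.
have dv : derivable f x v := smooth_derivable sf.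
have lim_right u : derivable f x u ->
    (fun h : R => h^-1 * (f (h *: u + x) - f x)) @ 0^'+ --> 'D_u f x.
  move=> du; apply: cvg_dnbhs_at_right; exact: du.
have l1 := lim_right _ dvw; have l2 := lim_right _ dv.
suff l3 : (fun h : R => h^-1 * (f (h *: (v + w) + x) - f (h *: v + x))) @ 0^'+ --> 'D_w f x.
  have l4 : (fun h : R => h^-1 * (f (h *: (v + w) + x) - f x)) @ 0^'+ -->
      'D_v f x + 'D_w f x.
    apply: cvg_trans (cvgD l2 l3); apply: near_eq_cvg; apply: nearW => h /=.
    by rewrite -mulrDr; congr (_ * _); rewrite addrC addrA subrK.
  have <- := cvg_lim (@norm_hausdorff _ R) l1.
  by have <- := cvg_lim (@norm_hausdorff _ R) l4.
apply/cvgrPdist_le => e e0.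
have cD : continuous ('D_w f) by exact: (smooth_continuous (smooth_derive w sf)).
have : nbhs x ('D_w f @^-1` ball ('D_w f x) e).
  by apply: (cD x); exact: nbhsx_ballx.
move=> /nbhs_ballP[r /= r0 rB].
pose K := `|v| + `|w| + 1.
have K0 : 0 < K by rewrite ltr_wpDl// addr_ge0.
near=> h.
have h0 : 0 < h by near: h; exact: nbhs_right_gt.
have hK : h * K < r.
  by rewrite -ltr_pdivlMr//; near: h; apply: nbhs_right_lt; rewrite divr_gt0.
pose g (t : R) := f (t *: w + (h *: v + x)).
have dg (t : R) : is_derive t (1 : R) g ('D_w f (t *: w + (h *: v + x))).
  exact: (@is_derive_along_line f (h *: v + x) w t (smooth_derivable sf)).
have cg : {within `[0, h], continuous g}.
  apply: continuous_subspaceT => t.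
  by apply/differentiable_continuous/derivable1_diffP; have [] := dg t.
have [c ch] := MVT h0 (fun t _ => dg t) cg.
rewrite subr0 => gE.
have -> : f (h *: (v + w) + x) - f (h *: v + x) = g h - g 0.
  by rewrite /g scale0r add0r scalerDr addrA [h *: w + _]addrC.
rewrite gE mulrC mulfK ?gt_eqF//.
have : ball ('D_w f x) e ('D_w f (c *: w + (h *: v + x))).
  apply: rB; rewrite -ball_normE /=.
  have -> : x - (c *: w + (h *: v + x)) = - (c *: w + h *: v).
    by rewrite addrA [- (_ + x)]opprD addrCA subrr addr0.
  rewrite normrN; apply: le_lt_trans hK; apply: le_trans (ler_normD _ _) _.
  move: ch; rewrite in_itv/= => /andP[c0 ch].
  rewrite !normrZ (gtr0_norm c0) (gtr0_norm h0).
  have : c * `|w| <= h * `|w| by rewrite ler_wpM2r// ltW.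
  rewrite /K; lra.
by rewrite /ball/= => /ltW.
Unshelve. all: by end_near. Qed.

End directional_derivatives.

Section normals.
Context {R : realType} {d : nat}.
Notation space := 'rV[R]_d.
Implicit Types (f : space -> R) (x v w : space).

Lemma smooth_derive_gradient f x v : smooth f -> 'D_v f x = dot (gradient f x) v.
Proof.
move=> sf.
have H (r : seq 'I_d) : 'D_(\sum_(i <- r) v ord0 i *: delta_mx ord0 i) f x =
    \sum_(i <- r) gradient f x ord0 i * v ord0 i.
  elim: r => [|i r ih].
    by rewrite !big_nil -(scale0r (0 : space)) smooth_deriveZ// mul0r.
  by rewrite !big_cons smooth_deriveD// ih smooth_deriveZ// mulrC mxE.
by rewrite {1}(row_sum_delta v) H.
Qed.

Lemma dotDr x v w : dot x (v + w) = dot x v + dot x w.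
Proof. by rewrite /dot -big_split/=; apply: eq_bigr => i _; rewrite mxE mulrDr. Qed.

Lemma dotZr x v (c : R) : dot x (c *: v) = c * dot x v.
Proof. by rewrite /dot mulr_sumr; apply: eq_bigr => i _; rewrite mxE; ring. Qed.

Lemma dotC x v : dot x v = dot v x.
Proof. by rewrite /dot; apply: eq_bigr => i _; rewrite mulrC. Qed.

Lemma dot_ge0 x : 0 <= dot x x.
Proof. by apply: sumr_ge0 => i _; rewrite -expr2 sqr_ge0. Qed.

Lemma continuous_dot x : continuous (dot x).
Proof.
suff H (r : seq 'I_d) : continuous (fun v : space => \sum_(i <- r) x ord0 i * v ord0 i).
  exact: H.
elim: r => [|i r ih].
  rewrite (_ : (fun v : space => \sum_(i <- [::]) x ord0 i * v ord0 i) = fun=> 0).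
    exact: cst_continuous.
  by apply/funext => z; rewrite big_nil.
rewrite (_ : (fun v : space => \sum_(i <- i :: r) x ord0 i * v ord0 i) =
    fun z : space => x ord0 i * z ord0 i + \sum_(i <- r) x ord0 i * z ord0 i).
  move=> v.
  have c1 : (fun z : space => z ord0 i) @ v --> v ord0 i by exact: coord_continuous.
  have c2 : (fun z : space => x ord0 i * z ord0 i) @ v --> x ord0 i * v ord0 i.
    exact: cvgMl_tmp c1.
  exact: (cvgD c2 (ih v)).
by apply/funext => z; rewrite big_cons.
Qed.

Variable Omega : set space.
Hypotheses (oO : open Omega) (sO : smooth_boundary Omega).
Hypothesis cO : convex_set (Omega : set (convex_lmodType 'rV[R]_d)).

Lemma boundary_notin x : boundary Omega x -> ~ Omega x.
Proof. by move=> [_ nx] Ox; apply: nx; exact: (open_nbhs_nbhs (conj oO Ox)). Qed.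

(** If a point of the domain is close enough to x, then the point of the
    segment is a convex combination of it and of another point of the domain. *)
Lemma segment_in x y (t : R) : closure Omega x -> Omega y -> 0 < t <= 1 ->
  Omega (t *: y + (1 - t) *: x).
Proof.
move=> cx Oy /andP[t0 t1].
pose c := (1 - t) / t.
pose F x' := y + c *: (x - x').
have cF : {for x, continuous F}.
  have c1 : (fun x' : space => x - x') @ x --> x - x.
    have k0 : (fun _ : space => x) @ x --> x by exact: cst_continuous.
    have k1 : (fun x' : space => x') @ x --> x by exact: cvg_id.
    exact: (cvgB k0 k1).
  have c2 : (fun x' : space => c *: (x - x')) @ x --> c *: (x - x) by exact: cvgZl_tmp c1.
  have k2 : (fun _ : space => y) @ x --> y by exact: cst_continuous.
  exact: (cvgD k2 c2).
have : nbhs x (F @^-1` Omega).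
  by apply: cF; apply: open_nbhs_nbhs; split => //; rewrite /F subrr scaler0 addr0.
move=> /cx[x' [Ox' OF]].
have t01 : 0 <= t <= 1 by rewrite (ltW t0).
have := convex_setE cO OF Ox' t01; congr Omega.
rewrite /F scalerDr scalerA /c mulrCA divff ?gt_eqF// mulr1 scalerBr -addrA.
by congr (_ + _); rewrite subrK.
Qed.

(** Moving from x into the convex domain decreases the defining function. *)
Lemma local_defining_support x rho y : boundary Omega x ->
  local_defining_function Omega x rho -> Omega y ->
  dot (gradient rho x) (y - x) <= 0.
Proof.
move=> bx [srho [U [oU Ux UP]]] Oy.
rewrite -smooth_derive_gradient//.
have rx : 0 <= rho x.
  by rewrite leNgt; apply/negP => h; apply: (boundary_notin bx); apply/(UP x Ux).1.
have dv : derivable rho x (y - x) := smooth_derivable srho.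
have l1 : (fun h : R => h^-1 * (rho (h *: (y - x) + x) - rho x)) @ 0^'+ --> 'D_(y - x) rho x.
  by apply: cvg_dnbhs_at_right; exact: dv.
apply: (cvgr_to_le l1).
have : nbhs x (fun z => U z) by exact: open_nbhs_nbhs.
have cl : {for (0 : R), continuous (fun h : R => h *: (y - x) + x)}.
  apply: cvgD; last exact: cvg_cst.
  by apply: (@cvgZ _ _ _ _ _ id (fun=> y - x) (0 : R) (y - x)); [exact: cvg_id|exact: cvg_cst].
rewrite -{1}(add0r x) -(scale0r (y - x)) => /cl /nbhs_ballP[r /= r0 rU].
near=> h.
have h0 : 0 < h by near: h; exact: nbhs_right_gt.
have h1 : h <= 1 by near: h; apply: nbhs_right_le.
have hr : h < r by near: h; apply: nbhs_right_lt.
have Uh : U (h *: (y - x) + x).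
  by apply: rU; rewrite /ball/= sub0r normrN gtr0_norm.
have Oh : Omega (h *: (y - x) + x).
  have cx : closure Omega x by case: bx.
  have := @segment_in x y h cx Oy; rewrite h0 h1 => /(_ isT); congr Omega.
  by rewrite scalerBr scalerBl scale1r -addrA; congr (_ + _); rewrite addrC.
have /(UP _ Uh).1.1 := Oh.
move=> rh; rewrite mulr_ge0_le0 ?invr_ge0 ?(ltW h0)//.
by rewrite subr_le0 (le_trans (ltW rh)).
Unshelve. all: by end_near. Qed.

(** By convexity the tangent hyperplanes are supporting hyperplanes. This
    holds for whichever defining function the normal was chosen from. *)
Lemma normal_support x : boundary Omega x ->
  dot (normal Omega x) (normal Omega x) = 1 /\
  forall y, closure Omega y -> dot (normal Omega x) (y - x) <= 0.
Proof.
move=> bx.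
have [rho rhoP] := sO bx.
have : outward_normal Omega x (normal Omega x).
  by apply: (@xgetPex _ _ [set n | outward_normal Omega x n]); eexists; exists rho.
move=> [{}rho0 rho0P ->].
set g := gradient rho0 x.
have g0 : g != 0.
  by have [_ [U [_ Ux UP]]] := rho0P; have [_] := UP x Ux.
have gg : 0 < dot g g.
  rewrite lt_def dot_ge0 andbT; apply: contra g0 => /eqP h.
  apply/eqP/rowP => i; rewrite [RHS]mxE; apply/eqP; rewrite -sqrf_eq0 expr2.
  move/eqP : h; rewrite psumr_eq0 => [/allP/(_ i)|j _]; last by rewrite -expr2 sqr_ge0.
  by apply; rewrite mem_index_enum.
have e0 : 0 < enorm g by rewrite sqrtr_gt0.
split.
  rewrite dotZr dotC dotZr -[dot g g]sqr_sqrtr ?(ltW gg)// -/(enorm g).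
  by field; rewrite gt_eqF.
move=> y cy.
rewrite leNgt; apply/negP; set n := _ *: g => ny.
have cn : (fun z => dot n (z - x)) @ y --> dot n (y - x).
  have -> : (fun z => dot n (z - x)) = (fun z => dot n z + dot n (- x)).
    by apply/funext => z; rewrite dotDr.
  rewrite dotDr.
  have k0 : (fun _ : space => dot n (- x)) @ y --> dot n (- x) by exact: cst_continuous.
  exact: (cvgD (@continuous_dot n y) k0).
have : nbhs y ((fun z => dot n (z - x)) @^-1` [set r | 0 < r]).
  by apply: cn; exact: lt_nbhsr.
move=> /cy[z [Oz /=]]; rewrite ltNge => /negP; apply.
rewrite /n dotC dotZr dotC mulr_ge0_le0 ?invr_ge0 ?(ltW e0)//.
exact: local_defining_support bx rho0P Oz.
Qed.

End normals.

(** * Null sets of the inflow boundary *)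

Section nonmeasurable_comparison.
Local Open Scope ereal_scope.
Context d (X : measurableType d) (R : realType).

(** The integral of an arbitrary nonnegative function is a supremum over
    simple functions below it. This applies to the inflow measure, whose
    integrand involves the normal. *)
Lemma ge0_integral_mono (mu : {measure set X -> \bar R}) (f g : X -> \bar R) :
  (forall x, 0 <= f x) -> (forall x, f x <= g x) ->
  \int[mu]_x f x <= \int[mu]_x g x.
Proof.
move=> f0 fg; have g0 x : 0 <= g x := le_trans (f0 x) (fg x).
rewrite !ge0_integralTE//; apply: ge_ereal_sup => _ [h hf <-].
by apply: ereal_sup_ubound; exists h => // x; exact: le_trans (hf x) (fg x).
Qed.

Lemma ge0_integral_mono_in (mu : {measure set X -> \bar R}) (A B : set X) (f g : X -> \bar R) :
  (forall x, A x -> 0 <= f x) -> (forall x, B x -> 0 <= g x) ->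
  (forall x, A x -> B x /\ f x <= g x) ->
  \int[mu]_(x in A) f x <= \int[mu]_(x in B) g x.
Proof.
move=> f0 g0 fg; rewrite integral_mkcond [leRHS]integral_mkcond.
apply: ge0_integral_mono => x; rewrite !patchE.
  by case: ifPn => // /set_mem /f0.
case: ifPn => [/set_mem /fg[Bx fgx]|_]; first by rewrite mem_set.
by case: ifPn => // /set_mem /g0.
Qed.

End nonmeasurable_comparison.

Section inflow_lines.
Context {R : realType} {d : nat}.
Notation RT := (measurableTypeR R).
Notation space := 'rV[R]_d.
Hypothesis d0 : (0 < d)%N.
Variables (T : R) (Omega : set space).
Hypotheses (oO : open Omega) (bO : bounded_set Omega) (sO : smooth_boundary Omega).
Hypothesis cO : convex_set (Omega : set (convex_lmodType 'rV[R]_d)).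

(** The closure is tested rather than the domain itself, so that this set is
    closed and therefore measurable. *)
Definition deep (rho : R) : set space :=
  [set y | forall v : space, enorm v <= rho -> closure Omega (y + v)].

Lemma closed_deep rho : closed (deep rho).
Proof.
have -> : deep rho = \bigcap_(v in [set v : space | enorm v <= rho])
    [set y | closure Omega (y + v)].
  by apply/seteqP; split => y h v; exact: h.
apply: closed_bigI => v _.
have c : continuous (fun y : space => y + v).
  move=> y.
  have k0 : (fun _ : space => v) @ y --> v by exact: cst_continuous.
  have k1 : (fun y : space => y) @ y --> y by exact: cvg_id.
  exact: (cvgD k1 k0).
exact: (closed_comp (fun y _ => c y) (@closed_closure _ Omega)).
Qed.

Lemma deep_rational y : Omega y -> exists2 rho : rat, 0 < ratr rho :> R & deep (ratr rho) y.
Proof.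
move=> Oy; have /nbhs_ballP[e /= e0 eO] : nbhs y Omega by exact: open_nbhs_nbhs.
have [rho] : exists r : rat, ratr r \in `]0, e[ by exact: rat_in_itvoo.
rewrite in_itv/= => /andP[rho0 rhoe]; exists rho => // v vr.
apply: subset_closure; apply: eO; split => // i j; rewrite (ord1 i) /ball/= !mxE.
rewrite opprD addNKr normrN; apply: le_lt_trans rhoe; apply: le_trans vr.
exact: coord_le_enorm.
Qed.

(** The ball of radius rho about x + t k lies on the inner side of the
    supporting hyperplane at x; test this with its outermost point. *)
Lemma deep_inflow x k (t rho : R) : boundary Omega x -> 0 < t ->
  deep rho (x + t *: k) -> 0 < rho -> dot (normal Omega x) k <= - (rho / t).
Proof.
move=> bx t0 dx rho0; have [nn ns] := normal_support oO sO cO bx.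
set n := normal Omega x in nn ns *.
have en : enorm (rho *: n) = rho.
  by rewrite /enorm dotZr dotC dotZr nn mulr1 -expr2 sqrtr_sqr gtr0_norm.
have := dx (rho *: n); rewrite en lexx => /(_ isT) /ns.
have -> : x + t *: k + rho *: n - x = t *: k + rho *: n by rewrite -!addrA addrC -!addrA addNr addr0.
rewrite dotDr !dotZr nn mulr1 => h.
by rewrite -mulNr ler_pdivlMr// mulrC; lra.
Qed.

Variable N : set (RT * space * space).
Hypothesis mN : measurable N.
Hypothesis N0 : inflow_measure T Omega N = 0%E.

(** The bad lines that are well inside the domain a time t after their entry:
    for these |n . k| is bounded below by [deep_inflow]. *)
Definition entry_slab (t rho : R) : set (RT * (space * space)) :=
  [set p | [/\ hits Omega p.2, -1 < entry_time Omega p.2 < 0,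
     0 < p.1 < T & N (p.1, entry_point Omega p.2, p.2.2) /\
     deep rho (entry_point Omega p.2 + t *: p.2.2)]].

Lemma measurable_entry_slab t rho : measurable (entry_slab t rho).
Proof.
have mE : measurable_fun setT (fun p : RT * (space * space) => entry_time Omega p.2).
  exact: measurableT_comp (measurable_entry_time oO) measurable_snd.
have mP : measurable_fun setT (fun p : RT * (space * space) => entry_point Omega p.2).
  exact: measurableT_comp (measurable_entry_point oO) measurable_snd.
have mk : measurable_fun setT (fun p : RT * (space * space) => p.2.2).
  exact: measurableT_comp measurable_snd measurable_snd.
have mz : measurable_fun setT (fst : RT * (space * space) -> RT) by exact: measurable_fst.
have mh : measurable [set p : RT * (space * space) | hits Omega p.2].
  rewrite -[X in measurable X]setTI.
  by apply: (measurable_snd measurableT); exact: measurable_hits.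
have mPt : measurable_fun setT (fun p : RT * (space * space) => entry_point Omega p.2 + t *: p.2.2).
  by apply: measurable_char_point.
have mNp : measurable_fun setT (fun p : RT * (space * space) => (p.1, entry_point Omega p.2, p.2.2)).
  by apply/measurable_fun_pairP; split => //; apply/measurable_fun_pairP; split.
rewrite (_ : entry_slab t rho = [set p | hits Omega p.2] `&`
    ((fun p => entry_time Omega p.2) @^-1` `]-1, 0[%classic `&`
    (fst @^-1` `]0, T[%classic `&`
    ((fun p => (p.1, entry_point Omega p.2, p.2.2)) @^-1` N `&`
     (fun p => entry_point Omega p.2 + t *: p.2.2) @^-1` deep rho)))).
  apply: measurableI => //; apply: measurableI.
    by rewrite -[X in measurable X]setTI; exact: mE.
  apply: measurableI; first by rewrite -[X in measurable X]setTI; exact: mz.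
  apply: measurableI; first by rewrite -[X in measurable X]setTI; exact: mNp.
  rewrite -[X in measurable X]setTI; apply: mPt => //.
  by apply: measurable_closed; exact: closed_deep.
apply/seteqP; split => p; rewrite /entry_slab /= !in_itv/=.
  by move=> [h1 h2 h3 [h4 h5]].
by move=> [h1 [h2 [h3 [h4 h5]]]].
Qed.

(** For fixed time and direction, the starting points with an entry time in
    ]-1, 0[ form a slab over the bad part of the boundary. Its volume is at
    most a constant times the surface of this part, hence at most a constant
    times the integral of |n . k| over it, and the latter vanishes after
    integration over time and direction. *)
Lemma entry_slab_null t rho : 0 < t -> 0 < rho ->
  sigma_finite_product lebesgue_measure initial_measure (entry_slab t rho) = 0%E.
Proof.
move=> t0 rho0; have mS := measurable_entry_slab t rho.
pose G z k := lebesgue_rV d [set y | entry_slab t rho (z, (y, k))].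
have C0 : 0 < @slab_constant R d by exact: slab_constant_gt0.
pose c := rho / t / @slab_constant R d.
have c0 : 0 < c by apply: divr_gt0 => //; exact: divr_gt0.
have mBd : measurable (boundary Omega).
  apply: measurableD; first by apply: measurable_closed; exact: closed_closure.
  by apply: measurable_open; exact: open_interior.
have inner z k : 0 < z < T -> sphere k -> (c%:E * G z k <=
    \int[hausdorff d.-1]_(x in boundary Omega)
     (`|dot (normal Omega x) k| * \1_(N `&` inflow T Omega) (z, x, k))%:E)%E.
  move=> z0T sk.
  pose B : set space := boundary Omega `&` ([set x | N (z, x, k)] `&` [set x | deep rho (x + t *: k)]).
  have mB : measurable B.
    apply: measurableI => //; apply: measurableI.
      exact: (measurable_section1 (z : RT) (measurable_section2 k mN)).
    apply: measurable_closed.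
    have cc : continuous (fun y : space => y + t *: k).
      move=> y.
      have k0 : (fun _ : space => t *: k) @ y --> t *: k by exact: cst_continuous.
      have k1 : (fun y : space => y) @ y --> y by exact: cvg_id.
      exact: (cvgD k1 k0).
    exact: (closed_comp (fun y _ => cc y) (@closed_deep rho)).
  have GB : (G z k <= (@slab_constant R d)%:E * hausdorff d.-1 B)%E.
    apply: (@lebesgue_slab_le R d d0 k) => //.
      exact: (measurable_section2 k (measurable_section1 z mS)).
    move=> y [/= hq /andP[h1 h2] _ [h3 h4]].
    exists (entry_point Omega (y, k)), (- entry_time Omega (y, k)); split.
    - by split; [exact: entry_point_boundary|split].
    - by apply/andP; split; lra.
    - by rewrite /entry_point /char_point /= scaleNr addrK.
  have HI : ((rho / t)%:E * hausdorff d.-1 B <=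
    \int[hausdorff d.-1]_(x in boundary Omega)
     (`|dot (normal Omega x) k| * \1_(N `&` inflow T Omega) (z, x, k))%:E)%E.
    have -> : ((rho / t)%:E * hausdorff d.-1 B = \int[hausdorff d.-1]_(x in B) (rho / t)%:E)%E.
      by rewrite integral_cst.
    apply: ge0_integral_mono_in => x.
    - by move=> _; rewrite lee_fin divr_ge0// ltW.
    - by move=> _; rewrite lee_fin mulr_ge0.
    move=> [bx [Nx dx]]; split => //.
    have nk := deep_inflow bx t0 dx rho0.
    have rt0 : 0 < rho / t by rewrite divr_gt0.
    have nk0 : dot (normal Omega x) k < 0 by apply: le_lt_trans nk _; rewrite oppr_lt0.
    rewrite lee_fin indicE mem_set ?mulr1; last first.
      by split => //; split => //=; rewrite in_itv.
    by rewrite ltr0_norm// lerNr.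
  apply: le_trans HI; rewrite /c EFinM -muleA lee_pmul2l// ?lte_fin ?divr_gt0//.
  by rewrite muleC lee_pdivrMr// muleC.
have mGk z : measurable_fun setT (G z).
  exact: (measurable_measure_section2 (lebesgue_rV d) (measurable_section1 z mS)).
have G0 z k : (0 <= G z k)%E by exact: measure_ge0.
have slabE z : initial_measure [set q | entry_slab t rho (z, q)] =
    (\int[sphere_measure]_(k in sphere) G z k)%E.
  have -> : initial_measure [set q | entry_slab t rho (z, q)] = _ :=
    measure_tonelli2 (lebesgue_rV d) sphere_measure (measurable_section1 z mS).
  rewrite [RHS]integral_mkcond; apply: eq_integral => k _; rewrite patchE.
  case: ifPn => // /negP; rewrite inE => nsk.
  rewrite (_ : [set x | _] = set0) ?measure0//.
  by apply/seteqP; split => y // -[/= [h _]].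
have mH : measurable_fun setT (fun z : RT => initial_measure [set q | entry_slab t rho (z, q)]).
  exact: (@measurable_measure_section1 _ _ RT _ R initial_measure _ mS).
rewrite (measure_tonelli1 lebesgue_measure initial_measure mS).
have -> : (\int[lebesgue_measure]_z initial_measure [set q | entry_slab t rho (z, q)] =
   \int[lebesgue_measure]_(z in `]0%R, T[) initial_measure [set q | entry_slab t rho (z, q)])%E.
  rewrite [RHS]integral_mkcond; apply: eq_integral => z _; rewrite patchE.
  case: ifPn => // /negP; rewrite inE/= in_itv/= => nz.
  rewrite (_ : [set x | _] = set0) ?measure0//.
  by apply/seteqP; split => y // -[/=].
have key : (c%:E * \int[lebesgue_measure]_(z in `]0%R, T[)
    initial_measure [set q | entry_slab t rho (z, q)] <= 0)%E.
  rewrite -N0 /inflow_measure -ge0_integralZl//; last 2 first.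
  - exact: measurable_funTS.
  - by rewrite lee_fin ltW.
  apply: ge0_integral_mono_in.
  - by move=> z _; rewrite mule_ge0 ?lee_fin ?(ltW c0).
  - by move=> z _; do 2 (apply: integral_ge0 => ? _); rewrite lee_fin mulr_ge0.
  move=> z zT; split => //; rewrite slabE.
  have msph : measurable (@sphere R d) by exact: measurable_sphere.
  rewrite -ge0_integralZl//; last 2 first.
  - exact: measurable_funTS.
  - by rewrite lee_fin ltW.
  apply: ge0_integral_mono_in.
  - by move=> k _; rewrite mule_ge0 ?lee_fin ?(ltW c0).
  - by move=> k _; apply: integral_ge0 => ? _; rewrite lee_fin mulr_ge0.
  move=> k sk; split => //; exact: inner.
apply/eqP; rewrite eq_le; apply/andP; split; last exact: integral_ge0.
by move: key; rewrite pmule_rle0// lte_fin.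
Qed.


(** Every line that enters the domain is deep inside at some later rational
    time, so countably many slabs exhaust the bad lines. *)
Lemma entry_deep q : hits Omega q -> exists tr : rat * rat,
  [/\ 0 < ratr tr.1 :> R, 0 < ratr tr.2 :> R &
      deep (ratr tr.2) (entry_point Omega q + ratr tr.1 *: q.2)].
Proof.
move=> hq; have [_ [s cs]] := hq; have es := entry_time_lt oO bO hq cs.
have [t] : exists t : rat, ratr t \in `]0, s - entry_time Omega q[.
  by apply: rat_in_itvoo; rewrite subr_gt0.
rewrite in_itv/= => /andP[t0 ts].
have ct : chord Omega q (entry_time Omega q + ratr t).
  by apply: (chord_after_entry bO cO hq cs); lra.
have [rho rho0 dr] := deep_rational ct; exists (t, rho); split => //=.
by rewrite -addrA -scalerDl.
Qed.

Lemma entry_inflow q : hits Omega q -> 0 < entry_time Omega q < T ->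
  inflow T Omega (entry_time Omega q, entry_point Omega q, q.2).
Proof.
move=> hq eT; have [tr [t0 rho0 dr]] := entry_deep hq.
have bq := entry_point_boundary oO bO hq.
split => //=; first by case: hq.
apply: (le_lt_trans (deep_inflow bq t0 dr rho0)).
by rewrite oppr_lt0 divr_gt0.
Qed.

(** Besides bad points of the inflow boundary, the entry time 0 has to be
    excluded: a line that starts on the boundary at the initial time is covered
    by neither trace. *)
Lemma inflow_lines : {ae initial_measure, forall q : space * space, hits Omega q ->
  entry_time Omega q != 0 /\
  (0 < entry_time Omega q < T -> ~ N (entry_time Omega q, entry_point Omega q, q.2))}.
Proof.
(* a pair consists of a time t after the entry and a radius rho *)
pose D (tr : rat * rat) : set (RT * (space * space)) := if (0 < ratr tr.1 :> R) && (0 < ratr tr.2 :> R) then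
  [set p | [/\ 0 < p.1 < T, N (p.1, p.2.1, p.2.2) & deep (ratr tr.2) (p.2.1 + ratr tr.1 *: p.2.2)]]
  else set0.
pose N' : set (RT * (space * space)) := ([set 0] `*` setT) `|` \bigcup_tr D tr.
have mD tr : measurable (D tr).
  rewrite /D; case: ifP => // _.
  rewrite (_ : [set p | _] = fst @^-1` `]0, T[%classic `&`
    ((fun p : RT * (space * space) => (p.1, p.2.1, p.2.2)) @^-1` N `&`
     (fun p : RT * (space * space) => p.2.1 + ratr tr.1 *: p.2.2) @^-1` deep (ratr tr.2))).
    have m1 : measurable_fun setT (fun p : RT * (space * space) => p.2.1).
      exact: measurableT_comp measurable_fst measurable_snd.
    have m2 : measurable_fun setT (fun p : RT * (space * space) => p.2.2).
      exact: measurableT_comp measurable_snd measurable_snd.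
    apply: measurableI.
      by rewrite -[X in measurable X]setTI; apply: (@measurable_fst _ _ RT (space * space)%type).
    apply: measurableI; rewrite -[X in measurable X]setTI.
      apply: (_ : measurable_fun setT (fun p : RT * (space * space) => (p.1, p.2.1, p.2.2))) => //.
      apply/measurable_fun_pairP; split => //; apply/measurable_fun_pairP; split => //.
      exact: measurable_fst.
    apply: (@measurable_char_point R d _ (RT * (space * space))%type (fst \o snd) (snd \o snd)
      (fun=> ratr tr.1)) => //.
    by apply: measurable_closed; exact: closed_deep.
  apply/seteqP; split => p; rewrite /= in_itv/=.
    by move=> [h1 h2 h3].
  by move=> [h1 [h2 h3]].
have mN' : measurable N'.
  apply: measurableU; first by apply: measurableX.
  exact: countable_union_measurable.
have S0 : (sigma_finite_product lebesgue_measure initial_measure).-negligible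
    [set p : RT * (space * space) | [/\ hits Omega p.2, -1 < entry_time Omega p.2 < 0
      & N' (p.1, (entry_point Omega p.2, p.2.2))]].
  have m0 : measurable (([set 0] : set RT) `*` (setT : set (space * space))).
    exact: measurableX.
  pose E0 tr : set (RT * (space * space)) :=
    if (0 < ratr tr.1 :> R) && (0 < ratr tr.2 :> R)
      then entry_slab (ratr tr.1) (ratr tr.2) else set0.
  pose E1 : set (RT * (space * space)) := (([set 0] : set RT) `*` setT) `|` \bigcup_tr E0 tr.
  suff : (sigma_finite_product lebesgue_measure initial_measure).-negligible E1.
    apply: negligibleS.
    move=> p [hp ep [[/= p0 _]|[tr _]]]; first by left; split.
    rewrite /D; case: ifP => // tr0 [/= h1 h2 h3]; right; exists tr => //.
    by rewrite /E0 tr0.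
  apply: negligibleU.
    exists ([set 0] `*` setT); split => //.
    apply/(null_sections2 _ _ m0); apply: nearW => q.
    rewrite (_ : [set x | _] = [set 0]); first exact: lebesgue_measure_set1.
    by apply/seteqP; split => z //= -[].
  have ES tr : {ae sigma_finite_product lebesgue_measure initial_measure, forall p : RT * (space * space),
      ~ E0 tr p}.
    rewrite /E0; case: ifP => [/andP[t0 rho0]|_]; last first.
      by exists set0; split; [exact: measurable0|exact: measure0|move=> p /= h; case: h => -[]].
    exists (entry_slab (ratr tr.1) (ratr tr.2)); split.
    - exact: measurable_entry_slab.
    - exact: entry_slab_null.
    - by move=> p /= /contrapT.
  have := ae_countable ES; rewrite /almost_everywhere.
  by apply: negligibleS => p [tr _ Ep] /= h; exact: (h tr Ep).
have E0 := entry_null oO bO mN'.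
have mS : measurable [set p : RT * (space * space) | [/\ hits Omega p.2, -1 < entry_time Omega p.2 < 0
      & N' (p.1, (entry_point Omega p.2, p.2.2))]].
  rewrite (_ : [set p | _] = [set p : RT * (space * space) | hits Omega p.2] `&` 
   ((fun p : RT * (space * space) => entry_time Omega p.2) @^-1` `]-1, 0[%classic `&`
     (fun p : RT * (space * space) => (p.1, (entry_point Omega p.2, p.2.2))) @^-1` N')).
    apply: measurableI.
      rewrite -[X in measurable X]setTI.
      by apply: (measurable_snd measurableT); exact: measurable_hits.
    apply: measurableI; rewrite -[X in measurable X]setTI.
      apply: (_ : measurable_fun setT (fun p : RT * (space * space) => entry_time Omega p.2)) => //.
      exact: measurableT_comp (measurable_entry_time oO) measurable_snd.
    apply: (_ : measurable_fun setT (fun p : RT * (space * space) => (p.1, (entry_point Omega p.2, p.2.2)))) => //.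
    apply/measurable_fun_pairP; split; first exact: measurable_fst.
    apply/measurable_fun_pairP; split.
      exact: measurableT_comp (measurable_entry_point oO) measurable_snd.
    exact: measurableT_comp measurable_snd measurable_snd.
  apply/seteqP; split => p; rewrite /= in_itv/=.
    by move=> [h1 h2 h3].
  by move=> [h1 [h2 h3]].
have E1 := E0 (measure_negligible mS S0).
have mE : measurable [set q : space * space | hits Omega q /\
   N' (entry_time Omega q, (entry_point Omega q, q.2))].
  apply: measurableI; first exact: measurable_hits.
  rewrite -[X in measurable X]setTI.
  apply: (_ : measurable_fun setT (fun q : space * space => (entry_time Omega q : RT, (entry_point Omega q, q.2)))) => //.
  apply/measurable_fun_pairP; split; first exact: measurable_entry_time.
  apply/measurable_fun_pairP; split; first exact: measurable_entry_point.
  exact: measurable_snd.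
exists [set q | hits Omega q /\ N' (entry_time Omega q, (entry_point Omega q, q.2))]; split => //.
move=> q /= /not_implyP[hq h]; split => //; apply: contrapT => nN; apply: h; split.
  by apply/negP => /eqP e0; apply: nN; left; split.
move=> eT Nq; apply: nN; right.
have [tr [t0 rho0 dr]] := entry_deep hq.
by exists tr => //; rewrite /D t0 rho0.
Qed.

End inflow_lines.

(** * Traces along the characteristics *)

Section traces.
Context {R : realType} {d : nat}.
Notation RT := (measurableTypeR R).
Notation space := 'rV[R]_d.

Lemma ess_cvg_right0_shift (g : R -> R) (a l : R) :
  ess_cvg_right0 (fun s => g (a + s)) l -> forall e, 0 < e -> exists2 delta, 0 < delta &
    {ae lebesgue_measure, forall s, a < s < a + delta -> `|g s - l| < e}.
Proof.
move=> gl e e0; have [de de0 [N [mN N0 NP]]] := gl e e0.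
exists de => //; exists [set s | N (s - a)]; split.
- rewrite -[X in measurable X]setTI.
  apply: (_ : measurable_fun setT (fun s : RT => (s - a : RT))) => //.
  by apply: measurable_funB => //; exact: measurable_cst.
- by rewrite -N0 [RHS](lebesgue_measure_shift (- a)).
- move=> s /= /not_implyP[sa h]; apply: NP => /= h'; apply: h.
  have := h' ltac:(by apply/andP; split; lra).
  by rewrite addrCA subrr addr0.
Qed.

(** The essential limits are turned into actual points of a set G of full
    measure, arbitrarily close to the start of the line. *)
Lemma ess_common_limit (g1 g2 : R -> R) (a b l : R) (G : set R) : a < b ->
  lebesgue_measure.-negligible (`]a, b[ `\` G) ->
  ess_cvg_right0 (fun s => g1 (a + s)) l -> ess_cvg_right0 (fun s => g2 (a + s)) l ->
  forall e t, 0 < e -> a < t -> exists s, [/\ G s, s < t & `|g1 s - g2 s| < e].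
Proof.
move=> ab Gn h1 h2 e t e0 at_; have e20 : 0 < e / 2 by rewrite divr_gt0.
have [d1 d10 [N1 [mN1 N10 N1P]]] := ess_cvg_right0_shift h1 e20.
have [d2 d20 [N2 [mN2 N20 N2P]]] := ess_cvg_right0_shift h2 e20.
pose G' := (G `\` (N1 `|` N2)) `&` `]a, b[.
have G'n : lebesgue_measure.-negligible (`]a, b[ `\` G').
  have : lebesgue_measure.-negligible ((`]a, b[ `\` G) `|` (N1 `|` N2)).
    by apply: negligibleU => //; apply: negligibleU; [exists N1|exists N2]; split.
  apply: negligibleS => s [sab nG]; have [Gs|] := pselect (G s); last by left.
  by right; apply: contrapT => nN; apply: nG.
pose c := Num.min (Num.min t b) (Num.min (a + d1) (a + d2)).
have ac : a < c by rewrite !lt_min ab at_ !ltrDl d10 d20.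
have cb : c <= b by rewrite !ge_min lexx orbT.
have [s [[Gs nN] _] /andP[as_ sc]] := line_dense G'n (lexx a) ac cb.
move: sc; rewrite !lt_min => /andP[/andP[st sb] /andP[s1 s2]].
exists s; split => //.
have e1 : `|g1 s - l| < e / 2.
  apply: contrapT => h; apply: nN; left; apply: N1P => /= h'; apply: h; apply: h'.
  by rewrite as_.
have e2 : `|g2 s - l| < e / 2.
  apply: contrapT => h; apply: nN; right; apply: N2P => /= h'; apply: h; apply: h'.
  by rewrite as_.
have -> : g1 s - g2 s = (g1 s - l) - (g2 s - l) by ring.
by apply: le_lt_trans (ler_normB _ _) _; rewrite [ltRHS]splitr; exact: ltrD.
Qed.

Variables (T : R) (Omega : set space).
Hypotheses (oO : open Omega) (bO : bounded_set Omega) (sO : smooth_boundary Omega).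
Hypothesis cO : convex_set (Omega : set (convex_lmodType 'rV[R]_d)).

(** The start of the part of a characteristic in the space-time domain: the
    initial time if the line starts inside, and the entry time otherwise. *)
Definition line_start (q : space * space) : R :=
  if `[< Omega q.1 >] then 0 else entry_time Omega q.

Lemma char_times_hits q : sphere q.2 -> char_times T Omega q !=set0 -> hits Omega q.
Proof. by move=> sk [s [_ cs]]; split => //; exists s. Qed.

Lemma line_start_ge0 q : sphere q.2 -> char_times T Omega q !=set0 -> 0 <= line_start q.
Proof.
move=> sk ct; have hq := char_times_hits sk ct; have [s [/andP[s0 _] cs]] := ct.
rewrite /line_start; case: asboolP => // nO.
rewrite leNgt; apply/negP => e0; apply: nO.
have := chord_after_entry bO cO hq cs e0 (ltW s0).
by rewrite /chord /= /char_point scale0r addr0.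
Qed.

Lemma char_times_interval q : sphere q.2 -> char_times T Omega q !=set0 ->
  exists b, [/\ line_start q < b, b <= T & char_times T Omega q = `]line_start q, b[%classic].
Proof.
move=> sk ct; have hq := char_times_hits sk ct; have [s0 cs0] := ct.
have a0 := line_start_ge0 sk ct.
set A := char_times T Omega q in ct cs0 *.
have ubT : ubound A T by move=> s [/andP[_ /ltW]].
have sA : has_sup A by split => //; exists T.
have Astart s : A s -> line_start q < s.
  move=> [/andP[sp _] cs]; rewrite /line_start; case: asboolP => // _.
  exact: (entry_time_lt oO bO hq cs).
have Aend s : A s -> s < sup A.
  move=> As; have /nbhs_ballP[e /= e0 es] : nbhs s A.
    by apply: open_nbhs_nbhs; split => //; exact: open_char_times.
  apply: (@lt_le_trans _ _ (s + e / 2)); first by rewrite ltrDl divr_gt0.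
  apply: ub_le_sup; first by exists T.
  apply: es; rewrite /ball/= opprD addNKr normrN gtr0_norm ?divr_gt0//.
  by rewrite ltr_pdivrMr// ltr_pMr// ltr1n.
exists (sup A); split.
- exact: lt_trans (Astart _ cs0) (Aend _ cs0).
- by apply: ge_sup.
apply/seteqP; split => s; rewrite /= in_itv/=.
  by move=> As; rewrite Astart// Aend.
move=> /andP[as_ sb].
have [t [/andP[t0 tT] ctt] st] := sup_gt ct sb.
split; first by rewrite (le_lt_trans a0 as_) (lt_trans st tT).
move: as_; rewrite /line_start; case: asboolP => [Oq s_gt0|_ es].
  apply: (convex_line (b := t) cO (a := 0)) => //.
    by rewrite /char_point scale0r addr0.
  by rewrite (ltW s_gt0) (ltW st).
exact: (chord_after_entry bO cO hq ctt es (ltW st)).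
Qed.

Hypothesis d0 : (0 < d)%N.

(** A line that starts inside uses the initial trace; otherwise it enters at a
    positive time through a point of the inflow boundary. *)
Lemma traces_along_lines (u : R * space * space -> R) (f : space -> R) :
  inflow_trace T Omega u (fun=> 0) -> initial_trace Omega u (fun q => f q.1) ->
  {ae initial_measure, forall q : space * space, sphere q.2 -> char_times T Omega q !=set0 ->
    ess_cvg_right0 (fun s => u (char_map (q, line_start q + s)))
      (if `[< Omega q.1 >] then f q.1 else 0)}.
Proof.
move=> [N [mN N0 NP]] iu.
have mN' : measurable (N : set (RT * space * space)) := mN.
have := inflow_lines d0 oO bO sO cO mN' N0.
apply: filterS2 iu => q iq hiq sk ct.
have hq := char_times_hits sk ct.
have a0 := line_start_ge0 sk ct.
move: a0; rewrite /line_start; case: asboolP => [Oq _|nO e0].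
  have -> : (fun s => u (char_map (q, 0 + s))) = (fun s => u (s, q.1 + s *: q.2, q.2)).
    by apply/funext => s; rewrite add0r.
  by apply: iq; split.
have [en0 nN] := hiq hq.
have [s [/andP[s0 sT] cs]] := ct.
have eT : 0 < entry_time Omega q < T.
  by rewrite lt_neqAle eq_sym en0 e0/=; apply: lt_trans sT; exact: (entry_time_lt oO bO hq cs).
have := nN eT => nNq.
have inq := entry_inflow oO bO sO cO hq eT.
have : ess_cvg_right0 (fun s => u (entry_time Omega q + s, entry_point Omega q + s *: q.2, q.2)) 0.
  by apply: contrapT => h; apply: nNq; apply: NP => /= h'; apply: h; exact: h'.
congr ess_cvg_right0; apply/funext => r.
by rewrite /char_map /entry_point /char_point /= -addrA -scalerDl.
Qed.

End traces.

(** * Phase space and truncated logarithms *)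

Section domain_measure.
Context {R : realType} {d : nat}.
Notation RT := (measurableTypeR R).
Notation space := 'rV[R]_d.
Variables (T : R) (Omega : set space).
Hypotheses (oO : open Omega) (bO : bounded_set Omega).

Lemma measurable_spacetime : measurable (spacetime T Omega : set (RT * space)).
Proof. by apply: measurableX => //; exact: measurable_open. Qed.

Lemma measurable_phase_space : measurable (phase_space T Omega : set (RT * space * space)).
Proof. by apply: measurableX; [exact: measurable_spacetime|exact: measurable_sphere]. Qed.

Lemma lebesgue_rV_bounded : (lebesgue_rV d Omega < +oo)%E.
Proof.
have [M [_ OM]] := bO; pose r := `|M| + 1.
have r0 : 0 <= r by rewrite addr_ge0.
pose a : space := \row_i (- r).
have Oc : Omega `<=` cube a (r + r).
  move=> x Ox i; have h : `|x| <= r by apply: OM Ox; rewrite /r ltr_pwDr// ler_norm.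
  have : `|x ord0 i| <= r.
    apply: le_trans h; rewrite [leRHS]/Num.norm /= mx_normrE.
    by rewrite (le_bigmax _ (fun j => `|x j.1 j.2|) (ord0, i)).
  by rewrite !mxE ler_norml => /andP[h1 h2]; apply/andP; split; lra.
apply: (@le_lt_trans _ _ (lebesgue_rV d (cube a (r + r)))).
  by apply: le_measure; rewrite ?inE//; [exact: measurable_open|exact: measurable_cube].
by rewrite lebesgue_rV_cube ?ltry// addr_ge0.
Qed.

Lemma spacetime_measure_lty : (spacetime_measure (spacetime T Omega) < +oo)%E.
Proof.
have -> : spacetime_measure (spacetime T Omega) =
    (lebesgue_measure (`]0%R, T[%classic : set R) * lebesgue_rV d Omega)%E.
  apply: (@product_measure1E _ _ _ _ _ lebesgue_measure (lebesgue_rV d)) => //.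
  exact: measurable_open.
apply: lte_mul_pinfty; rewrite ?lebesgue_rV_bounded//.
by rewrite lebesgue_measure_itv/=; case: ifP.
Qed.

Lemma phase_measure_lty : (phase_measure (phase_space T Omega) < +oo)%E.
Proof.
have -> : phase_measure (phase_space T Omega) =
    (spacetime_measure (spacetime T Omega) * sphere_measure (@sphere R d))%E.
  apply: (@product_measure1E _ _ _ _ _ spacetime_measure sphere_measure) => //.
    exact: measurable_spacetime.
  exact: measurable_sphere.
apply: lte_mul_pinfty; rewrite ?measure_ge0//.
  by rewrite ge0_fin_numE//; exact: spacetime_measure_lty.
by rewrite -ge0_fin_numE ?measure_ge0//; apply: fin_num_measure; exact: measurable_sphere.
Qed.

End domain_measure.

Section clamped_log.
Context {R : realType}.

(** The value ln (v / u), truncated to [-m, m]. Where the quotient is bounded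
    this changes nothing, and the truncation is a bounded measurable function
    everywhere. *)
Definition log_ratio (m u v : R) : R := Num.max (- m) (Num.min m (ln v - ln u)).

Lemma log_ratioE c u v : 0 < c -> 0 < u -> 0 < v -> u <= c * v -> v <= c * u ->
  log_ratio (ln c) u v = ln (v / u).
Proof.
move=> c0 u0 v0 uv vu; have vu0 : 0 < v / u by rewrite divr_gt0.
have h1 : ln v - ln u <= ln c.
  have : ln v <= ln (c * u) by rewrite ler_ln ?posrE ?mulr_gt0.
  by rewrite lnM ?posrE//; lra.
have h2 : - ln c <= ln v - ln u.
  have : ln u <= ln (c * v) by rewrite ler_ln ?posrE ?mulr_gt0.
  by rewrite lnM ?posrE//; lra.
rewrite /log_ratio (min_idPr h1) (max_idPr h2).
by rewrite lnM ?posrE ?invr_gt0// lnV ?posrE.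
Qed.

Lemma log_ratio_le m u v : 0 <= m -> `|log_ratio m u v| <= m.
Proof.
move=> m0; rewrite /log_ratio ler_norml; apply/andP; split.
  by rewrite le_max lexx.
by rewrite ge_max ge_min lexx andbT; lra.
Qed.

Lemma bounded_log_ratio d (X : measurableType d) (m : R) (u v : X -> R) : 0 <= m ->
  measurable_fun setT u -> measurable_fun setT v ->
  bounded_measurable (fun x => log_ratio m (u x) (v x)).
Proof.
move=> m0 mu mv; split; last by exists m => x; exact: log_ratio_le.
apply: measurable_maxr; first exact: measurable_cst.
apply: measurable_minr; first exact: measurable_cst.
by apply: measurable_funB; exact: measurableT_comp.
Qed.

Lemma bounded_exp_log_ratio d (X : measurableType d) (m : R) (u v : X -> R) : 0 <= m ->
  measurable_fun setT u -> measurable_fun setT v ->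
  bounded_measurable (fun x => expR (log_ratio m (u x) (v x))).
Proof.
move=> m0 mu mv; have [ml lm] := bounded_log_ratio m0 mu mv; split.
  by apply: measurableT_comp ml; exact: measurable_expR.
exists (expR m) => x; rewrite ger0_norm ?expR_ge0// ler_expR.
by apply: le_trans (ler_norm _) _; exact: log_ratio_le.
Qed.

End clamped_log.

(** * Entropy production on the phase space *)

Lemma measurable_set_le {R : realType} d (Y : measurableType d) (f g : Y -> R) :
  measurable_fun setT f -> measurable_fun setT g -> measurable [set x | f x <= g x].
Proof.
by move=> mf mg; rewrite -[X in measurable X]setTI; exact: measurable_fun_le.
Qed.

Lemma integrable_preserving d1 d2 (X : measurableType d1) (Y : measurableType d2)
    (R : realType) (m1 : {measure set X -> \bar R}) (m2 : {measure set Y -> \bar R})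
    (phi : X -> Y) : measurable_fun setT phi ->
  (forall A, measurable A -> m2 A = m1 (phi @^-1` A)) ->
  forall f : Y -> \bar R, m2.-integrable setT f -> m1.-integrable setT (f \o phi).
Proof.
move=> mphi m12 f /integrableP[mf foo]; apply/integrableP; split.
  exact: measurableT_comp.
apply: le_lt_trans foo; rewrite (ge0_integral_preserving mphi m12 (f := fun y => `|f y|%E))//.
exact: measurableT_comp.
Qed.

(** Only the negative part of f, which vanishes almost everywhere, has to be
    discarded. *)
Lemma ae_integral_ge0 d (X : measurableType d) (R : realType) (mu : {measure set X -> \bar R})
    (f : X -> \bar R) : measurable_fun setT f -> {ae mu, forall x, (0 <= f x)%E} ->
  (0 <= \int[mu]_x f x)%E.
Proof.
move=> mf f0; rewrite integralE.
have -> : (\int[mu]_x f^\- x = \int[mu]_x (cst 0%E x))%E.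
  apply: ae_eq_integral => //; first exact: measurable_funeneg.
  by apply: filterS f0 => x fx _ /=; rewrite funenegE max_r// leeNl oppe0.
by rewrite integral0 sube0; exact: integral_ge0.
Qed.

Lemma ae_and d (X : measurableType d) (R : realType) (mu : {measure set X -> \bar R})
    (P Q : X -> Prop) : {ae mu, forall x, P x} -> {ae mu, forall x, Q x} ->
  {ae mu, forall x, P x /\ Q x}.
Proof. by apply: filterS2. Qed.

Section comparison_along_lines.
Context {R : realType} {d : nat}.
Notation RT := (measurableTypeR R).
Notation space := 'rV[R]_d.
Variables (T : R) (Omega : set space).
Hypotheses (oO : open Omega) (bO : bounded_set Omega).
Hypothesis cO : convex_set (Omega : set (convex_lmodType 'rV[R]_d)).
Let X : set (RT * space * space) := phase_space T Omega.

Variables (u v w z : RT * space * space -> R) (M k : R).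
Hypotheses (bu : bounded_measurable u) (bv : bounded_measurable v).
Hypotheses (bw : bounded_measurable w) (bz : bounded_measurable z).
Hypotheses (wM : forall p, `|w p| <= M) (zM : forall p, `|z p| <= M).
Hypotheses (u_out : forall p, ~ X p -> u p = 0) (v_out : forall p, ~ X p -> v p = 0).
Hypotheses (w_out : forall p, ~ X p -> w p = 0) (z_out : forall p, ~ X p -> z p = 0).
Hypotheses (uw : transport_derivative T Omega u w).
Hypotheses (vz : transport_derivative T Omega v z).
Hypothesis starts : {ae initial_measure, forall q : space * space, sphere q.2 ->
  char_times T Omega q !=set0 -> exists l,
  ess_cvg_right0 (fun s => u (char_map (q, line_start Omega q + s))) l /\
  ess_cvg_right0 (fun s => v (char_map (q, line_start Omega q + s))) l}.

Let mX : measurable X := measurable_phase_space T oO.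
Let Xoo : (phase_measure X < +oo)%E := phase_measure_lty T oO bO.

Lemma phase_space_char_times q s : X (char_map (q, s)) <-> sphere q.2 /\ char_times T Omega q s.
Proof.
rewrite /X /phase_space /spacetime /char_map /char_times /=; split.
  by move=> [[/= h1 h2] h3]; rewrite in_itv in h1.
by move=> [h1 [h2 h3]]; split => //; split => //=; rewrite in_itv.
Qed.

(** Collects what is true on almost every line for a property P that holds
    almost everywhere: the full-measure set G of times avoids all exceptional
    sets at once. *)
Lemma good_line (P : RT * space * space -> Prop) :
  {ae phase_measure, forall p, X p -> P p} ->
  {ae initial_measure, forall q : space * space, sphere q.2 ->
    char_times T Omega q !=set0 -> exists a b, exists G : set R,
    [/\ 0 <= a, a < b, b <= T & char_times T Omega q = `]a, b[%classic] /\
    [/\ G `<=` `]a, b[, lebesgue_measure.-negligible (`]a, b[ `\` G)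
      & forall s, G s -> P (char_map (q, s))] /\
    [/\ (forall s t, G s -> G t -> s < t -> u (char_map (q, t)) - u (char_map (q, s)) =
          itv_int (fun r => w (char_map (q, r))) s t),
        (forall s t, G s -> G t -> s < t -> v (char_map (q, t)) - v (char_map (q, s)) =
          itv_int (fun r => z (char_map (q, r))) s t)
      & forall e t, 0 < e -> a < t -> exists s,
          [/\ G s, s < t & `|u (char_map (q, s)) - v (char_map (q, s))| < e]]}.
Proof.
move=> /(ae_preserving measurable_char_map char_map_preserving).
move=> /(@ae_sections1 _ _ _ _ _ initial_measure lebesgue_measure).
have := characteristic_representation oO cO bu bw mX Xoo u_out w_out uw.
have := characteristic_representation oO cO bv bz mX Xoo v_out z_out vz.
move=> Vae Uae Pae.
have := ae_and (ae_and starts Pae) (ae_and Vae Uae).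
apply: filterS => q [[stq [N3 [mN3 N30 N3P]]] [[N2 [N2n Vq]] [N1 [N1n Uq]]]] sk ct.
have [b [ab bT ctE]] := char_times_interval oO bO cO sk ct.
have a0 := line_start_ge0 bO cO sk ct.
set a := line_start Omega q in a0 ab ctE *.
exists a, b, (`]a, b[ `\` (N1 `|` (N2 `|` N3))).
have Gn : lebesgue_measure.-negligible (`]a, b[ `\` (`]a, b[ `\` (N1 `|` (N2 `|` N3)))).
  have : lebesgue_measure.-negligible (N1 `|` (N2 `|` N3)).
    by apply: negligibleU => //; apply: negligibleU => //; exists N3; split.
  by apply: negligibleS => s [sab /not_andP[]//]; move=> /contrapT.
split; first by split.
split.
  split => //.
  move=> s [sab nN]; apply: contrapT => nP; apply: nN; right; right; apply: N3P => /= h.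
  by apply: nP; apply: h; apply/phase_space_char_times; rewrite ctE.
split.
- move=> s t [sab nNs] [tab nNt]; move: sab tab; rewrite -ctE => sab tab.
  by apply: Uq => // Ns; [apply: nNs|apply: nNt]; left.
- move=> s t [sab nNs] [tab nNt]; move: sab tab; rewrite -ctE => sab tab.
  by apply: Vq => // Ns; [apply: nNs|apply: nNt]; right; left.
have [l [ul vl]] := stq sk ct.
exact: (ess_common_limit ab Gn ul vl).
Qed.

Hypothesis k01 : 0 < k <= 1.
Hypothesis bounds : {ae phase_measure, forall p, X p ->
  [/\ 0 < u p <= M, 0 < v p <= M, 0 <= w p + M * u p & 0 <= z p + M * v p] /\
  (k * z p <= w p + M * u p /\ k * w p <= z p + M * v p)}.

Let bounded_line (f : RT * space * space -> R) q : bounded_measurable f ->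
  bounded_measurable (fun s : RT => f (char_map (q, s))).
Proof.
by move=> bf; exact: (bounded_measurable_section q (bounded_measurable_comp measurable_char_map bf)).
Qed.

Let c : R := expR (M * T) / k.

(** The comparison of [line_ratio] on both sides, transported back to the
    phase space. *)
Lemma ratio_bounds : {ae phase_measure, forall p, X p -> u p <= c * v p /\ v p <= c * u p}.
Proof.
have /andP[k0 k1] := k01.
have mu : measurable_fun setT u by case: bu.
have mv : measurable_fun setT v by case: bv.
apply: (ae_of_preserving measurable_char_map char_map_preserving).
  rewrite (_ : [set p | _] = X `&` ~` ([set p | u p <= c * v p] `&` [set p | v p <= c * u p])); last first.
    apply/seteqP; split => p /=; first by move=> /not_implyP.
    by move=> [h1 h2] /(_ h1).
  apply: measurableI => //; apply: measurableC; apply: measurableI.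
    by apply: measurable_set_le => //; exact: measurable_funM.
  by apply: measurable_set_le => //; exact: measurable_funM.
apply: (@ae_of_sections1 _ _ _ _ _ initial_measure lebesgue_measure).
  rewrite (_ : [set x | _] = char_map @^-1` (X `&`
    ~` ([set p | u p <= c * v p] `&` [set p | v p <= c * u p]))); last first.
    apply/seteqP; split => p /=; first by move=> /not_implyP.
    by move=> [h1 h2] /(_ h1).
  rewrite -[X in measurable X]setTI; apply: measurable_char_map => //.
  apply: measurableI => //; apply: measurableC; apply: measurableI.
    by apply: measurable_set_le => //; exact: measurable_funM.
  by apply: measurable_set_le => //; exact: measurable_funM.
have := good_line bounds; apply: filterS => q hq.
have [[sk ct]|nq] := pselect (sphere q.2 /\ char_times T Omega q !=set0); last first.
  by apply: aeW => s /phase_space_char_times[sk ct]; case: nq; split => //; exists s.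
have [a [b [G [[a0 ab bT ctE] [[Gab Gn GP] [UW VZ start]]]]]] := hq sk ct.
have k01' : 0 <= k <= 1 by rewrite ltW.
have start' e t : 0 < e -> a < t -> exists s,
    [/\ G s, s < t & `|v (char_map (q, s)) - u (char_map (q, s))| < e].
  by move=> e0 /(start e t e0)[s [h1 h2 h3]]; exists s; split => //; rewrite distrC.
have r1 t : G t -> k * v (char_map (q, t)) <= expR (M * T) * u (char_map (q, t)).
  apply: (line_ratio a0 Gab Gn (bounded_line q bw) (bounded_line q bz) _ _ _ UW VZ start bT k01') => //.
  - by move=> r /GP[[]].
  - by move=> r /GP[[]].
  - by move=> r /GP[[]].
  - by move=> r /GP[_ []].
have r2 t : G t -> k * u (char_map (q, t)) <= expR (M * T) * v (char_map (q, t)).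
  apply: (line_ratio a0 Gab Gn (bounded_line q bz) (bounded_line q bw) _ _ _ VZ UW start' bT k01') => //.
  - by move=> r /GP[[]].
  - by move=> r /GP[[]].
  - by move=> r /GP[[]].
  - by move=> r /GP[_ []].
have [N [mN N0 NP]] := Gn.
exists N; split => // s /= /not_implyP[Xs h]; apply: NP; split.
  by rewrite -ctE; have /phase_space_char_times[] := Xs.
move=> Gs; apply: h; rewrite /c mulrAC [in X in _ /\ X]mulrAC !ler_pdivlMr//.
by rewrite ![_ * k]mulrC; split; [exact: r2|exact: r1].
Qed.

Let bounds' : {ae phase_measure, forall p, X p ->
  [/\ 0 < u p <= M, 0 < v p <= M, 0 <= w p + M * u p & u p <= c * v p /\ v p <= c * u p]}.
Proof.
apply: filterS2 bounds ratio_bounds => p h1 h2 Xp.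
by have [[]] := h1 Xp; have := h2 Xp.
Qed.

(** The derivative of [entropy u v] along the characteristics, with the
    logarithm truncated at the bound of [ratio_bounds]. It vanishes off the
    phase space together with w and z. *)
Definition entropy_production (p : RT * space * space) : R :=
  (1 - expR (log_ratio (ln c) (u p) (v p))) * w p + log_ratio (ln c) (u p) (v p) * z p.

Hypothesis T0 : 0 < T.
Hypothesis M0 : 0 <= M.

Lemma c_ge1 : 1 <= c.
Proof.
have /andP[k0 k1] := k01.
rewrite /c ler_pdivlMr// mul1r; apply: le_trans k1 _.
by rewrite -[leLHS]expR0 ler_expR mulr_ge0// ltW.
Qed.

Lemma bounded_entropy_production : bounded_measurable entropy_production.
Proof.
have lc0 : 0 <= ln c by apply: ln_ge0; exact: c_ge1.
have [mu _] := bu; have [mv _] := bv.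
apply: bounded_measurableD; apply: bounded_measurableM => //.
  apply: bounded_measurableB; first exact: bounded_measurable_cst.
  exact: bounded_exp_log_ratio.
exact: bounded_log_ratio.
Qed.

Lemma entropy_production_out p : ~ X p -> entropy_production p = 0.
Proof. by move=> nX; rewrite /entropy_production w_out// z_out// !mulr0 addr0. Qed.

(** In characteristic coordinates the integral is one over lines, each of
    which contributes a nonnegative amount by [line_entropy_production]. *)
Lemma entropy_production_integral_ge0 :
  (0 <= \int[phase_measure]_p (entropy_production p)%:E)%E.
Proof.
have bE := bounded_entropy_production.
have iE := integrable_support mX Xoo bE entropy_production_out.
rewrite (integral_preserving measurable_char_map char_map_preserving iE).
have iE' := integrable_preserving measurable_char_map char_map_preserving iE.
rewrite -(@integral12_prod_meas1 _ _ _ _ _ initial_measure lebesgue_measure _ iE').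
apply: ae_integral_ge0; first exact: (@measurable_fubini_F _ _ _ _ _ initial_measure lebesgue_measure _ iE').
have := good_line bounds'; apply: filterS => q hq.
have bEq := bounded_line q bE.
have [[sk ct]|nq] := pselect (sphere q.2 /\ char_times T Omega q !=set0); last first.
  apply: integral_ge0 => s _ /=; rewrite entropy_production_out//.
  by move=> /phase_space_char_times[sk ct]; apply: nq; split => //; exists s.
have [a [b [G [[a0 ab bT ctE] [[Gab Gn GP] [UW VZ start]]]]]] := hq sk ct.
have c0 : 0 < c by apply: lt_le_trans c_ge1.
have : 0 <= itv_int (fun s => entropy_production (char_map (q, s))) a b.
  apply: (line_entropy_production ab a0 Gab Gn (bounded_line q bw) (bounded_line q bz)
    _ _ _ _ UW VZ start c0 _ _ _ bEq) => //.
  - by move=> r /GP[].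
  - by move=> r /GP[].
  - by move=> r /GP[_ _ _ []].
  - by move=> r /GP[_ _ _ []].
  - by move=> r /GP[].
  move=> r /GP[/andP[u0 _] /andP[v0 _] _ [uv vu]].
  by rewrite /entropy_production log_ratioE// lnK// posrE divr_gt0.
have Eout s : ~ `[a, b]%classic s -> entropy_production (char_map (q, s)) = 0.
  move=> nab; apply: entropy_production_out => /phase_space_char_times[_].
  by rewrite ctE => sab; apply: nab; exact: subset_itv_oo_cc sab.
rewrite /itv_int Rintegral_support// => E0.
have iEq : lebesgue_measure.-integrable setT (EFin \o (fun s : RT => entropy_production (char_map (q, s)))).
  apply: (@integrable_support _ _ _ lebesgue_measure `[a, b]%classic) => //.
  by rewrite /= lebesgue_measure_itv/=; case: ifPn => // _; rewrite -EFinB ltry.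
have fE := fineK (integrable_fin_num measurableT iEq).
have : (0 <= \int[lebesgue_measure]_s (EFin \o (fun s : RT => entropy_production (char_map (q, s)))) s)%E.
  by rewrite -fE lee_fin.
exact.
Qed.

End comparison_along_lines.

(** * Entropy dissipation at a fixed time and position *)

Section finite_measure_integral.
Context d (X : measurableType d) (R : realType) (mu : {finite_measure set X -> \bar R}).
Implicit Types f g : X -> R.

Lemma finite_integrable f : bounded_measurable f -> mu.-integrable setT (EFin \o f).
Proof.
move=> bf; apply: bounded_measurable_integrable => //.
by rewrite -ge0_fin_numE ?measure_ge0//; exact: fin_num_measure.
Qed.

Lemma finite_ae_le_Rintegral f g : bounded_measurable f -> bounded_measurable g ->
  {ae mu, forall x, f x <= g x} -> \int[mu]_x f x <= \int[mu]_x g x.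
Proof.
move=> bf bg fg; have bh := bounded_measurableB bg bf.
have iB : \int[mu]_x (g x - f x) = \int[mu]_x g x - \int[mu]_x f x.
  by apply: RintegralB => //; exact: finite_integrable.
rewrite -subr_ge0 -iB; apply: fine_ge0; apply: ae_integral_ge0.
  by apply: measurableT_comp => //; case: bh.
by apply: filterS fg => x h; rewrite lee_fin subr_ge0.
Qed.

Lemma finite_RintegralD f g : bounded_measurable f -> bounded_measurable g ->
  \int[mu]_x (f x + g x) = \int[mu]_x f x + \int[mu]_x g x.
Proof. by move=> bf bg; apply: RintegralD => //; exact: finite_integrable. Qed.

Lemma finite_RintegralB f g : bounded_measurable f -> bounded_measurable g ->
  \int[mu]_x (f x - g x) = \int[mu]_x f x - \int[mu]_x g x.
Proof. by move=> bf bg; apply: RintegralB => //; exact: finite_integrable. Qed.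

Lemma finite_RintegralZ c f : bounded_measurable f ->
  \int[mu]_x (c * f x) = c * \int[mu]_x f x.
Proof. by move=> bf; apply: RintegralZl => //; exact: finite_integrable. Qed.

End finite_measure_integral.

Section kernel_integral.
Context {R : realType} d1 d2 (X : measurableType d1) (Y : measurableType d2).
Variables (m1 : {finite_measure set X -> \bar R}) (m2 : {finite_measure set Y -> \bar R}).
Variable f : X * Y -> R.
Hypothesis bf : bounded_measurable f.

Let product_integrable : (sigma_finite_product m1 m2).-integrable setT (EFin \o f).
Proof.
have h : sigma_finite_product m1 m2 (setT `*` setT) = (m1 setT * m2 setT)%E.
  exact: (@product_measure1E _ _ _ _ _ m1 m2).
apply: bounded_measurable_integrable => //.
have : (sigma_finite_product m1 m2 (setT `*` setT) < +oo)%E.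
  rewrite h; apply: lte_mul_pinfty; rewrite ?measure_ge0 ?fin_num_measure//.
  by rewrite -ge0_fin_numE ?measure_ge0//; exact: fin_num_measure.
by rewrite setXTT.
Qed.

Lemma bounded_section1 x : bounded_measurable (fun y => f (x, y)).
Proof.
have [mf [M fM]] := bf; split; last by exists M.
exact: (measurableT_comp mf (measurable_pair1 x)).
Qed.

Lemma bounded_section2 y : bounded_measurable (fun x => f (x, y)).
Proof.
have [mf [M fM]] := bf; split; last by exists M.
exact: (measurableT_comp mf (measurable_pair2 y)).
Qed.

Lemma kernel_integral_EFin x : (\int[m2]_y (f (x, y))%:E = (\int[m2]_y f (x, y))%:E)%E.
Proof.
by rewrite fineK//; apply: integrable_fin_num => //; exact: finite_integrable (bounded_section1 x).
Qed.

Lemma kernel_integral_EFin2 y : (\int[m1]_x (f (x, y))%:E = (\int[m1]_x f (x, y))%:E)%E.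
Proof.
by rewrite fineK//; apply: integrable_fin_num => //; exact: finite_integrable (bounded_section2 y).
Qed.

Lemma bounded_kernel_integral : bounded_measurable (fun x => \int[m2]_y f (x, y)).
Proof.
have [mf [M fM]] := bf; split.
  have := @measurable_fubini_F _ _ _ _ _ m1 m2 _ product_integrable.
  move=> /(measurableT_comp (@fine_measurable R setT measurableT)).
  exact.
exists (M * fine (m2 setT)) => x; rewrite ler_norml -mulNr -!(Rintegral_cst m2 measurableT).
apply/andP; split; apply: le_Rintegral => //; try by
  [exact: finite_integrable (bounded_section1 x)|apply: finite_integrable; exact: bounded_measurable_cst].
  by move=> y _; have := fM (x, y); rewrite ler_norml => /andP[].
by move=> y _; have := fM (x, y); rewrite ler_norml => /andP[].
Qed.

Lemma kernel_fubini : \int[m1]_x \int[m2]_y f (x, y) = \int[m2]_y \int[m1]_x f (x, y).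
Proof.
have := @Fubini _ _ _ _ _ m1 m2 _ product_integrable.
rewrite /Rintegral => h; congr fine.
under eq_integral do rewrite -/(Rintegral _ _ _) -kernel_integral_EFin.
under [RHS]eq_integral do rewrite -/(Rintegral _ _ _) -kernel_integral_EFin2.
exact: h.
Qed.

End kernel_integral.

Section phase_kernel.
Context {R : realType} {d : nat}.
Notation space := 'rV[R]_d.
Variable p : R -> R.
Hypothesis pP : phase_function (d := d) p.

Lemma sphere_dot (k k' : space) : sphere k -> sphere k' -> -1 <= dot k k' <= 1.
Proof.
have e (x : space) : sphere x -> dot x x = 1.
  by move=> sx; rewrite -(sphere_sum sx); apply: eq_bigr => i _; rewrite expr2.
move=> /e sk /e sk'.
have := dot_ge0 (k + k'); have := dot_ge0 (k + (-1) *: k').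
rewrite !dotDr !(dotC (_ + _)) !dotDr !dotZr !(dotC (_ *: _)) !dotZr sk sk' (dotC k' k).
by move: (dot k k') => t; lra.
Qed.

Lemma measurable_dot : measurable_fun setT (fun kk : space * space => dot kk.1 kk.2).
Proof.
apply: measurable_sum => i; apply: measurable_funM.
  exact: measurableT_comp (measurable_rV_coord i) measurable_fst.
exact: measurableT_comp (measurable_rV_coord i) measurable_snd.
Qed.

(** The phase function, extended by 0 off pairs of unit vectors; the integrals
    over the sphere then become integrals over the whole space and the kernel
    is measurable on the product. *)
Definition kernel : space * space -> R :=
  (fun kk => p (dot kk.1 kk.2)) \_ (sphere `*` sphere).

Lemma kernelE k k' : sphere k -> sphere k' -> kernel (k, k') = p (dot k k').
Proof. by move=> sk sk'; rewrite /kernel patchE mem_set. Qed.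

Lemma kernelC k k' : kernel (k, k') = kernel (k', k).
Proof.
rewrite /kernel !patchE dotC; congr (if _ then _ else _).
by apply/idP/idP; rewrite !inE => -[].
Qed.

Lemma kernel_out k k' : ~ sphere k -> kernel (k, k') = 0.
Proof. by move=> nk; rewrite /kernel patchE memNset// => -[]. Qed.

Lemma kernel_ge0 kk : 0 <= kernel kk.
Proof.
have [_ [th0 [th1 [th00 pth]]] _] := pP.
rewrite /kernel patchE; case: ifPn => //; rewrite inE => -[s1 s2].
by have /andP[h _] := pth _ _ s1 s2; apply: le_trans h; exact: ltW.
Qed.

Lemma bounded_kernel : bounded_measurable kernel.
Proof.
have [mp [th0 [th1 [th00 pth]]] _] := pP.
have mS : measurable ((sphere : set space) `*` (sphere : set space)).
  by apply: measurableX; exact: measurable_sphere.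
split.
  apply/(measurable_restrictT _ mS).
  apply: (measurable_comp _ _ mp (g := fun kk : space * space => dot kk.1 kk.2)) => //.
  - by move=> _ [kk [s1 s2] <-]; rewrite /= in_itv/=; exact: sphere_dot.
  - by apply: measurable_funTS; exact: measurable_dot.
exists `|th1| => kk; rewrite /kernel patchE; case: ifPn => [|_]; last by rewrite normr0.
rewrite inE => -[s1 s2]; have /andP[h1 h2] := pth _ _ s1 s2.
rewrite ger0_norm ?(le_trans h2) ?ler_norm//.
by apply: le_trans h1; exact: ltW.
Qed.

Lemma kernel_integral k : sphere k -> \int[sphere_measure]_k' kernel (k, k') = 1.
Proof.
move=> sk; have [_ _ /(_ k sk) <-] := pP.
rewrite [RHS]Rintegral_mkcond; congr Rintegral; apply/funext => k'; rewrite patchE.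
case: ifPn => [|]; first by rewrite inE => sk'; rewrite kernelE.
by rewrite notin_setE => nk'; rewrite kernelC kernel_out.
Qed.

Lemma kernel_scattering (U : space -> R) k : (forall k', ~ sphere k' -> U k' = 0) -> sphere k ->
  \int[sphere_measure]_(k' in sphere) (p (dot k k') * U k') =
  \int[sphere_measure]_k' (kernel (k, k') * U k').
Proof.
move=> Uout sk; rewrite Rintegral_mkcond; congr Rintegral; apply/funext => k'; rewrite patchE.
case: ifPn => [|]; first by rewrite inE => sk'; rewrite kernelE.
by rewrite notin_setE => nk'; rewrite Uout// mulr0.
Qed.

Section fiber.
Variables (U V W Z : space -> R) (a ta s c : R).
Hypotheses (bU : bounded_measurable U) (bV : bounded_measurable V).
Hypotheses (bW : bounded_measurable W) (bZ : bounded_measurable Z).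
Hypotheses (Uout : forall k, ~ sphere k -> U k = 0) (Vout : forall k, ~ sphere k -> V k = 0).
Hypotheses (Wout : forall k, ~ sphere k -> W k = 0) (Zout : forall k, ~ sphere k -> Z k = 0).
Hypotheses (c1 : 1 <= c) (s0 : 0 < s).
Hypothesis good : {ae sphere_measure, forall k, sphere k -> [/\ 0 < U k, 0 < V k,
  U k <= c * V k /\ V k <= c * U k,
  W k + a * U k + s * (U k - \int[sphere_measure]_(k' in sphere) (p (dot k k') * U k')) = 0
  & Z k + ta * V k + s * (V k - \int[sphere_measure]_(k' in sphere) (p (dot k k') * V k')) = 0]}.
Hypothesis same_average : \int[sphere_measure]_k U k = \int[sphere_measure]_k V k.

Let lam k := log_ratio (ln c) (U k) (V k).
Let E k := (1 - expR (lam k)) * W k + lam k * Z k.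
Let F k := U k - V k + V k * lam k.

Let c0 : 0 < c. Proof. have c1' := c1; lra. Qed.
Let lc0 : 0 <= ln c. Proof. exact: ln_ge0. Qed.
Let bl : bounded_measurable lam.
Proof. by case: bU => mU _; case: bV => mV _; exact: bounded_log_ratio. Qed.
Let bel : bounded_measurable (fun k => expR (lam k)).
Proof. by case: bU => mU _; case: bV => mV _; exact: bounded_exp_log_ratio. Qed.
Let bE : bounded_measurable E.
Proof.
apply: bounded_measurableD; apply: bounded_measurableM => //.
by apply: bounded_measurableB => //; exact: bounded_measurable_cst.
Qed.
Let bF : bounded_measurable F.
Proof.
by apply: bounded_measurableD; [exact: bounded_measurableB|exact: bounded_measurableM].
Qed.

Let bK k (f : space -> R) : bounded_measurable f -> bounded_measurable (fun k' => kernel (k, k') * f k').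
Proof. by move=> bf; apply: bounded_measurableM => //; exact: (bounded_section1 bounded_kernel k). Qed.

Let fiber_pointwise : {ae sphere_measure, forall k,
  E k + (ta + s) * F k + (a - ta) * (U k - V k) <=
  s * \int[sphere_measure]_k' (kernel (k, k') * F k')}.
Proof.
have := good; apply: filterS => k; have [sk|nk] := pselect (sphere k); last first.
  move=> _; have -> : \int[sphere_measure]_k' (kernel (k, k') * F k') = 0.
    by rewrite /Rintegral integral0_eq// => k' _; rewrite kernel_out// mul0r.
  by rewrite /E /F Wout// Zout// Uout// Vout// !(mulr0, mul0r, addr0, subrr).
move=> /(_ sk)[u0 v0 [uv vu] eU eV].
have uvE : lam k = ln (V k / U k) by rewrite /lam log_ratioE.
have r0 : 0 < V k / U k by rewrite divr_gt0.
have eE : expR (lam k) = V k / U k by rewrite uvE lnK.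
pose q := V k / U k.
rewrite !kernel_scattering// in eU eV.
set KU := \int[sphere_measure]_k' (kernel (k, k') * U k') in eU.
set KV := \int[sphere_measure]_k' (kernel (k, k') * V k') in eV.
have WE : W k = - a * U k - s * U k + s * KU by lra.
have ZE : Z k = - ta * V k - s * V k + s * KV by lra.
have qU : (1 - expR (lam k)) * U k = U k - V k.
  by rewrite eE mulrBl mul1r divfK// gt_eqF.
have -> : E k + (ta + s) * F k + (a - ta) * (U k - V k) =
    s * ((1 - expR (lam k)) * KU + lam k * KV) + (a + s) * ((U k - V k) - (1 - expR (lam k)) * U k).
  by rewrite /E /F WE ZE; ring.
rewrite qU subrr mulr0 addr0 ler_pM2l//.
have -> : (1 - expR (lam k)) * KU + lam k * KV = \int[sphere_measure]_k'
    ((1 - expR (lam k)) * (kernel (k, k') * U k') + lam k * (kernel (k, k') * V k')).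
  rewrite finite_RintegralD ?finite_RintegralZ//; try exact: bK;
    apply: bounded_measurableZ; exact: bK.
apply: finite_ae_le_Rintegral.
- by apply: bounded_measurableD; apply: bounded_measurableZ; exact: bK.
- exact: bK.
have := good; apply: filterS => k'; have [sk'|nk'] := pselect (sphere k'); last first.
  by move=> _; rewrite kernelC kernel_out// !mul0r !mulr0 addr0.
move=> /(_ sk')[u0' v0' [uv' vu'] _ _].
have -> : F k' = entropy (U k') (V k') by rewrite /F /lam log_ratioE.
have := entropy_tangent u0' v0' r0; rewrite -eE expRK => h.
by have := ler_wpM2l (kernel_ge0 (k, k')) h; lra.
Qed.

(** At each direction k, put q = V k / U k. The equations turn E k into minus
    (ta + s) F k, a multiple of U k - V k, and s times the scattered value of
    (1 - q) U + (ln q) V, which is at most the scattered value of F by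
    [entropy_tangent]. On integration, the second term vanishes by the equality
    of averages, and scattering preserves the integral of F because the kernel
    is symmetric with integral 1. *)
Lemma fiber_dissipation :
  \int[sphere_measure]_k E k <= - ta * \int[sphere_measure]_k F k.
Proof.
pose KF k := \int[sphere_measure]_k' (kernel (k, k') * F k').
have bKF2 : bounded_measurable (fun kk => kernel kk * F kk.2).
  apply: bounded_measurableM; first exact: bounded_kernel.
  exact: (bounded_measurable_comp measurable_snd bF).
have bKF : bounded_measurable KF.
  exact: (bounded_kernel_integral sphere_measure sphere_measure bKF2).
have h := finite_ae_le_Rintegral _ _ fiber_pointwise.
have KFint : \int[sphere_measure]_k KF k = \int[sphere_measure]_k F k.
  rewrite (kernel_fubini sphere_measure sphere_measure bKF2)/=.
  congr Rintegral; apply/funext => k'.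
  have -> : (fun k => kernel (k, k') * F k') = (fun k => F k' * kernel (k', k)).
    by apply/funext => k; rewrite kernelC mulrC.
  rewrite finite_RintegralZ; last exact: (bounded_section1 bounded_kernel).
  have [sk'|nk'] := pselect (sphere k'); first by rewrite kernel_integral// mulr1.
  by rewrite /F Uout// Vout// mul0r subrr addr0 mul0r.
have bUV := bounded_measurableB bU bV.
have bZF := bounded_measurableZ (ta + s) bF.
have bZUV := bounded_measurableZ (a - ta) bUV.
have bs := bounded_measurableD bE bZF.
have := h (bounded_measurableD bs bZUV) (bounded_measurableZ s bKF).
rewrite finite_RintegralZ// -/KF KFint.
rewrite finite_RintegralD// finite_RintegralD// !finite_RintegralZ// finite_RintegralB//.
by rewrite same_average subrr mulr0 addr0 => ?; lra.
Qed.

End fiber.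
End phase_kernel.

(** * Uniqueness *)

Section vanishing_integrals.
Context {R : realType}.
Notation RT := (measurableTypeR R).
Variables (a b : R) (h : R -> R) (G : set R).
Hypotheses (bh : bounded_measurable (h : RT -> R)).
Hypothesis Gn : lebesgue_measure.-negligible (`]a, b[ `\` G).
Hypothesis h0 : forall s t, G s -> G t -> s < t -> itv_int h s t = 0.

Let itv_int_eq0 s t : a <= s -> s <= t -> t <= b -> itv_int h s t = 0.
Proof.
rewrite le_eqVlt [s <= t]le_eqVlt => as_ /predU1P[->|st] tb; first by rewrite itv_int0.
have [_ [M0 hM0]] := bh; pose M := `|M0|; have M_ge0 : 0 <= M by exact: normr_ge0.
have hM r : `|h r| <= M by apply: le_trans (hM0 r) (ler_norm _).
have as' : a <= s by rewrite le_eqVlt.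
apply/eqP; rewrite -normr_le0; apply/ler_addgt0Pr => e e0; rewrite add0r.
have [e1 e1E] : exists e1, e1 = e / (2 * (M + 1)) by eexists.
have M1 : 0 < 2 * (M + 1) by lra.
have e10 : 0 < e1 by rewrite e1E divr_gt0.
have [m mE] : exists m, m = (s + t) / 2 by eexists.
have sc : s < Num.min (s + e1) m by rewrite lt_min mE; apply/andP; split; lra.
have cb : Num.min (s + e1) m <= b by rewrite ge_min mE; apply/orP; right; lra.
have ac : a <= Num.max (t - e1) m by rewrite le_max mE; apply/orP; right; lra.
have ct : Num.max (t - e1) m < t by rewrite gt_max mE; apply/andP; split; lra.
have [s' Gs' /andP[ss']] := line_dense Gn as' sc cb.
rewrite lt_min => /andP[s'e s'm].
have [t' Gt' /andP[+ t't]] := line_dense Gn ac ct tb.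
rewrite gt_max => /andP[t'e t'm].
have s't' : s' < t' by apply: lt_trans t'm.
have := itv_intD bh (ltW ss') (ltW (lt_trans s't' t't)).
rewrite (itv_intD bh (ltW s't') (ltW t't)) (h0 Gs' Gt' s't') add0r => ->.
apply: le_trans (ler_normD _ _) _.
have i1 := itv_int_le bh (ltW ss') hM; have i2 := itv_int_le bh (ltW t't) hM.
have i3 : M * (s' - s) <= M * e1 by apply: ler_wpM2l => //; lra.
have i4 : M * (t - t') <= M * e1 by apply: ler_wpM2l => //; lra.
have i5 : 2 * (M + 1) * e1 = e by rewrite e1E mulrC divfK// gt_eqF.
have i6 : 2 * (M + 1) * e1 = M * e1 + M * e1 + 2 * e1 by ring.
lra.
Qed.

(** The integrals vanish between points of the dense set G, hence on all
    subintervals by continuity of the integral. *)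
Lemma itv_int_ae0 : {ae lebesgue_measure, forall s, a < s < b -> h s = 0}.
Proof.
have gen : (@measurable _ RT) `<=`
  <<s [set A | exists (i : unit) (B : set R), measurable B /\ A = (fun _ (s : RT) => (s : R)) i @^-1` B] >>.
  by move=> A mA; apply: sub_sigma_algebra; exists tt, A.
have boxE s t : box (fun _ : unit => fun s : RT => s : R) (fun=> s) (fun=> t) = `]s, t[%classic.
  by apply/seteqP; split => r /=; rewrite in_itv/=; [move=> /(_ tt)|move=> ? _].
have io s t : lebesgue_measure.-integrable `]s, t[%classic (EFin \o h).
  by apply: integrableS (itv_integrable s t bh) => //; exact: subset_itv_oo_cc.
have [mh _] := bh.
have := @box_integrals_ae0 _ RT R unit (fun _ s => s) lebesgue_measure _ gen
  (fun=> a) (fun=> b) h mh.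
rewrite !boxE => H; apply: filterS (H _ (io a b) _) => //.
- by move=> s h' ab; apply: h'; rewrite /= in_itv.
move=> a' b' /(_ tt) aa' /(_ tt) bb'.
have -> : box (fun _ : unit => fun s : RT => s : R) a' b' = `]a' tt, b' tt[%classic.
  by apply/seteqP; split => r /=; rewrite in_itv/=; [move=> /(_ tt)|move=> ? []].
have [ba|ab] := leP (b' tt) (a' tt).
  by rewrite set_itv_ge ?integral_set0// bnd_simp -leNgt.
have moo : measurable (`]a' tt, b' tt[%classic : set RT) by exact: measurable_itv.
rewrite -(fineK (integrable_fin_num moo (io _ _))).
congr (_%:E); rewrite -(itv_int_eq0 aa' (ltW ab) bb') /itv_int.
rewrite -Rintegral_itv_obnd_cbnd; first by rewrite -Rintegral_itv_bndo_bndc.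
apply: integrableS (itv_integrable (a' tt) (b' tt) bh) => //; exact: subset_itv_oc_cc.
Qed.

End vanishing_integrals.

(** On almost every line the two derivatives have the same integrals between
    almost all pairs of times. *)
Lemma transport_derivative_unique {R : realType} {d : nat} (T : R) (Omega : set 'rV[R]_d)
    (u v w z : measurableTypeR R * 'rV[R]_d * 'rV[R]_d -> R) :
  open Omega -> bounded_set Omega -> convex_set (Omega : set (convex_lmodType 'rV[R]_d)) ->
  bounded_measurable u -> bounded_measurable v -> bounded_measurable w -> bounded_measurable z ->
  (forall p, ~ phase_space T Omega p -> u p = 0) -> (forall p, ~ phase_space T Omega p -> v p = 0) ->
  (forall p, ~ phase_space T Omega p -> w p = 0) -> (forall p, ~ phase_space T Omega p -> z p = 0) ->
  transport_derivative T Omega u w -> transport_derivative T Omega v z ->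
  {ae phase_measure, forall p, phase_space T Omega p -> u p = v p} ->
  {ae phase_measure, forall p, phase_space T Omega p -> w p = z p}.
Proof.
move=> oO bO cO bu bv bw bz u_out v_out w_out z_out uw vz uv.
have mX := measurable_phase_space T oO; have Xoo := phase_measure_lty T oO bO.
have mE : measurable [set p | ~ (phase_space T Omega p -> w p = z p)].
  rewrite (_ : [set p | _] = phase_space T Omega `&`
      ~` ([set p | w p <= z p] `&` [set p | z p <= w p])).
    apply: measurableI => //; apply: measurableC.
    by case: bw => mw _; case: bz => mz _; apply: measurableI; exact: measurable_set_le.
  apply/seteqP; split => p /=.
    move=> /not_implyP[Xp ne]; split => // -[h1 h2]; apply: ne.
    by apply/eqP; rewrite eq_le h1.
  by move=> [Xp ne] /(_ Xp) e; apply: ne; rewrite e.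
apply: (ae_of_preserving measurable_char_map char_map_preserving mE).
apply: (@ae_of_sections1 _ _ _ _ _ initial_measure lebesgue_measure).
  have := measurable_char_map measurableT mE; rewrite setTI; exact.
have Uae := characteristic_representation oO cO bu bw mX Xoo u_out w_out uw.
have Vae := characteristic_representation oO cO bv bz mX Xoo v_out z_out vz.
have := @ae_sections1 _ _ _ _ _ initial_measure lebesgue_measure _
  (ae_preserving measurable_char_map char_map_preserving uv).
move=> uvae; have := ae_and uvae (ae_and Uae Vae).
apply: filterS => q [[N3 [mN3 N30 N3P]] [[N1 [N1n Uq]] [N2 [N2n Vq]]]].
have [[sk ct]|nq] := pselect (sphere q.2 /\ char_times T Omega q !=set0); last first.
  by apply: aeW => s /phase_space_char_times[sk ct]; case: nq; split => //; exists s.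
have [b [ab bT ctE]] := char_times_interval oO bO cO sk ct.
set a := line_start Omega q in ab ctE.
have bl (f : measurableTypeR R * 'rV[R]_d * 'rV[R]_d -> R) : bounded_measurable f ->
    bounded_measurable (fun s : measurableTypeR R => f (char_map (q, s))).
  by move=> bf; exact: (bounded_measurable_section q (bounded_measurable_comp measurable_char_map bf)).
have Gn : lebesgue_measure.-negligible (`]a, b[ `\` (`]a, b[ `\` (N1 `|` (N2 `|` N3)))).
  have : lebesgue_measure.-negligible (N1 `|` (N2 `|` N3)).
    by apply: negligibleU => //; apply: negligibleU => //; exists N3; split.
  by apply: negligibleS => s [sab /not_andP[]//]; move=> /contrapT.
have same s : (`]a, b[ `\` (N1 `|` (N2 `|` N3))) s -> u (char_map (q, s)) = v (char_map (q, s)).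
  move=> [sab nN]; apply: contrapT => ne; apply: nN; right; right; apply: N3P => /= h.
  by apply: ne; apply: h; apply/phase_space_char_times; rewrite ctE.
have := itv_int_ae0 (bounded_measurableB (bl _ bw) (bl _ bz)) Gn.
move=> H; have {}H : {ae lebesgue_measure, forall s, a < s < b ->
    w (char_map (q, s)) - z (char_map (q, s)) = 0}.
  apply: H => s t Gs Gt st; rewrite itv_intB; try exact: bl.
  have [sab nNs] := Gs; have [tab nNt] := Gt; move: sab tab; rewrite -ctE => sab tab.
  rewrite -Uq//; [|by move=> Ns; apply: nNs; left|by move=> Nt; apply: nNt; left].
  rewrite -Vq//; [|by move=> Ns; apply: nNs; right; left|by move=> Nt; apply: nNt; right; left].
  by rewrite !same// subrr.
move: H => [N [mN N0 NP]]; exists N; split => // s /= /not_implyP[Xs ne]; apply: NP => /= h.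
apply: ne; apply/eqP; rewrite -subr_eq0; apply/eqP; apply: h.
have /phase_space_char_times[_] := Xs.
by rewrite ctE /= in_itv.
Qed.

Section uniqueness.
Context {R : realType} {d : nat}.
Notation RT := (measurableTypeR R).
Notation space := 'rV[R]_d.
Variables (T : R) (Omega : set space).
Hypotheses (T0 : 0 < T) (oO : open Omega) (bO : bounded_set Omega).
Hypothesis cO : convex_set (Omega : set (convex_lmodType 'rV[R]_d)).
Let X : set (RT * space * space) := phase_space T Omega.

Variables (u v w z : RT * space * space -> R) (M k : R).
Hypotheses (bu : bounded_measurable u) (bv : bounded_measurable v).
Hypotheses (bw : bounded_measurable w) (bz : bounded_measurable z).
Hypotheses (M0 : 0 <= M) (wM : forall p, `|w p| <= M) (zM : forall p, `|z p| <= M).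
Hypotheses (u_out : forall p, ~ X p -> u p = 0) (v_out : forall p, ~ X p -> v p = 0).
Hypotheses (w_out : forall p, ~ X p -> w p = 0) (z_out : forall p, ~ X p -> z p = 0).
Hypotheses (uw : transport_derivative T Omega u w).
Hypotheses (vz : transport_derivative T Omega v z).
Hypothesis starts : {ae initial_measure, forall q : space * space, sphere q.2 ->
  char_times T Omega q !=set0 -> exists l,
  ess_cvg_right0 (fun s => u (char_map (q, line_start Omega q + s))) l /\
  ess_cvg_right0 (fun s => v (char_map (q, line_start Omega q + s))) l}.
Hypothesis k01 : 0 < k <= 1.
Hypothesis bounds : {ae phase_measure, forall p, X p ->
  [/\ 0 < u p <= M, 0 < v p <= M, 0 <= w p + M * u p & 0 <= z p + M * v p] /\
  (k * z p <= w p + M * u p /\ k * w p <= z p + M * v p)}.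

Variables (A tA : RT * space -> R) (Ss al : R) (pf : R -> R).
Hypotheses (Ss0 : 0 < Ss) (al0 : 0 < al) (pP : phase_function (d := d) pf).
Hypothesis equations : {ae phase_measure, forall p, X p ->
  w p + A p.1 * u p + Ss * (u p - scattering pf u p) = 0 /\
  z p + tA p.1 * v p + Ss * (v p - scattering pf v p) = 0}.
Hypothesis averages : {ae spacetime_measure, forall q, spacetime T Omega q ->
  average u q = average v q}.
Hypothesis tA_al : {ae spacetime_measure, forall q, spacetime T Omega q -> al <= tA q}.

Let c : R := expR (M * T) / k.
Let c1 : 1 <= c. Proof. exact: c_ge1. Qed.
Let lc0 : 0 <= ln c. Proof. exact: ln_ge0. Qed.

Let mX : measurable X := measurable_phase_space T oO.
Let Xoo : (phase_measure X < +oo)%E := phase_measure_lty T oO bO.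

Let good : {ae phase_measure, forall p, X p -> [/\ 0 < u p, 0 < v p,
  u p <= c * v p /\ v p <= c * u p,
  w p + A p.1 * u p + Ss * (u p - scattering pf u p) = 0 &
  z p + tA p.1 * v p + Ss * (v p - scattering pf v p) = 0]}.
Proof.
have r := ratio_bounds oO bO cO bu bv bw bz wM zM u_out v_out w_out z_out uw vz starts k01 bounds.
have := ae_and (ae_and bounds r) equations; apply: filterS => p [[h1 h2] h3] Xp.
have [[/andP[u0 _] /andP[v0 _] _ _] _] := h1 Xp.
by have [e1 e2] := h3 Xp; split => //; exact: h2.
Qed.

Let E := entropy_production T u v w z M k.
Let F (p : RT * space * space) := u p - v p + v p * log_ratio (ln c) (u p) (v p).

Let bE : bounded_measurable E.
Proof. exact: bounded_entropy_production. Qed.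

Let bF : bounded_measurable F.
Proof.
have [mu _] := bu; have [mv _] := bv.
by apply: bounded_measurableD; [exact: bounded_measurableB|
  apply: bounded_measurableM => //; exact: bounded_log_ratio].
Qed.

Let F_out p : ~ X p -> F p = 0.
Proof. by move=> nX; rewrite /F u_out// v_out// subrr mul0r addr0. Qed.

Let E_out p : ~ X p -> E p = 0.
Proof. exact: entropy_production_out. Qed.

Let F_ge0 : {ae phase_measure, forall p, 0 <= F p}.
Proof.
have := good; apply: filterS => p; have [Xp|nX] := pselect (X p).
  move=> /(_ Xp)[u0 v0 [uv vu] _ _].
  rewrite /F log_ratioE// ?(lt_le_trans ltr01 c1)//; exact: entropy_ge0.
by move=> _; rewrite F_out.
Qed.

Let fiber_average (f : RT * space * space -> R) q : (forall p, ~ X p -> f p = 0) ->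
  average f q = \int[sphere_measure]_k f (q, k).
Proof. by move=> f_out; apply: Rintegral_support => k' nk'; apply: f_out => -[]. Qed.

Let bsec (f : RT * space * space -> R) q : bounded_measurable f ->
  bounded_measurable (fun k => f (q, k)).
Proof. by move=> bf; exact: (bounded_section1 bf q). Qed.

Let fiber_le0 : {ae spacetime_measure, forall q,
  0 <= \int[sphere_measure]_k (- 1 * (E (q, k) + al * F (q, k)))}.
Proof.
have arith (e f t : R) : e <= - t * f -> al * f <= t * f -> 0 <= -1 * (e + al * f).
  by move: al => a h1 h2; lra.
have g := @ae_sections1 _ _ _ _ _ spacetime_measure sphere_measure _ good.
have f0 := @ae_sections1 _ _ _ _ _ spacetime_measure sphere_measure _ F_ge0.
have := ae_and (ae_and g f0) (ae_and averages tA_al).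
apply: filterS => q hq; have [[gq fq] [aq tq]] := hq.
have bEq := bsec q bE; have bFq := bsec q bF.
have balF := bounded_measurableZ al bFq.
rewrite finite_RintegralZ; last exact: bounded_measurableD.
rewrite finite_RintegralD// finite_RintegralZ//.
have F0 : 0 <= \int[sphere_measure]_k F (q, k).
  rewrite -[leLHS](_ : \int[sphere_measure]_(k in @setT space) (0 : R) = 0); last first.
    by rewrite /Rintegral integral0.
  apply: finite_ae_le_Rintegral => //; exact: bounded_measurable_cst.
have [Oq|nOq] := pselect (spacetime T Omega q); last first.
  rewrite /Rintegral !integral0_eq ?mulr0 ?addr0 ?mulr0// => k' _.
    by rewrite F_out// => -[].
  by rewrite E_out// => -[].
have tq' := tq Oq.
have aq' := aq Oq; rewrite !fiber_average// in aq'.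
have := @fiber_dissipation _ _ _ pP _ _ _ _ (A q) (tA q) Ss c
  (bsec q bu) (bsec q bv) (bsec q bw) (bsec q bz) _ _ _ _ c1 Ss0 _ aq'.
move=> H.
have {}H : \int[sphere_measure]_k E (q, k) <= - tA q * \int[sphere_measure]_k F (q, k).
  apply: H.
  - by move=> k' nk'; apply: u_out => -[].
  - by move=> k' nk'; apply: v_out => -[].
  - by move=> k' nk'; apply: w_out => -[].
  - by move=> k' nk'; apply: z_out => -[].
  by move: gq; apply: filterS => k' gk sk'; exact: gk.
exact: (arith _ _ _ H (ler_wpM2r F0 tq')).
Qed.

Let F_eq0 : {ae phase_measure, forall p, F p = 0}.
Proof.
have arith (e f : R) : 0 <= -1 * (e + f) -> 0 <= e -> f <= 0 by move=> h1 h2; lra.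
have iE := integrable_support mX Xoo bE E_out.
have iF := integrable_support mX Xoo bF F_out.
have balF := bounded_measurableZ al bF.
have bG := bounded_measurableZ (-1) (bounded_measurableD bE balF).
have G_out p : ~ X p -> -1 * (E p + al * F p) = 0.
  by move=> nX; rewrite E_out// F_out// mulr0 addr0 mulr0.
have iG := integrable_support mX Xoo bG G_out.
have alF_out p : ~ X p -> al * F p = 0 by move=> nX; rewrite F_out// mulr0.
have ialF := integrable_support mX Xoo balF alF_out.
have EF_out p : ~ X p -> E p + al * F p = 0.
  by move=> nX; rewrite E_out// F_out// mulr0 addr0.
have iEF := integrable_support mX Xoo (bounded_measurableD bE balF) EF_out.
have G0 : 0 <= \int[phase_measure]_p (-1 * (E p + al * F p)).
  apply: fine_ge0; rewrite -(@integral12_prod_meas1 _ _ _ _ _ spacetime_measure sphere_measure _ iG).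
  apply: ae_integral_ge0.
    exact: (@measurable_fubini_F _ _ _ _ _ spacetime_measure sphere_measure _ iG).
  have := fiber_le0; apply: filterS => q h /=.
  have : (0 <= \int[sphere_measure]_k (-1 * (E (q, k) + al * F (q, k)))%:E)%E.
    by rewrite (kernel_integral_EFin sphere_measure bG) lee_fin.
  exact.
move: G0; rewrite RintegralZl// RintegralD// RintegralZl// => G0.
have E0 : 0 <= \int[phase_measure]_p E p.
  apply: fine_ge0.
  exact: (entropy_production_integral_ge0 oO bO cO bu bv bw bz wM zM u_out v_out w_out z_out uw vz starts k01 bounds T0 M0).
have F0 : \int[phase_measure]_p F p <= 0 by rewrite -(pmulr_rle0 _ al0); exact: arith G0 E0.
have : ae_eq phase_measure setT (EFin \o F) (cst 0%E).
  have mF : measurable_fun setT (EFin \o F) by apply/measurable_EFinP; case: bF.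
  apply/(ae_eq_integral_abs _ measurableT mF).
  have -> : (\int[phase_measure]_x `|(EFin \o F) x| = \int[phase_measure]_x (F x)%:E)%E.
    apply: ae_eq_integral => //; first exact: measurableT_comp.
    by have := F_ge0; apply: filterS => p F0p _ /=; rewrite ger0_norm.
  rewrite -(fineK (integrable_fin_num measurableT iF)); congr (_%:E).
  apply/eqP; rewrite eq_le; apply/andP; split; first exact: F0.
  have F0' : {ae phase_measure, forall p, (0 <= (EFin \o F) p)%E}.
    by have := F_ge0; apply: filterS => p F0p; rewrite /= lee_fin.
  by apply: fine_ge0; exact: (ae_integral_ge0 mF F0').
by apply: filterS => p Fp; have [] := Fp Logic.I.
Qed.

(** The integral of the entropy is at most 0 by the two estimates of the
    entropy production. *)
Lemma solutions_equal : {ae phase_measure, forall p, X p -> u p = v p}.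
Proof.
have := ae_and good F_eq0; apply: filterS => p [gp Fp] Xp.
have [u0 v0 [uv vu] _ _] := gp Xp.
apply: entropy_eq0 => //; move: Fp; rewrite /F log_ratioE// ?(lt_le_trans ltr01 c1)//.
by rewrite /entropy => ->.
Qed.

Hypothesis d0 : (0 < d)%N.

(** As the absorption does not depend on the direction, it suffices to find
    one direction where the equations hold; there is one because the phase
    function has integral 1, so that the sphere has positive measure. *)
Lemma absorptions_equal : {ae spacetime_measure, forall q, spacetime T Omega q -> A q = tA q}.
Proof.
have uv := solutions_equal.
have wz := transport_derivative_unique oO bO cO bu bv bw bz u_out v_out w_out z_out uw vz uv.
have all := ae_and (ae_and good uv) wz.
have := @ae_sections1 _ _ _ _ _ spacetime_measure sphere_measure _ all.
apply: filterS => q hq Oq; apply: contrapT => ne.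
have bKf k0 (f : RT * space * space -> R) : bounded_measurable f ->
    bounded_measurable (fun k' => kernel pf (k0, k') * f (q, k')).
  move=> bf; apply: bounded_measurableM; last exact: bsec.
  exact: (bounded_section1 (bounded_kernel pP) k0).
have scat k0 : sphere k0 -> scattering pf u (q, k0) = scattering pf v (q, k0).
  have uo k' : ~ sphere k' -> u (q, k') = 0 by move=> nk'; apply: u_out => -[].
  have vo k' : ~ sphere k' -> v (q, k') = 0 by move=> nk'; apply: v_out => -[].
  move=> sk0; rewrite /scattering /= !kernel_scattering//.
  have le1 : {ae sphere_measure, forall k', kernel pf (k0, k') * u (q, k') = kernel pf (k0, k') * v (q, k')}.
    apply: filterS hq => k' [[_ h] _]; have [sk'|nk'] := pselect (sphere k').
      by rewrite h.
    by rewrite u_out ?v_out// => -[].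
  apply/eqP; rewrite eq_le; apply/andP; split; apply: finite_ae_le_Rintegral;
    try exact: bKf; by apply: filterS le1 => k' ->.
have noS : {ae sphere_measure, forall k' : space, ~ sphere k'}.
  apply: filterS hq => k' [[g uvk] wzk] sk'; apply: ne.
  have Xk : X (q, k') by [].
  have [u0 _ _] := g Xk; rewrite /= -(uvk Xk) -(wzk Xk).
  have -> : scattering pf v (q, k') = scattering pf u (q, k') by rewrite scat.
  move=> e1 e2; have : (A q - tA q) * u (q, k') = 0.
    by move: e1 e2; move: (A q) (tA q) (u _) (w _) (scattering _ _ _) => a1 a2 a3 a4 a5; lra.
  by move/eqP; rewrite mulf_eq0 (gt_eqF u0) orbF subr_eq0 => /eqP.
have sd : sphere (delta_mx ord0 (Ordinal d0) : space).
  rewrite /sphere /enorm /dot /= (bigD1 (Ordinal d0))//= big1 => [|i ni].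
    by rewrite addr0 !mxE !eqxx mulr1 sqrtr1.
  by rewrite !mxE (negbTE ni) andbF mulr0.
have := kernel_integral pP sd.
have : \int[sphere_measure]_k' kernel pf (delta_mx ord0 (Ordinal d0), k') <=
    \int[sphere_measure]_(k' in @setT space) (0 : R).
  apply: finite_ae_le_Rintegral.
  - exact: (bounded_section1 (bounded_kernel pP)).
  - exact: bounded_measurable_cst.
  by apply: filterS noS => k' nk'; rewrite kernelC kernel_out.
by rewrite /Rintegral integral0 /= => + e; rewrite e ler10.
Qed.

End uniqueness.

(** * Truncated solutions *)

Section ae_integral.
Import HBNNSimple.
Context d (X : measurableType d) (R : realType) (mu : {measure set X -> \bar R}).
Local Open Scope ereal_scope.

(** The integrands of the weak equation and the sections of a solution are
    compared almost everywhere without a discussion of measurability: a simple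
    function below f can be set to 0 on a null set. *)
Lemma ge0_ae_le_integral_any (f g : X -> \bar R) :
  (forall x, 0 <= f x) -> (forall x, 0 <= g x) -> {ae mu, forall x, f x <= g x} ->
  \int[mu]_x f x <= \int[mu]_x g x.
Proof.
move=> f0 g0 [N [mN N0 NP]]; rewrite [leLHS]ge0_integralTE//.
apply: ge_ereal_sup => _ [h hf <-].
rewrite -integralT_nnsfun.
have mNC : measurable (~` N) by exact: measurableC.
have -> : \int[mu]_x (h x)%:E = \int[mu]_(x in ~` N) (h x)%:E.
  rewrite [RHS]integral_mkcond; apply: ae_eq_integral => //.
  - exact/measurable_EFinP.
  - by apply/(measurable_restrictT _ mNC); apply: measurable_funTS; exact/measurable_EFinP.
  exists N; split => // x /=; apply: contra_notP => nNx _.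
  by rewrite patchE mem_set.
rewrite integral_mkcond; apply: ge0_integral_mono => x; rewrite patchE; case: ifPn => //.
  by move=> _; rewrite lee_fin.
rewrite inE => nNx; apply: le_trans (hf x) _; apply: contrapT => h'.
by apply: nNx; apply: NP.
Qed.

Lemma ae_eq_integral_any (f g : X -> \bar R) : {ae mu, forall x, f x = g x} ->
  \int[mu]_x f x = \int[mu]_x g x.
Proof.
move=> fg; rewrite integralE [RHS]integralE; congr (_ - _).
  apply/eqP; rewrite eq_le; apply/andP; split; apply: ge0_ae_le_integral_any => //;
    by apply: filterS fg => x; rewrite /= !funeposE => ->.
apply/eqP; rewrite eq_le; apply/andP; split; apply: ge0_ae_le_integral_any => //;
  by apply: filterS fg => x; rewrite /= !funenegE => ->.
Qed.

Lemma ae_eq_Rintegral_in (D : set X) (f g : X -> R) :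
  {ae mu, forall x, D x -> f x = g x} ->
  (\int[mu]_(x in D) f x)%R = (\int[mu]_(x in D) g x)%R.
Proof.
move=> fg; rewrite Rintegral_mkcond [RHS]Rintegral_mkcond; congr fine.
apply: ae_eq_integral_any; apply: filterS fg => x h.
by rewrite !patchE; case: ifPn => //; rewrite inE => /h ->.
Qed.

End ae_integral.

Section cleaning.
Context {R : realType} {d : nat}.
Notation RT := (measurableTypeR R).
Notation space := 'rV[R]_d.
Variables (T : R) (Omega : set space).
Hypotheses (oO : open Omega) (bO : bounded_set Omega).
Hypothesis cO : convex_set (Omega : set (convex_lmodType 'rV[R]_d)).
Let X : set (RT * space * space) := phase_space T Omega.
Let mX : measurable X := measurable_phase_space T oO.
Variable M : R.
Hypothesis M0 : 0 <= M.

(** A solution is bounded only almost everywhere on the phase space, and its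
    values elsewhere are arbitrary. This representative is bounded everywhere
    and vanishes off the phase space. *)
Definition clamp (f : RT * space * space -> R) : RT * space * space -> R :=
  (fun p => Num.max (- M) (Num.min M (f p))) \_ X.

Lemma clamp_out f p : ~ X p -> clamp f p = 0.
Proof. by move=> nX; rewrite /clamp patchE memNset. Qed.

Lemma clamp_le f p : `|clamp f p| <= M.
Proof.
rewrite /clamp patchE; case: ifPn => _; last by rewrite normr0.
rewrite ler_norml; apply/andP; split; first by rewrite le_max lexx.
by rewrite ge_max ge_min lexx andbT; have M0' := M0; lra.
Qed.

Lemma bounded_clamp f : measurable_fun X f -> bounded_measurable (clamp f).
Proof.
move=> mf; split; last by exists M => p; exact: clamp_le.
apply/(measurable_restrictT _ mX).
by apply: measurable_maxr => //; apply: measurable_minr.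
Qed.

Lemma clamp_ae f : {ae phase_measure, forall p, X p -> `|f p| <= M} ->
  {ae phase_measure, forall p, X p -> clamp f p = f p}.
Proof.
apply: filterS => p h Xp; have := h Xp; rewrite ler_norml => /andP[h1 h2].
by rewrite /clamp patchE mem_set// (min_idPr h2) (max_idPr h1).
Qed.

Variables (u w : RT * space * space -> R).
Hypotheses (mu : measurable_fun X u) (mw : measurable_fun X w).
Hypothesis uM : {ae phase_measure, forall p, X p -> `|u p| <= M}.
Hypothesis wM : {ae phase_measure, forall p, X p -> `|w p| <= M}.

Let fibers : {ae spacetime_measure, forall q, {ae sphere_measure, forall k,
  X (q, k) -> clamp u (q, k) = u (q, k)}}.
Proof. exact: (@ae_sections1 _ _ _ _ _ spacetime_measure sphere_measure _ (clamp_ae uM)). Qed.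

Lemma clamp_average : {ae spacetime_measure, forall q, spacetime T Omega q ->
  average (clamp u) q = average u q}.
Proof.
have := fibers; apply: filterS => q hq Oq; apply: ae_eq_Rintegral_in.
by apply: filterS hq => k h sk; apply: h.
Qed.

Lemma clamp_scattering pf : {ae spacetime_measure, forall q, spacetime T Omega q ->
  forall k, scattering pf (clamp u) (q, k) = scattering pf u (q, k)}.
Proof.
have := fibers; apply: filterS => q hq Oq k; apply: ae_eq_Rintegral_in.
by apply: filterS hq => k' h sk; rewrite h.
Qed.

Lemma clamp_transport_derivative : transport_derivative T Omega u w ->
  transport_derivative T Omega (clamp u) (clamp w).
Proof.
move=> uw phi tphi.
have -> : \int[phase_measure]_(p in X) (clamp u p * 'D_(1, p.2, 0) phi p) =
    \int[phase_measure]_(p in X) (u p * 'D_(1, p.2, 0) phi p).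
  by apply: ae_eq_Rintegral_in; apply: filterS (clamp_ae uM) => p h Xp; rewrite h.
have -> : \int[phase_measure]_(p in X) (clamp w p * phi p) =
    \int[phase_measure]_(p in X) (w p * phi p).
  by apply: ae_eq_Rintegral_in; apply: filterS (clamp_ae wM) => p h Xp; rewrite h.
exact: uw.
Qed.

Hypothesis u0 : {ae phase_measure, forall p, X p -> 0 < u p}.

Let fibers_ge0 : {ae spacetime_measure, forall q, {ae sphere_measure, forall k,
  0 <= clamp u (q, k)}}.
Proof.
have := @ae_sections1 _ _ _ _ _ spacetime_measure sphere_measure _ (ae_and (clamp_ae uM) u0).
apply: filterS => q; apply: filterS => k [h1 h2].
have [Xp|nX] := pselect (X (q, k)); last by rewrite clamp_out.
by rewrite h1// ltW// h2.
Qed.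

Let clamp_out_fiber q k : ~ sphere k -> clamp u (q, k) = 0.
Proof. by move=> nk; apply: clamp_out => -[]. Qed.

Let averageE q : average (clamp u) q = \int[sphere_measure]_k clamp u (q, k).
Proof. by apply: Rintegral_support => k; exact: clamp_out_fiber. Qed.

Let bounded_fiber q : bounded_measurable (fun k => clamp u (q, k)).
Proof. exact: (bounded_section1 (bounded_clamp mu)). Qed.

Lemma clamp_average_bounds : {ae spacetime_measure, forall q, spacetime T Omega q ->
  0 <= average (clamp u) q <= M * fine (sphere_measure [set: space])}.
Proof.
have := fibers_ge0; apply: filterS => q hq _; rewrite averageE; apply/andP; split.
  rewrite -[leLHS](_ : \int[sphere_measure]_(k in @setT space) (0 : R) = 0); last first.
    by rewrite /Rintegral integral0.
  by apply: finite_ae_le_Rintegral => //; exact: bounded_measurable_cst.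
rewrite -Rintegral_cst//; apply: finite_ae_le_Rintegral => //.
  exact: bounded_measurable_cst.
by apply: aeW => k; apply: le_trans (ler_norm _) _; exact: clamp_le.
Qed.

Lemma clamp_scattering_bounds pf th0 th1 : phase_function (d := d) pf ->
  (forall k k' : space, sphere k -> sphere k' -> th0 <= pf (dot k k') <= th1) ->
  {ae spacetime_measure, forall q, spacetime T Omega q -> forall k, sphere k ->
    th0 * average (clamp u) q <= scattering pf (clamp u) (q, k) <= th1 * average (clamp u) q}.
Proof.
move=> pP pth; have := fibers_ge0; apply: filterS => q hq _ k sk.
rewrite averageE /scattering /= kernel_scattering//; last exact: clamp_out_fiber.
have bK : bounded_measurable (fun k' => kernel pf (k, k') * clamp u (q, k')).
  by apply: bounded_measurableM => //; exact: (bounded_section1 (bounded_kernel pP) k).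
rewrite -!finite_RintegralZ//; apply/andP; split; apply: finite_ae_le_Rintegral => //;
    try exact: bounded_measurableZ.
  apply: filterS hq => k' h; have [sk'|nk'] := pselect (sphere k').
    by rewrite kernelE//; have /andP[h1 _] := pth _ _ sk sk'; exact: ler_wpM2r.
  by rewrite clamp_out_fiber// !mulr0.
apply: filterS hq => k' h; have [sk'|nk'] := pselect (sphere k').
  by rewrite kernelE//; have /andP[_ h1] := pth _ _ sk sk'; exact: ler_wpM2r.
by rewrite clamp_out_fiber// !mulr0.
Qed.

Lemma ess_cvg_right0_ae (g1 g2 : R -> R) (l r : R) : 0 < r ->
  {ae lebesgue_measure, forall s, 0 < s < r -> g1 s = g2 s} ->
  ess_cvg_right0 g2 l -> ess_cvg_right0 g1 l.
Proof.
move=> r0 [N1 [mN1 N10 N1P]] h e e0; have [de de0 [N2 [mN2 N20 N2P]]] := h e e0.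
exists (Num.min r de); first by rewrite lt_min r0.
have : lebesgue_measure.-negligible (N1 `|` N2).
  by apply: negligibleU; [exists N1|exists N2]; split.
move=> [N [mN N0 NP]]; exists N; split => //.
move=> s /= /not_implyP[/andP[s0]]; rewrite lt_min => /andP[sr sd] ne; apply: NP.
have [e12|n12] := pselect (g1 s = g2 s).
  right; apply: N2P => /= h'; apply: ne; rewrite e12; apply: h'; exact/andP.
by left; apply: N1P => /= h'; apply: n12; apply: h'; exact/andP.
Qed.

(** The trace is determined by the values at almost every time of the line,
    and those agree on almost every line. *)
Lemma clamp_start l : {ae initial_measure, forall q : space * space,
  sphere q.2 -> char_times T Omega q !=set0 ->
  ess_cvg_right0 (fun s => u (char_map (q, line_start Omega q + s))) (l q) ->
  ess_cvg_right0 (fun s => clamp u (char_map (q, line_start Omega q + s))) (l q)}.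
Proof.
have := ae_preserving measurable_char_map char_map_preserving (clamp_ae uM).
move=> /(@ae_sections1 _ _ _ _ _ initial_measure lebesgue_measure).
apply: filterS => q [N [mN N0 NP]] sk ct.
have [b [ab bT ctE]] := char_times_interval oO bO cO sk ct.
apply: (@ess_cvg_right0_ae _ _ _ (b - line_start Omega q)); first by rewrite subr_gt0.
set a := line_start Omega q in ab ctE *.
exists [set s | N (s + a)]; split.
- rewrite -[X in measurable X]setTI.
  apply: (_ : measurable_fun setT (fun s : RT => (s + a : RT))) => //.
  by apply: measurable_funD => //; exact: measurable_cst.
- by rewrite -N0 [RHS](lebesgue_measure_shift a).
move=> s /= /not_implyP[/andP[s0 sb] ne]; apply: NP => /= h.
apply: ne; rewrite [a + s]addrC; apply: h; apply/phase_space_char_times; split => //.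
by rewrite ctE /= in_itv/=; apply/andP; split; lra.
Qed.

End cleaning.

(** * Identification of the absorption *)

Lemma ae_norm_le d (X : measurableType d) (R : realType) (mu : {measure set X -> \bar R})
    (D : set X) (f : X -> R) (a b : R) : a <= b ->
  {ae mu, forall x, D x -> `|f x| <= a} -> {ae mu, forall x, D x -> `|f x| <= b}.
Proof. by move=> ab; apply: filterS => x h Dx; exact: le_trans (h Dx) ab. Qed.

Lemma ae_fst d1 d2 (T1 : measurableType d1) (T2 : measurableType d2) (R : realType)
    (m1 : {sigma_finite_measure set T1 -> \bar R}) (m2 : {sigma_finite_measure set T2 -> \bar R})
    (P : T1 -> Prop) : {ae m1, forall x, P x} ->
  {ae sigma_finite_product m1 m2, forall z, P z.1}.
Proof.
move=> [N [mN N0 NP]]; have mNT : measurable (N `*` [set: T2]) by exact: measurableX.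
exists (N `*` setT); split => //.
  apply/(null_sections2 _ _ mNT); apply: aeW => y; rewrite -N0.
  by congr (m1 _); apply/seteqP; split => x //= -[].
by move=> z h; split => //; exact: NP.
Qed.

Lemma ae_phase_fst {R : realType} {d : nat} (P : measurableTypeR R * 'rV[R]_d -> Prop) :
  {ae spacetime_measure, forall q, P q} -> {ae phase_measure, forall q, P q.1}.
Proof. by move=> h; exact: (@ae_fst _ _ _ _ _ spacetime_measure sphere_measure P h). Qed.

(** The lower bound comes from the constant coefficient, all the others being
    nonnegative as the average m is. *)
Lemma absorption_bounds {R : realType} {d : nat} (T : R) (Omega : set 'rV[R]_d) L
    (Sigma : 'I_L.+1 -> R * 'rV[R]_d -> R) (G : R) : 0 <= G ->
  (forall l, absorption_coefficient T Omega (Sigma l)) ->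
  exists c C, [/\ 0 < c, 0 <= C & {ae spacetime_measure, forall q, spacetime T Omega q ->
    forall m, 0 <= m q <= G -> c <= absorption Sigma m q <= C}].
Proof.
move=> G0 SP.
have bnd l : exists cC : R * R, 0 < cC.1 /\
    {ae spacetime_measure, forall q, spacetime T Omega q -> cC.1 <= Sigma l q <= cC.2}.
  by have [_ [c [C [c0 h]]]] := SP l; exists (c, C).
have [b bP] := choice bnd.
exists (b ord0).1, (\sum_l `|(b l).2| * G ^+ l); split.
- by case: (bP ord0).
- by apply: sumr_ge0 => l _; rewrite mulr_ge0// exprn_ge0.
have := ae_countable (fun l => (bP l).2); apply: filterS => q hq Oq m /andP[m0 mG].
have lo l : 0 <= Sigma l q.
  have /andP[h _] := hq l Oq; apply: le_trans h.
  by have [h _] := bP l; exact: ltW.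
apply/andP; split.
  rewrite /absorption big_ord_recl expr0 mulr1.
  have /andP[h _] := hq ord0 Oq; apply: le_trans h _; rewrite lerDl.
  by apply: sumr_ge0 => l _; rewrite mulr_ge0// exprn_ge0.
apply: ler_sum => l _; apply: ler_pM => //; first by rewrite exprn_ge0.
  by have /andP[_ h] := hq l Oq; apply: le_trans h (ler_norm _).
by rewrite lerXn2r ?nnegrE.
Qed.

(** By the equation, ww + M uu is at least s kk and ww is at most s kk, where
    the scattered intensity kk is comparable to the average g. Two solutions
    with the same average thus control each other's derivatives, which is the
    hypothesis of the ratio bounds. *)
Lemma growth_bounds (R : realFieldType) (M s th0 th a g kk uu ww : R) :
  0 < s -> 0 < th -> 0 < th0 -> 0 <= a -> 0 <= M - a - s -> 0 < uu ->
  ww + a * uu + s * (uu - kk) = 0 -> th0 * g <= kk <= th * g ->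
  s * (th0 * g) <= ww + M * uu /\ th0 / th * ww <= s * (th0 * g).
Proof.
move=> s0 th_gt0 th00 a0 aM u0 e /andP[k1 k2].
have -> : ww = s * kk - (a + s) * uu by rewrite -[RHS]add0r -e; ring.
split.
  apply: (@le_trans _ _ (s * kk)); first by rewrite ler_pM2l.
  rewrite -subr_ge0 (_ : _ - _ = (M - a - s) * uu); last by ring.
  by rewrite mulr_ge0// ltW.
have -> : s * (th0 * g) = th0 / th * (s * (th * g)) by field; rewrite gt_eqF.
rewrite ler_pM2l ?divr_gt0//.
apply: (@le_trans _ _ (s * kk)); last by rewrite ler_pM2l.
by rewrite gerBl mulr_ge0// ?addr_ge0// ltW.
Qed.

Theorem theorem4p1 (R : realType) (d : nat) (d_gt0 : (0 < d)%N)
  (T : R) (T_gt0 : 0 < T)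
  (Omega : set 'rV[R]_d) (domain : bounded_convex_smooth_domain Omega)
  (L : nat) (Sigma tSigma : 'I_L.+1 -> R * 'rV[R]_d -> R)
  (SigmaP : forall l, absorption_coefficient T Omega (Sigma l))
  (tSigmaP : forall l, absorption_coefficient T Omega (tSigma l))
  (Sigma_s : R) (Sigma_s_gt0 : 0 < Sigma_s)
  (p : R -> R) (pP : phase_function (d := d) p)
  (f : 'rV[R]_d -> R) (f_Linfty : Linfty (lebesgue_rV d) Omega f)
  (f_gt0 : {ae lebesgue_rV d, forall x, Omega x -> 0 < f x})
  (u tu : R * 'rV[R]_d * 'rV[R]_d -> R)
  (uP : unique_positive_solution T Omega Sigma Sigma_s p f u)
  (tuP : unique_positive_solution T Omega tSigma Sigma_s p f tu) :
  {ae spacetime_measure, forall q, spacetime T Omega q ->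
     average u q = average tu q} ->
  {ae spacetime_measure, forall q, spacetime T Omega q ->
     absorption Sigma (average u) q = absorption tSigma (average tu) q}.
Proof.
move=> same_average; have [oO _ bO cO sO] := domain.
have [[[[[mu [Mu uMu]] _ _ _] [w [uw [mw [Mw wMw]] eqw]] u_in u_ini] u0] _] := uP.
have [[[[[mtu [Mtu tuMtu]] _ _ _] [tw [tutw [mtw [Mtw twMtw]] eqtw]] tu_in tu_ini] tu0] _] := tuP.
have [_ [th0 [th1 [th00 pth]]] _] := pP.
(* a common bound of both solutions and of their derivatives *)
have [M1 M1E] : exists M1, M1 = `|Mu| + `|Mw| + `|Mtu| + `|Mtw| by eexists.
have M10 : 0 <= M1 by rewrite M1E !addr_ge0.
have n1 := normr_ge0 Mu; have n2 := normr_ge0 Mw; have n3 := normr_ge0 Mtu; have n4 := normr_ge0 Mtw.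
have leMu : Mu <= M1 by rewrite M1E; have := ler_norm Mu; lra.
have leMw : Mw <= M1 by rewrite M1E; have := ler_norm Mw; lra.
have leMtu : Mtu <= M1 by rewrite M1E; have := ler_norm Mtu; lra.
have leMtw : Mtw <= M1 by rewrite M1E; have := ler_norm Mtw; lra.
have uM1 : {ae phase_measure, forall p, phase_space T Omega p -> `|u p| <= M1}.
  exact: ae_norm_le leMu uMu.
have wM1 : {ae phase_measure, forall p, phase_space T Omega p -> `|w p| <= M1}.
  exact: ae_norm_le leMw wMw.
have tuM1 : {ae phase_measure, forall p, phase_space T Omega p -> `|tu p| <= M1}.
  exact: ae_norm_le leMtu tuMtu.
have twM1 : {ae phase_measure, forall p, phase_space T Omega p -> `|tw p| <= M1}.
  exact: ae_norm_le leMtw twMtw.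
(* averages are at most G, which bounds the absorption independently of the
   growth rate M below *)
have [G GE] : exists G, G = M1 * fine (sphere_measure [set: 'rV[R]_d]) by eexists.
have G0 : 0 <= G by rewrite GE mulr_ge0// fine_ge0.
have [c [C [c0 C0 cC]]] := absorption_bounds G0 SigmaP.
have [tc [tC [tc0 tC0 tcC]]] := absorption_bounds G0 tSigmaP.
have gu : {ae spacetime_measure, forall q, spacetime T Omega q -> 0 <= average u q <= G}.
  have := ae_and (clamp_average uM1) (clamp_average_bounds oO M10 mu uM1 u0).
  by apply: filterS => q [h1 h2] Oq; rewrite GE -h1//; exact: h2.
have gtu : {ae spacetime_measure, forall q, spacetime T Omega q -> 0 <= average tu q <= G}.
  have := ae_and (clamp_average tuM1) (clamp_average_bounds oO M10 mtu tuM1 tu0).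
  by apply: filterS => q [h1 h2] Oq; rewrite GE -h1//; exact: h2.
(* M exceeds the total loss rates C + Sigma_s and tC + Sigma_s *)
pose M := M1 + C + tC + Sigma_s.
have M_ge0 : 0 <= M by rewrite /M; lra.
have M1M : M1 <= M by rewrite /M; lra.
have uM : {ae phase_measure, forall p, phase_space T Omega p -> `|u p| <= M}.
  exact: (ae_norm_le M1M uM1).
have wM : {ae phase_measure, forall p, phase_space T Omega p -> `|w p| <= M}.
  exact: (ae_norm_le M1M wM1).
have tuM : {ae phase_measure, forall p, phase_space T Omega p -> `|tu p| <= M}.
  exact: (ae_norm_le M1M tuM1).
have twM : {ae phase_measure, forall p, phase_space T Omega p -> `|tw p| <= M}.
  exact: (ae_norm_le M1M twM1).
pose X := phase_space T Omega.
pose u1 := clamp T Omega M u; pose w1 := clamp T Omega M w.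
pose v1 := clamp T Omega M tu; pose z1 := clamp T Omega M tw.
pose A := absorption Sigma (average u); pose tA := absorption tSigma (average tu).
have equations : {ae phase_measure, forall q, X q ->
    w1 q + A q.1 * u1 q + Sigma_s * (u1 q - scattering p u1 q) = 0 /\
    z1 q + tA q.1 * v1 q + Sigma_s * (v1 q - scattering p v1 q) = 0}.
  have sc : {ae phase_measure, forall q : measurableTypeR R * 'rV[R]_d * 'rV[R]_d, spacetime T Omega q.1 ->
      (forall k, scattering p u1 (q.1, k) = scattering p u (q.1, k)) /\
      (forall k, scattering p v1 (q.1, k) = scattering p tu (q.1, k))}.
    apply: (ae_phase_fst (P := fun q => spacetime T Omega q ->
      (forall k, scattering p u1 (q, k) = scattering p u (q, k)) /\
      (forall k, scattering p v1 (q, k) = scattering p tu (q, k)))).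
    have := ae_and (clamp_scattering uM p) (clamp_scattering tuM p).
    by apply: filterS => q [h1 h2] Oq; split; [exact: h1|exact: h2].
  have := ae_and sc (ae_and (ae_and eqw eqtw) (ae_and (ae_and (clamp_ae uM) (clamp_ae wM))
    (ae_and (clamp_ae tuM) (clamp_ae twM)))).
  apply: filterS => -[q k] [hs [[e1 e2] [[h1 h2] [h3 h4]]]] Xq.
  have [s1 s2] := hs Xq.1.
  rewrite /u1 /w1 /v1 /z1 h1// h2// h3// h4// -/u1 -/v1 s1 s2.
  by split; [exact: e1|exact: e2].
have averages : {ae spacetime_measure, forall q, spacetime T Omega q -> average u1 q = average v1 q}.
  have := ae_and (ae_and (clamp_average uM) (clamp_average tuM)) same_average.
  by apply: filterS => q [[h1 h2] h3] Oq; rewrite /u1 /v1 h1// h2// h3.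
(* the maximum makes k <= 1 evident *)
pose th := Num.max th0 th1.
have th_gt0 : 0 < th by rewrite lt_max th00.
pose k := th0 / th.
have k01 : 0 < k <= 1.
  by rewrite divr_gt0//= ler_pdivrMr// mul1r le_max lexx.
have pth' (x y : 'rV[R]_d) : sphere x -> sphere y -> th0 <= p (dot x y) <= th.
  by move=> sx sy; have /andP[-> h] := pth x y sx sy; rewrite le_max h orbT.
have facts : {ae phase_measure, forall q : measurableTypeR R * 'rV[R]_d * 'rV[R]_d, spacetime T Omega q.1 ->
   [/\ 0 <= A q.1 <= C, tc <= tA q.1 <= tC,
     forall k, sphere k -> th0 * average u1 q.1 <= scattering p u1 (q.1, k) <= th * average u1 q.1 &
     forall k, sphere k -> th0 * average u1 q.1 <= scattering p v1 (q.1, k) <= th * average u1 q.1] /\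
     0 <= average u1 q.1}.
  apply: (ae_phase_fst (P := fun q => spacetime T Omega q ->
   [/\ 0 <= A q <= C, tc <= tA q <= tC,
     forall k, sphere k -> th0 * average u1 q <= scattering p u1 (q, k) <= th * average u1 q &
     forall k, sphere k -> th0 * average u1 q <= scattering p v1 (q, k) <= th * average u1 q] /\
     0 <= average u1 q)).
  have := ae_and (ae_and (ae_and (ae_and gu gtu) (ae_and cC tcC)) (ae_and averages (clamp_average uM)))
    (ae_and (clamp_scattering_bounds oO M_ge0 mu uM u0 pP pth')
      (clamp_scattering_bounds oO M_ge0 mtu tuM tu0 pP pth')).
  apply: filterS => q [[[[g1 g2] [a1 a2]] [av cu]] [s1 s2]] Oq.
  have /andP[A1 A2] := a1 Oq _ (g1 Oq).
  split; last by rewrite /u1 cu//; have /andP[] := g1 Oq.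
  split.
  - by rewrite /A A2 andbT; apply: le_trans A1; exact: ltW.
  - exact: (a2 Oq _ (g2 Oq)).
  - exact: s1.
  - by move=> k' sk'; rewrite (av Oq); exact: s2.
have bounds : {ae phase_measure, forall q, X q ->
  [/\ 0 < u1 q <= M, 0 < v1 q <= M, 0 <= w1 q + M * u1 q & 0 <= z1 q + M * v1 q] /\
  (k * z1 q <= w1 q + M * u1 q /\ k * w1 q <= z1 q + M * v1 q)}.
  have := ae_and (ae_and facts equations) (ae_and (ae_and (clamp_ae uM) (clamp_ae tuM)) (ae_and u0 tu0)).
  apply: filterS => -[q y] [[fq eq] [[cu ctu] [pu ptu]]] Xq.
  have [[/andP[A1 A2] /andP[tA1 tA2] Ku Kv] g0] := fq Xq.1.
  have [e1 e2] := eq Xq.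
  have /andP[K1 K2] := Ku y Xq.2; have /andP[K3 K4] := Kv y Xq.2.
  have up : 0 < u1 (q, y) by rewrite /u1 cu//; exact: pu.
  have vp : 0 < v1 (q, y) by rewrite /v1 ctu//; exact: ptu.
  have ul : u1 (q, y) <= M by apply: le_trans (ler_norm _) _; exact: clamp_le.
  have vl : v1 (q, y) <= M by apply: le_trans (ler_norm _) _; exact: clamp_le.
  rewrite up vp ul vl.
  have AM : 0 <= M - A q - Sigma_s.
    by rewrite /M; move: A2 tC0 M10; move: (A q) => x; lra.
  have tAM : 0 <= M - tA q - Sigma_s.
    by rewrite /M; move: tA2 C0 M10; move: (tA q) => x; lra.
  have tA0 : 0 <= tA q by apply: le_trans tA1; exact: ltW.
  have [l1 l2] := growth_bounds Sigma_s_gt0 th_gt0 th00 A1 AM up e1 (Ku y Xq.2).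
  have [l3 l4] := growth_bounds Sigma_s_gt0 th_gt0 th00 tA0 tAM vp e2 (Kv y Xq.2).
  have sg : 0 <= Sigma_s * (th0 * average u1 q).
    by rewrite mulr_ge0// ?mulr_ge0// ltW.
  split; first by split => //; [exact: le_trans l1|exact: le_trans l3].
  by split; [exact: le_trans l1|exact: le_trans l3].
have starts : {ae initial_measure, forall q : 'rV[R]_d * 'rV[R]_d, sphere q.2 ->
    char_times T Omega q !=set0 -> exists l,
    ess_cvg_right0 (fun s => u1 (char_map (q, line_start Omega q + s))) l /\
    ess_cvg_right0 (fun s => v1 (char_map (q, line_start Omega q + s))) l}.
  pose l (q : 'rV[R]_d * 'rV[R]_d) := if `[< Omega q.1 >] then f q.1 else 0.
  have := ae_and (ae_and (traces_along_lines oO bO sO cO d_gt0 u_in u_ini)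
      (traces_along_lines oO bO sO cO d_gt0 tu_in tu_ini))
    (ae_and (clamp_start oO bO cO uM l) (clamp_start oO bO cO tuM l)).
  apply: filterS => q [[t1 t2] [h1 h2]] sq ct; exists (l q).
  by split; [exact: h1 (t1 sq ct)|exact: h2 (t2 sq ct)].
have tA_tc : {ae spacetime_measure, forall q, spacetime T Omega q -> tc <= tA q}.
  have := ae_and gtu tcC; apply: filterS => q [g1 a1] Oq.
  by have /andP[] := a1 Oq _ (g1 Oq).
have out (g : measurableTypeR R * 'rV[R]_d * 'rV[R]_d -> R) q :
  ~ phase_space T Omega q -> clamp T Omega M g q = 0 by exact: clamp_out.
exact: (absorptions_equal T_gt0 oO bO cO (bounded_clamp oO M_ge0 mu) (bounded_clamp oO M_ge0 mtu)
  (bounded_clamp oO M_ge0 mw) (bounded_clamp oO M_ge0 mtw) M_ge0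
  (clamp_le T Omega M_ge0 w) (clamp_le T Omega M_ge0 tw)
  (@out u) (@out tu) (@out w) (@out tw)
  (clamp_transport_derivative uM wM uw) (clamp_transport_derivative tuM twM tutw)
  starts k01 bounds Sigma_s_gt0 tc0 pP equations averages tA_tc d_gt0).
Qed.
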